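(* Let $1<p<\infty$ and let $U,V$ be $n\times n$ matrix $\mathrm{A}_p$ weights on $\mathbb{R}^d$. For locally integrable $n\times n$ matrix valued functions $B$, the following quantities are equivalent (each is bounded by a constant independent of $B$ times any other), all suprema being over cubes $Q\subseteq\mathbb{R}^d$: a) $\displaystyle\sup_Q\fint_Q\|\mathscr{V}_Q(B(x)-m_QB)\mathscr{U}_Q^{-1}\|\,dx$; b) $\displaystyle\sup_Q\left(\fint_Q\|V^{\frac1p}(x)(B(x)-m_QB)\mathscr{U}_Q^{-1}\|^p\,dx\right)^{\frac1p}$; c) $\displaystyle\sup_Q\left(\fint_Q\|U^{-\frac1p}(x)(B^*(x)-m_QB^* )(\mathscr{V}_Q')^{-1}\|^{p'}\,dx\right)^{\frac1{p'}}$; d) $\displaystyle\sup_Q\left(\fint_Q\left(\fint_Q\|V^{\frac1p}(x)(B(x)-B(y))U^{-\frac1p}(y)\|^{p'}\,dy\right)^{\frac p{p'}}dx\right)^{\frac1p}$; e) $\displaystyle\sup_Q\left(\fint_Q\left(\fint_Q\|V^{\frac1p}(x)(B(x)-B(y))U^{-\frac1p}(y)\|^{p}\,dx\right)^{\frac{p'}p}dy\right)^{\frac1{p'}}$.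
   Context: $\frac1p+\frac1{p'}=1$. $\fint_Q$ and $m_Q$ denote the unweighted average over $Q$; $\|\cdot\|$ on matrices is the operator norm; $B^*$ is the pointwise adjoint. An $n\times n$ matrix weight is a measurable, a.e. positive definite $n\times n$ matrix valued function $W$ on $\mathbb{R}^d$; it is a matrix $\mathrm{A}_p$ weight if $[W]_{\mathrm{A}_p}=\sup_{Q\text{ cube}}\fint_Q\left(\fint_Q\|W^{1/p}(x)W^{-1/p}(y)\|^{p'}dy\right)^{p/p'}dx<\infty$. For each cube $Q$, $\mathscr{U}_Q,\mathscr{V}_Q,\mathscr{V}_Q'$ are reducing matrices: positive definite matrices such that for all $\vec e\in\mathbb{C}^n$, $|\mathscr{U}_Q\vec e|^p\approx\fint_Q|U^{1/p}(x)\vec e|^p\,dx$, $|\mathscr{V}_Q\vec e|^p\approx\fint_Q|V^{1/p}(x)\vec e|^p\,dx$ and $|\mathscr{V}_Q'\vec e|^{p'}\approx\fint_Q|V^{-1/p}(x)\vec e|^{p'}\,dx$, with constants depending only on $n,p$. *)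

(* Defs.v *)
From HB Require Import structures.
From mathcomp Require Import all_boot all_order all_algebra.
From mathcomp Require Import sesquilinear spectral complex.
From mathcomp Require Import all_classical all_reals all_analysis.
Set Implicit Arguments.
Unset Strict Implicit.
Unset Printing Implicit Defensive.
Import Order.TTheory GRing.Theory Num.Theory.
Import numFieldNormedType.Exports.

Local Open Scope classical_set_scope.
Local Open Scope ring_scope.

Lemma sigma_finite_prod d1 d2 (T1 : measurableType d1) (T2 : measurableType d2)
    (R : realType) (m1 : {sigma_finite_measure set T1 -> \bar R})
    (m2 : {sigma_finite_measure set T2 -> \bar R}) :
  sigma_finite setT (m1 \x m2)%E.
Proof.
have /sigma_finiteP[F [TF ndF Foo]] := sigma_finiteT m1.
have /sigma_finiteP[G [TG ndG Goo]] := sigma_finiteT m2.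
exists (fun n => F n `*` G n) => [|k].
  rewrite -setXTT TF TG predeqE => -[x y]; split=> [[/= [n _ Fnx] [k _ Gky]]|].
    exists (maxn n k) => //; split.
    - by move: x Fnx; exact/subsetPset/ndF/leq_maxl.
    - by move: y Gky; exact/subsetPset/ndG/leq_maxr.
  by move=> [n _ []/= ? ?]; split; exists n.
have [? ?] := Foo k; have [? ?] := Goo k; split; first exact: measurableX.
by rewrite product_measure1E// lte_mul_pinfty// ge0_fin_numE.
Qed.

Section cons_measure.
Context (R : realType) (d : nat).
Variable m : {sigma_finite_measure set (d.-tuple R) -> \bar R}.

Definition prod_tuple (xt : measurableTypeR R * d.-tuple R) : d.+1.-tuple R :=
  [tuple of xt.1 :: xt.2].

Lemma measurable_prod_tuple : measurable_fun setT prod_tuple.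
Proof. exact: (measurable_cons measurable_fst measurable_snd). Qed.

Definition cons_measure : set (d.+1.-tuple R) -> \bar R :=
  pushforward (lebesgue_measure \x m)%E prod_tuple.

Let mcons := measurable_prod_tuple.

Let cons_measure0 : cons_measure set0 = 0%E.
Proof. exact: measure0. Qed.

Let cons_measure_ge0 A : (0 <= cons_measure A)%E.
Proof. exact: measure_ge0. Qed.

Let cons_measure_sigma_additive : semi_sigma_additive cons_measure.
Proof. exact: measure_semi_sigma_additive. Qed.

HB.instance Definition _ := isMeasure.Build _ _ _ cons_measure
  cons_measure0 cons_measure_ge0 cons_measure_sigma_additive.

Let sigma_finite_cons_measure : sigma_finite setT cons_measure.
Proof.
have [F FT Fm] : sigma_finite setT (lebesgue_measure \x m)%E.
  exact: sigma_finite_prod.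
pose g (t : d.+1.-tuple R) := (thead t, [tuple of behead t]).
have mg : measurable_fun setT g.
  apply: measurable_fun_pair => /=; first exact: measurable_tnth.
  exact: measurable_behead.
exists (fun k => g @^-1` F k) => [|k].
  by rewrite -preimage_bigcup -FT preimage_setT.
split; first by rewrite -[X in measurable X]setTI; apply: mg => //; case: (Fm k).
rewrite /cons_measure /pushforward -comp_preimage.
suff -> : g \o prod_tuple = id by case: (Fm k).
apply/funext => -[x t]; rewrite /g /prod_tuple /= theadE; congr pair.
exact/val_inj.
Qed.

HB.instance Definition _ :=
  Measure_isSigmaFinite.Build _ _ _ cons_measure sigma_finite_cons_measure.
End cons_measure.

Definition point_measure (R : realType) : set (0.-tuple R) -> \bar R :=
  \d_[tuple].
HB.instance Definition _ (R : realType) :=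
  SigmaFiniteMeasure.on (@point_measure R).

(* Lebesgue measure on the Borel sets of R^d, as the d-fold product of the
   one-dimensional Lebesgue measure. *)
Fixpoint borel_lebesgue (R : realType) (d : nat) :
    {sigma_finite_measure set (d.-tuple R) -> \bar R} :=
  if d is d'.+1 then cons_measure (borel_lebesgue R d') else @point_measure R.

(* R^d with its sigma-algebra of Lebesgue (not only Borel) measurable sets; its
   points are d-tuples. *)
Definition euclid (R : realType) (d : nat) : measurableType _ :=
  caratheodory_type (borel_lebesgue R d)^*%mu.

Definition leb (R : realType) (d : nat) : {measure set (euclid R d) -> \bar R} :=
  @completed_measure_extension _ _ _ (borel_lebesgue R d).

Definition ecoord (R : realType) (d : nat) (x : euclid R d) (i : 'I_d) : R :=
  tnth (x : d.-tuple R) i.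

Record cube (R : realType) (d : nat) := Cube {
  corner : 'I_d -> R;
  side : R;
  side_gt0 : 0 < side }.

(* Axis-parallel cubes, taken half-open: their boundaries are null sets. *)
Definition cube_set (R : realType) (d : nat) (Q : cube R d) : set (euclid R d) :=
  [set x | forall i, corner Q i <= ecoord x i < corner Q i + side Q].
Coercion cube_set : cube >-> set.

Lemma borel_box (R : realType) d (a : 'I_d -> R) (l : R) : 0 < l ->
  let A := [set x : d.-tuple R | forall i, a i <= tnth x i < a i + l] in
  measurable A /\ borel_lebesgue R d A = (l ^+ d)%:E.
Proof.
move=> l0; elim: d a => [|d IH] a /=.
  have -> : [set x : 0.-tuple R | forall i, a i <= tnth x i < a i + l] = setT.
    by apply/seteqP; split => // x _ [].
  split; first exact: measurableT.
  by rewrite /point_measure diracT.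
pose a' i := a (lift ord0 i).
have [mA EA] := IH a'.
set A := (X in measurable X).
set A' := (X in measurable X) in mA.
have mAA : measurable A.
  have -> : A = \bigcap_(i in [set: 'I_d.+1]) ((fun x => tnth x i) @^-1` `[a i, a i + l[).
    apply/seteqP; split => x /=; first by move=> h i _ /=; rewrite in_itv/=.
    by move=> h i; have := h i I; rewrite /= in_itv.
  apply: fin_bigcap_measurable => // i _.
  rewrite -[X in measurable X]setTI; apply: measurable_tnth => //.
split => //.
rewrite /cons_measure /pushforward.
have -> : (@prod_tuple R d) @^-1` A = `[a ord0, a ord0 + l[%classic `*` A'.
  apply/seteqP; split => -[x t] /=.
    move=> h; split; first by have := h ord0; rewrite in_itv.
    by move=> i; have := h (lift ord0 i); rewrite /prod_tuple tnthS.
  case; rewrite in_itv /= => hx ht i.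
  case: (unliftP ord0 i) => [j ->|->]; last by [].
  by rewrite /prod_tuple tnthS; have := ht j.
rewrite product_measure1E //=.
rewrite [X in (_ * X)%E = _]EA lebesgue_measure_itv /= lte_fin ltrDl l0.
by rewrite -EFinD -EFinM addrAC subrr add0r exprS.
Qed.

Lemma leb_cube (R : realType) d (Q : cube R d) :
  leb R d (cube_set Q) = ((side Q) ^+ d)%:E.
Proof.
have [mA EA] := @borel_box R d (corner Q) (side Q) (side_gt0 Q).
rewrite -EA /leb /= /completed_measure_extension /=.
rewrite measurable_mu_extE //.
Qed.

Section average.
Context (R : realType) (d : nat).
Local Open Scope ereal_scope.

Definition avg (A : set (euclid R d)) (f : euclid R d -> \bar R) : \bar R :=
  ((fine (leb R d A))^-1)%:E * \int[leb R d]_(x in A) f x.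

Definition sup_cube (F : cube R d -> \bar R) : \bar R := ereal_sup (range F).

(* The library only has local integrability on the line; compactness is that of
   the product topology, carried by row vectors. *)
Definition locally_integrable_euclid (f : euclid R d -> R) : Prop :=
  measurable_fun setT f /\
  forall K : set 'rV[R]_d, compact K ->
    \int[leb R d]_(x in [set x | K (\row_i ecoord x i)]) `|f x|%:E < +oo.

End average.

Local Open Scope complex_scope.
Local Open Scope sesquilinear_scope.

Section matrices.
Context (R : realType).

Definition vnorm (n : nat) (v : 'cV[R[i]]_n) : R :=
  Num.sqrt (\sum_i (complex.Re (v i 0) ^+ 2 + complex.Im (v i 0) ^+ 2)).

Definition opnorm (m n : nat) (A : 'M[R[i]]_(m, n)) : R :=
  sup [set vnorm (A *m v) | v in [set v | vnorm v <= 1]].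

(* The order of R[i] makes 0 < z mean that z is real and positive. *)
Definition posdef (n : nat) (A : 'M[R[i]]_n) : Prop :=
  A \is hermsymmx /\
  forall v : 'cV[R[i]]_n, v != 0 -> 0 < (v ^t* *m A *m v) 0 0.

(* A^s for A positive definite, applying t |-> t^s to the eigenvalues in the
   unitary diagonalization A = P^-1 D P. *)
Definition mxpow (n : nat) (A : 'M[R[i]]_n) (s : R) : 'M[R[i]]_n :=
  invmx (spectralmx A)
    *m diag_mx (map_mx (fun z => (complex.Re z `^ s)%:C) (spectral_diag A))
    *m spectralmx A.

End matrices.

Section weights.
Context (R : realType) (d n : nat).
Local Notation mxfun := (euclid R d -> 'M[R[i]]_n).
Implicit Types (p q : R) (W U V B : mxfun) (Q : cube R d).

Definition mx_measurable W : Prop := forall i j,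
  measurable_fun setT (fun x => complex.Re (W x i j)) /\
  measurable_fun setT (fun x => complex.Im (W x i j)).

Definition mx_locally_integrable B : Prop := forall i j,
  locally_integrable_euclid (fun x => complex.Re (B x i j)) /\
  locally_integrable_euclid (fun x => complex.Im (B x i j)).

Definition mx_avg Q B : 'M[R[i]]_n := \matrix_(i, j)
  (fine (avg Q (fun x => (complex.Re (B x i j))%:E))
   +i* fine (avg Q (fun x => (complex.Im (B x i j))%:E))).

Definition matrix_weight W : Prop :=
  mx_measurable W /\ {ae leb R d, forall x, posdef (W x)}.

(* q is the conjugate exponent of p. *)
Definition Ap_char p q W : \bar R := sup_cube (fun Q =>
  avg Q (fun x =>
    (avg Q (fun y =>
      (opnorm (mxpow (W x) p^-1 *m mxpow (W y) (- p^-1)) `^ q)%:E))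
    `^ (p / q)))%E.

Definition matrix_Ap p q W : Prop :=
  matrix_weight W /\ (Ap_char p q W < +oo)%E.

(* M_Q is a reducing matrix: |M_Q e|^r is comparable, up to the factor c, to the
   average of |W^s e|^r over Q. *)
Definition reducing (c r s : R) W (M : cube R d -> 'M[R[i]]_n) : Prop :=
  forall Q, posdef (M Q) /\
    forall e : 'cV[R[i]]_n,
      let a := avg Q (fun x => (vnorm (mxpow (W x) s *m e) `^ r)%:E) in
      let b := (vnorm (M Q *m e) `^ r)%:E in
      (a <= c%:E * b)%E /\ (b <= c%:E * a)%E.

Section quantities.
Variables (p q : R) (U V : mxfun) (rU rV rV' : cube R d -> 'M[R[i]]_n).
Variable B : mxfun.
Local Open Scope ereal_scope.

Definition bmo_a : \bar R := sup_cube (fun Q =>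
  avg Q (fun x =>
    (opnorm (rV Q *m (B x - mx_avg Q B) *m invmx (rU Q)))%:E)).

Definition bmo_b : \bar R := sup_cube (fun Q =>
  (avg Q (fun x =>
    (opnorm (mxpow (V x) p^-1 *m (B x - mx_avg Q B) *m invmx (rU Q))
      `^ p)%:E)) `^ p^-1).

Definition bmo_c : \bar R := sup_cube (fun Q =>
  (avg Q (fun x =>
    (opnorm (mxpow (U x) (- p^-1)
             *m ((B x) ^t* - mx_avg Q (fun y => (B y) ^t* ))
             *m invmx (rV' Q)) `^ q)%:E)) `^ q^-1).

Definition bmo_d : \bar R := sup_cube (fun Q =>
  (avg Q (fun x =>
    (avg Q (fun y =>
      (opnorm (mxpow (V x) p^-1 *m (B x - B y) *m mxpow (U y) (- p^-1))
        `^ q)%:E)) `^ (p / q))) `^ p^-1).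

Definition bmo_e : \bar R := sup_cube (fun Q =>
  (avg Q (fun y =>
    (avg Q (fun x =>
      (opnorm (mxpow (V x) p^-1 *m (B x - B y) *m mxpow (U y) (- p^-1))
        `^ p)%:E)) `^ (q / p))) `^ q^-1).

End quantities.
End weights.

(* Main.v *)
From HB Require Import structures.
Require Import Defs.
From mathcomp Require Import all_boot all_order all_algebra complex.
From mathcomp Require Import sesquilinear spectral.
From mathcomp Require Import all_classical all_reals all_analysis.
From mathcomp Require Import measurable_realfun ring lra.
Set Implicit Arguments.
Unset Strict Implicit.
Unset Printing Implicit Defensive.
Import Order.TTheory GRing.Theory Num.Theory.
Import numFieldNormedType.Exports.
Local Open Scope classical_set_scope.
Local Open Scope ring_scope.
Local Open Scope complex_scope.
Local Open Scope sesquilinear_scope.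

(** Write v = V^(1/p), v' = V^(-1/p), u = U^(1/p), u' = U^(-1/p), and m for the
average of B over the cube Q under consideration.  Five facts about one cube
carry the weights (part on reducing matrices).  The reducing property, applied
to the columns of the inverse reducing matrix, bounds the mean of
|v rV^-1|^p, and similarly for u and v'.  The A_p condition bounds the mean of
|u' rU|^q: this norm is computed by duality, and A_p is exactly what bounds the
dual pairing (lemma Ap_dual_vec).  Consequently rV' rV is bounded, its inverse is
bounded by Hoelder's inequality, so that rV' and rV^-1 are interchangeable, and the
mean of |v rV'|^p is bounded.

With these bounds, all comparisons but one are the triangle inequality and
Hoelder's inequality.  For example, b) controls a) because
rV (B - m) rU^-1 = (rV v') (v (B - m) rU^-1); d) controls b) because
v(x) (B(x) - m) rU^-1 is the mean over y of
v(x) (B(x) - B(y)) u'(y) times u(y) rU^-1; and d) is controlled by b) and c)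
because B(x) - B(y) = (B(x) - m) - (B(y) - m).

The exception is that a) controls b), a John-Nirenberg inequality.  In
vector form it bounds the integral over Q of |v (B - m) e|^p by a multiple of the
weight w(Q) = integral over Q of |u e|^p.  Replace B by its dyadic averages of depth N
below Q and argue by induction on N.  Stop at the maximal dyadic subcubes S where
the mean of |rV (B - m) rU^-1| exceeds twice its bound X.  They cover at
most half of Q, hence carry at most rho w(Q) for some rho < 1 (lemma
wt_small_portion; this is where the A_p condition of U enters).  At points outside the
stopped cubes, and in the jump from the mean over Q to the mean over S, the reduced
oscillation is at most a multiple of X; inside S the induction hypothesis applies.
The contribution of the stopped cubes is thus (1 + rho)/2 < 1 times the bound for Q,
which is absorbed.
The dyadic averages converge to B almost everywhere along a subsequence,
and Fatou's lemma removes N.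

The hypotheses are symmetric under duality: replacing p, v, u, B by
q, u', v', and the adjoint of B exchanges b) with c) and d) with e).
Every comparison is therefore proved once, for abstract data (record two_weight), and
used twice (lemmas two_weight_direct and two_weight_dual).  The factor rV' rV
and its inverse relate a) to its dual form.  Finally a) serves as a hub through
which any two of the quantities are compared.

As the weights are defined by a functional calculus, there is one more point: the
functions x |-> W(x)^s are measurable (lemma mxmeas_mxpow).
The class of functions f with f(W) measurable is closed under algebraic operations and
limits, and powers are obtained by Heron's iteration and dyadic approximation of
the exponent. *)

(** * Euclidean norm, adjoint and operator norm of complex matrices *)

Section vnorm.
Context (R : realType).
Implicit Types (z w : R[i]).

Local Notation Re := complex.Re.
Local Notation Im := complex.Im.

Lemma cReD z w : Re (z + w) = Re z + Re w. Proof. by case: z; case: w. Qed.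
Lemma cImD z w : Im (z + w) = Im z + Im w. Proof. by case: z; case: w. Qed.
Lemma cReN z : Re (- z) = - Re z. Proof. by case: z. Qed.
Lemma cImN z : Im (- z) = - Im z. Proof. by case: z. Qed.
Lemma cReM z w : Re (z * w) = Re z * Re w - Im z * Im w.
Proof. by case: z; case: w. Qed.
Lemma cImM z w : Im (z * w) = Re z * Im w + Im z * Re w.
Proof. by case: z => a b; case: w => a' b' /=; rewrite [b * a']mulrC. Qed.
Lemma cReC z : Re (z^*) = Re z. Proof. by case: z. Qed.
Lemma cImC z : Im (z^*) = - Im z. Proof. by case: z. Qed.

Lemma cRe_sum I (r : seq I) (P : pred I) (F : I -> R[i]) :
  Re (\sum_(i <- r | P i) F i) = \sum_(i <- r | P i) Re (F i).
Proof. by elim/big_rec2 : _ => //= i x y _ <-; rewrite cReD. Qed.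
Lemma cIm_sum I (r : seq I) (P : pred I) (F : I -> R[i]) :
  Im (\sum_(i <- r | P i) F i) = \sum_(i <- r | P i) Im (F i).
Proof. by elim/big_rec2 : _ => //= i x y _ <-; rewrite cImD. Qed.

(** The real part of the Hermitian inner product.  Being real valued and
bilinear over the reals, it can be integrated directly, and it determines the norm. *)
Definition rdot n (u v : 'cV[R[i]]_n) : R :=
  \sum_i (Re (u i 0) * Re (v i 0) + Im (u i 0) * Im (v i 0)).

Lemma rdotC n (u v : 'cV[R[i]]_n) : rdot u v = rdot v u.
Proof. by apply: eq_bigr => i _; rewrite mulrC [X in _ + X]mulrC. Qed.

Lemma rdotDl n (u u' v : 'cV[R[i]]_n) : rdot (u + u') v = rdot u v + rdot u' v.
Proof.
rewrite -big_split; apply: eq_bigr => i _ /=; rewrite !mxE cReD cImD; ring.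
Qed.

Lemma rdotDr n (u v v' : 'cV[R[i]]_n) : rdot u (v + v') = rdot u v + rdot u v'.
Proof. by rewrite rdotC rdotDl !(rdotC u). Qed.

Lemma rdotZl n (a : R) (u v : 'cV[R[i]]_n) : rdot (a%:C *: u) v = a * rdot u v.
Proof.
rewrite mulr_sumr; apply: eq_bigr => i _; rewrite !mxE cReM cImM /=; ring.
Qed.

Lemma rdotZr n (a : R) (u v : 'cV[R[i]]_n) : rdot u (a%:C *: v) = a * rdot u v.
Proof. by rewrite rdotC rdotZl rdotC. Qed.

Lemma rdot_ge0 n (v : 'cV[R[i]]_n) : 0 <= rdot v v.
Proof. by apply: sumr_ge0 => i _; rewrite -!expr2 addr_ge0 ?sqr_ge0. Qed.

Lemma vnorm_rdot n (v : 'cV[R[i]]_n) : vnorm v = Num.sqrt (rdot v v).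
Proof. by []. Qed.

Lemma sqr_vnorm n (v : 'cV[R[i]]_n) : vnorm v ^+ 2 = rdot v v.
Proof. by rewrite vnorm_rdot sqr_sqrtr// rdot_ge0. Qed.

Lemma vnorm_ge0 n (v : 'cV[R[i]]_n) : 0 <= vnorm v.
Proof. exact: sqrtr_ge0. Qed.

Lemma rdot0l n (v : 'cV[R[i]]_n) : rdot 0 v = 0.
Proof. by rewrite -(scale0r v) -[0]/(0%:C) rdotZl mul0r. Qed.

Lemma vnorm0 n : vnorm (0 : 'cV[R[i]]_n) = 0.
Proof. by rewrite vnorm_rdot rdot0l sqrtr0. Qed.

Lemma vnormZ n (a : R) (v : 'cV[R[i]]_n) : vnorm (a%:C *: v) = `|a| * vnorm v.
Proof.
by rewrite !vnorm_rdot rdotZl rdotZr mulrA -expr2 sqrtrM ?sqr_ge0// sqrtr_sqr.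
Qed.

Lemma vnorm_eq0 n (v : 'cV[R[i]]_n) : (vnorm v == 0) = (v == 0).
Proof.
apply/idP/eqP => [|->]; last by rewrite vnorm0.
rewrite -sqrf_eq0 sqr_vnorm psumr_eq0; last first.
  by move=> i _; rewrite -!expr2 addr_ge0 ?sqr_ge0.
move=> /allP h; apply/colP => i; have := h i; rewrite mem_index_enum => /(_ isT).
rewrite /= -!expr2 paddr_eq0 ?sqr_ge0// !sqrf_eq0 mxE.
by case: (v i 0) => a b /= /andP[/eqP -> /eqP ->].
Qed.

(** Cauchy-Schwarz, from the nonnegative square of |v| u - |u| v. *)
Lemma rdot_le n (u v : 'cV[R[i]]_n) : rdot u v <= vnorm u * vnorm v.
Proof.
have [u0|u0] := eqVneq (vnorm u) 0.
  by rewrite u0 mul0r; move/eqP: u0; rewrite vnorm_eq0 => /eqP ->; rewrite rdot0l.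
have [v0|v0] := eqVneq (vnorm v) 0.
  rewrite v0 mulr0; move/eqP: v0; rewrite vnorm_eq0 => /eqP ->.
  by rewrite rdotC rdot0l.
have up : 0 < vnorm u by rewrite lt_neqAle eq_sym u0 vnorm_ge0.
have vp : 0 < vnorm v by rewrite lt_neqAle eq_sym v0 vnorm_ge0.
pose x := (vnorm v)%:C *: u + (- vnorm u)%:C *: v.
have := rdot_ge0 x; rewrite /x !(rdotDl, rdotDr) !(rdotZl, rdotZr) -!sqr_vnorm.
rewrite (rdotC v u) => h.
have {}h : 0 <= 2 * (vnorm u * vnorm v) * (vnorm u * vnorm v - rdot u v) by lra.
rewrite pmulr_rge0 ?subr_ge0// in h.
by rewrite mulr_gt0// mulr_gt0.
Qed.

Lemma ler_vnormD n (u v : 'cV[R[i]]_n) : vnorm (u + v) <= vnorm u + vnorm v.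
Proof.
rewrite -(@ler_pXn2r _ 2)// ?nnegrE ?addr_ge0 ?vnorm_ge0//.
rewrite sqr_vnorm rdotDl !rdotDr -!sqr_vnorm (rdotC v).
have := rdot_le u v; set a := rdot _ _; lra.
Qed.

Lemma vnormN n (v : 'cV[R[i]]_n) : vnorm (- v) = vnorm v.
Proof.
have -> : - v = (-1)%:C *: v by rewrite rmorphN rmorph1 scaleN1r.
by rewrite vnormZ normrN1 mul1r.
Qed.

Lemma ler_vnorm_sum n I (r : seq I) (P : pred I) (F : I -> 'cV[R[i]]_n) :
  vnorm (\sum_(i <- r | P i) F i) <= \sum_(i <- r | P i) vnorm (F i).
Proof.
elim/big_rec2 : _ => [|i x y _ h]; first by rewrite vnorm0.
by rewrite (le_trans (ler_vnormD _ _))// lerD2l.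
Qed.

Lemma vnorm_le_dual n (v : 'cV[R[i]]_n) t : 0 <= t ->
  (forall u, vnorm u <= 1 -> rdot u v <= t) -> vnorm v <= t.
Proof.
move=> t0 h; have [v0|v0] := eqVneq (vnorm v) 0; first by rewrite v0.
have vp : 0 < vnorm v by rewrite lt_neqAle eq_sym v0 vnorm_ge0.
have := h ((vnorm v)^-1%:C *: v).
rewrite vnormZ ger0_norm ?invr_ge0 ?vnorm_ge0// mulVf// lexx => /(_ isT).
by rewrite rdotZl -sqr_vnorm expr2 mulrA mulVf// mul1r.
Qed.

Lemma coord_le_vnorm n (v : 'cV[R[i]]_n) i :
  `|Re (v i 0)| <= vnorm v /\ `|Im (v i 0)| <= vnorm v.
Proof.
have h : Re (v i 0) ^+ 2 + Im (v i 0) ^+ 2 <= rdot v v.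
  rewrite /rdot (bigD1 i)//= -!expr2 lerDl sumr_ge0// => j _.
  by rewrite -!expr2 addr_ge0 ?sqr_ge0.
by split; rewrite -sqrtr_sqr ler_sqrt ?rdot_ge0// (le_trans _ h)// ?lerDl ?lerDr sqr_ge0.
Qed.

End vnorm.

Section adjoint.
Context (R : realType).
Local Notation Re := complex.Re.
Local Notation Im := complex.Im.

Lemma adjE m n (A : 'M[R[i]]_(m, n)) i j : (A ^t*) i j = (A j i)^*.
Proof. by rewrite !mxE. Qed.

Lemma adjM m n k (A : 'M[R[i]]_(m, n)) (B : 'M[R[i]]_(n, k)) :
  (A *m B) ^t* = B ^t* *m A ^t*.
Proof. by rewrite trmx_mul map_mxM. Qed.

Lemma adjD m n (A B : 'M[R[i]]_(m, n)) : (A + B) ^t* = A ^t* + B ^t*.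
Proof. by apply/matrixP => i j; rewrite !mxE rmorphD. Qed.

Lemma adjN m n (A : 'M[R[i]]_(m, n)) : (- A) ^t* = - A ^t*.
Proof. by apply/matrixP => i j; rewrite !mxE rmorphN. Qed.

Lemma adjB m n (A B : 'M[R[i]]_(m, n)) : (A - B) ^t* = A ^t* - B ^t*.
Proof. by rewrite adjD adjN. Qed.

Lemma rdot_adj m n (A : 'M[R[i]]_(m, n)) u v :
  rdot (A *m u) v = rdot u (A ^t* *m v).
Proof.
pose h i j :=
  Re (A i j) * Re (u j 0) * Re (v i 0) - Im (A i j) * Im (u j 0) * Re (v i 0)
  + Re (A i j) * Im (u j 0) * Im (v i 0) + Im (A i j) * Re (u j 0) * Im (v i 0).
transitivity (\sum_i \sum_j h i j).
  apply: eq_bigr => i _; rewrite !mxE cRe_sum cIm_sum !mulr_suml -big_split /=.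
  by apply: eq_bigr => j _; rewrite cReM cImM /h; ring.
rewrite exchange_big /=; apply: eq_bigr => j _.
rewrite !mxE cRe_sum cIm_sum !mulr_sumr -big_split /=.
by apply: eq_bigr => i _; rewrite !mxE cReM cImM cReC cImC /h; ring.
Qed.

End adjoint.

Section opnorm.
Context (R : realType).
Local Notation Re := complex.Re.
Local Notation Im := complex.Im.

Definition ecol n (j : 'I_n) : 'cV[R[i]]_n := delta_mx j 0.

Lemma vnorm_ecol n (j : 'I_n) : vnorm (ecol j) = 1.
Proof.
rewrite vnorm_rdot /rdot (bigD1 j)//= big1 => [|i ij].
  by rewrite !mxE !eqxx /= mulr0 !addr0 mulr1 sqrtr1.
by rewrite !mxE (negbTE ij) /= !mulr0 addr0.
Qed.

Lemma vnormZ_le n (a : R[i]) (v : 'cV[R[i]]_n) :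
  vnorm (a *: v) <= (`|Re a| + `|Im a|) * vnorm v.
Proof.
have -> : a *: v = (Re a)%:C *: v + (Im a)%:C *: ('i%C *: v).
  rewrite scalerA -scalerDl; congr (_ *: _); rewrite [LHS]complexE; ring.
rewrite (le_trans (ler_vnormD _ _))// !vnormZ mulrDl lerD2l ler_wpM2l//.
rewrite le_eqVlt; apply/orP; left; apply/eqP; congr Num.sqrt.
apply: eq_bigr => i _; rewrite !mxE cReM cImM /=; ring.
Qed.

Lemma mulmx_cols m n (A : 'M[R[i]]_(m, n)) (v : 'cV[R[i]]_n) :
  A *m v = \sum_j v j 0 *: (A *m ecol j).
Proof.
rewrite {1}(matrix_sum_delta v) mulmx_sumr; apply: eq_bigr => j _.
by rewrite big_ord1 -scalemxAr.
Qed.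

(** A complex coefficient of v is bounded by the moduli of its two
real coordinates, each at most |v|; this gives the factor 2.  The lemma makes the
supremum that defines the operator norm finite. *)
Lemma vnorm_mulmx_cols m n (A : 'M[R[i]]_(m, n)) (v : 'cV[R[i]]_n) :
  vnorm (A *m v) <= 2 * (\sum_j vnorm (A *m ecol j)) * vnorm v.
Proof.
rewrite mulmx_cols (le_trans (ler_vnorm_sum _ _ _))// mulr_sumr mulr_suml.
apply: ler_sum => j _; rewrite (le_trans (vnormZ_le _ _))//.
rewrite mulrAC ler_wpM2r ?vnorm_ge0//.
by have [h1 h2] := coord_le_vnorm v j; lra.
Qed.

Lemma opnorm_set_sup m n (A : 'M[R[i]]_(m, n)) :
  has_sup [set vnorm (A *m v) | v in [set v | vnorm v <= 1]].
Proof.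
split; first by exists (vnorm (A *m 0)); exists 0 => //=; rewrite vnorm0.
exists (2 * (\sum_j vnorm (A *m ecol j))) => _ [v /= v1 <-].
rewrite (le_trans (vnorm_mulmx_cols _ _))// ler_piMr// mulr_ge0// sumr_ge0//.
by move=> i _; exact: vnorm_ge0.
Qed.

Lemma opnorm_ge0 m n (A : 'M[R[i]]_(m, n)) : 0 <= opnorm A.
Proof.
have [_ h] := opnorm_set_sup A.
by apply: sup_ubound => //; exists 0 => /=; rewrite ?mulmx0 vnorm0.
Qed.

Lemma vnorm_mulmx m n (A : 'M[R[i]]_(m, n)) v :
  vnorm (A *m v) <= opnorm A * vnorm v.
Proof.
have [->|v0] := eqVneq v 0; first by rewrite mulmx0 !vnorm0 mulr0.
have vp : 0 < vnorm v by rewrite lt_neqAle eq_sym vnorm_eq0 v0 vnorm_ge0.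
rewrite -ler_pdivrMr//.
have [_ h] := opnorm_set_sup A.
apply: sup_ubound => //; exists ((vnorm v)^-1%:C *: v) => /=.
  by rewrite vnormZ ger0_norm ?invr_ge0 ?vnorm_ge0// mulVf// gt_eqF.
by rewrite -scalemxAr vnormZ ger0_norm ?invr_ge0 ?vnorm_ge0// mulrC.
Qed.

Lemma opnorm_le m n (A : 'M[R[i]]_(m, n)) t : 0 <= t ->
  (forall v, vnorm (A *m v) <= t * vnorm v) -> opnorm A <= t.
Proof.
move=> t0 h; apply: ge_sup; first by have [] := opnorm_set_sup A.
by move=> _ [v /= v1 <-]; rewrite (le_trans (h v))// ler_piMr.
Qed.

Lemma opnorm_le_cols m n (A : 'M[R[i]]_(m, n)) :
  opnorm A <= 2 * \sum_j vnorm (A *m ecol j).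
Proof.
apply: opnorm_le => [|v]; last exact: vnorm_mulmx_cols.
by rewrite mulr_ge0// sumr_ge0// => i _; exact: vnorm_ge0.
Qed.

Lemma opnorm_leP m n (A : 'M[R[i]]_(m, n)) t : 0 <= t ->
  (forall u v, vnorm u <= 1 -> vnorm v <= 1 -> rdot u (A *m v) <= t) ->
  opnorm A <= t.
Proof.
move=> t0 h; apply: ge_sup; first by have [] := opnorm_set_sup A.
by move=> _ [v /= v1 <-]; apply: vnorm_le_dual => // u u1; exact: h.
Qed.

Lemma rdot_opnorm m n (A : 'M[R[i]]_(m, n)) u v :
  rdot u (A *m v) <= vnorm u * opnorm A * vnorm v.
Proof.
by rewrite (le_trans (rdot_le _ _))// -mulrA ler_wpM2l ?vnorm_ge0// vnorm_mulmx.
Qed.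

Lemma opnormM m n k (A : 'M[R[i]]_(m, n)) (B : 'M[R[i]]_(n, k)) :
  opnorm (A *m B) <= opnorm A * opnorm B.
Proof.
apply: opnorm_le => [|v]; first by rewrite mulr_ge0 ?opnorm_ge0.
rewrite -mulmxA (le_trans (vnorm_mulmx _ _))// -mulrA ler_wpM2l ?opnorm_ge0//.
exact: vnorm_mulmx.
Qed.

Lemma opnormD m n (A B : 'M[R[i]]_(m, n)) : opnorm (A + B) <= opnorm A + opnorm B.
Proof.
apply: opnorm_le => [|v]; first by rewrite addr_ge0 ?opnorm_ge0.
by rewrite mulmxDl (le_trans (ler_vnormD _ _))// mulrDl lerD// vnorm_mulmx.
Qed.

Lemma opnormN m n (A : 'M[R[i]]_(m, n)) : opnorm (- A) = opnorm A.
Proof.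
congr sup; apply/seteqP; split => _ [v /= v1 <-]; exists v => //.
  by rewrite mulNmx vnormN.
by rewrite mulNmx vnormN.
Qed.

(** Both norms are the supremum of the same pairing Re <u, B v> over the unit
balls. *)
Lemma opnorm_adj m n (A : 'M[R[i]]_(m, n)) : opnorm (A ^t*) = opnorm A.
Proof.
suff h m' n' (B : 'M[R[i]]_(m', n')) : opnorm (B ^t*) <= opnorm B.
  by apply/eqP; rewrite eq_le h/= -{1}(trmxCK A) h.
apply: opnorm_leP => [|u v u1 v1]; first exact: opnorm_ge0.
rewrite -rdot_adj rdotC (le_trans (rdot_opnorm _ _ _))//.
rewrite mulrC mulrA -[leRHS]mul1r ler_wpM2r ?opnorm_ge0//.
by rewrite mulr_ile1 ?vnorm_ge0.
Qed.

Lemma vnorm_cols_le m n (A : 'M[R[i]]_(m, n)) j :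
  vnorm (A *m ecol j) <= opnorm A.
Proof. by rewrite (le_trans (vnorm_mulmx _ _))// vnorm_ecol mulr1. Qed.

End opnorm.

(** * Measurable matrix functions *)

Section measurable_complex.
Context d (T : measurableType d) (R : realType).
Local Notation Re := complex.Re.
Local Notation Im := complex.Im.

Definition cmeas (f : T -> R[i]) : Prop :=
  measurable_fun setT (fun x => Re (f x)) /\
  measurable_fun setT (fun x => Im (f x)).

Lemma cmeas_cst a : cmeas (fun=> a).
Proof. by split; exact: measurable_cst. Qed.

Lemma eq_cmeas f g : f =1 g -> cmeas f -> cmeas g.
Proof. by move=> /funext ->. Qed.

Lemma cmeasD f g : cmeas f -> cmeas g -> cmeas (fun x => f x + g x).
Proof.
move=> [f1 f2] [g1 g2]; split.
  by under eq_fun do rewrite cReD; exact: measurable_funD.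
by under eq_fun do rewrite cImD; exact: measurable_funD.
Qed.

Lemma cmeasN f : cmeas f -> cmeas (fun x => - f x).
Proof.
move=> [f1 f2]; split.
  by under eq_fun do rewrite cReN; exact: measurable_funN.
by under eq_fun do rewrite cImN; exact: measurable_funN.
Qed.

Lemma cmeasM f g : cmeas f -> cmeas g -> cmeas (fun x => f x * g x).
Proof.
move=> [f1 f2] [g1 g2]; split.
  under eq_fun do rewrite cReM.
  by apply: measurable_funB; exact: measurable_funM.
under eq_fun do rewrite cImM.
by apply: measurable_funD; exact: measurable_funM.
Qed.

Lemma cmeas_conj f : cmeas f -> cmeas (fun x => (f x)^*).
Proof.
move=> [f1 f2]; split; first by under eq_fun do rewrite cReC.
by under eq_fun do rewrite cImC; exact: measurable_funN.
Qed.

Lemma cmeas_real (f : T -> R) : measurable_fun setT f -> cmeas (fun x => (f x)%:C).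
Proof. by move=> mf; split => //=; exact: measurable_cst. Qed.

(** The inverse of z is its conjugate times |z|^-2, and the second factor is a
real power, hence measurable also where z vanishes. *)
Lemma cmeasV f : cmeas f -> cmeas (fun x => (f x)^-1).
Proof.
move=> mf; have [f1 f2] := mf.
pose g x : R := (Re (f x) ^+ 2 + Im (f x) ^+ 2) `^ (-1).
have mg : measurable_fun setT g.
  apply: (measurableT_comp (measurable_powR (-1))).
  by apply: measurable_funD; exact: measurable_funX.
apply: (@eq_cmeas (fun x => (f x)^* * (g x)%:C)); last first.
  exact: cmeasM (cmeas_conj mf) (cmeas_real mg).
move=> x; rewrite /g powR_inv1 ?addr_ge0 ?sqr_ge0//.
by case: (f x) => a b; rewrite /GRing.mul /GRing.inv /= !mulr0 subr0 add0r mulNr.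
Qed.

Lemma cmeas_sum I (r : seq I) (P : pred I) (F : I -> T -> R[i]) :
  (forall i, P i -> cmeas (F i)) -> cmeas (fun x => \sum_(i <- r | P i) F i x).
Proof.
move=> h; elim: r => [|a r IH].
  by apply: (eq_cmeas (f := fun=> 0)) => [x|]; rewrite ?big_nil//; exact: cmeas_cst.
case Pa: (P a).
  apply: (eq_cmeas (f := fun x => F a x + \sum_(i <- r | P i) F i x)) => [x|].
    by rewrite big_cons Pa.
  by apply: cmeasD => //; exact: h.
by apply: eq_cmeas IH => x; rewrite big_cons Pa.
Qed.

Lemma cmeas_prod I (r : seq I) (F : I -> T -> R[i]) :
  (forall i, cmeas (F i)) -> cmeas (fun x => \prod_(i <- r) F i x).
Proof.
move=> h; elim: r => [|a r IH].
  by apply: (eq_cmeas (f := fun=> 1)) => [x|]; rewrite ?big_nil//; exact: cmeas_cst.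
apply: (eq_cmeas (f := fun x => F a x * \prod_(i <- r) F i x)) => [x|].
  by rewrite big_cons.
exact: cmeasM.
Qed.

End measurable_complex.

Section measurable_matrix.
Context d (T : measurableType d) (R : realType).

(** For square matrices on Euclidean space this unfolds to `mx_measurable`. *)
Definition mxmeas m n (F : T -> 'M[R[i]]_(m, n)) : Prop :=
  forall i j, cmeas (fun x => F x i j).

Lemma eq_mxmeas m n (F G : T -> 'M[R[i]]_(m, n)) : F =1 G -> mxmeas F -> mxmeas G.
Proof. by move=> /funext ->. Qed.

Lemma mxmeas_cst m n (A : 'M[R[i]]_(m, n)) : mxmeas (fun=> A).
Proof. by move=> i j; exact: cmeas_cst. Qed.

Lemma mxmeasD m n (F G : T -> 'M[R[i]]_(m, n)) :
  mxmeas F -> mxmeas G -> mxmeas (fun x => F x + G x).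
Proof.
move=> mF mG i j; apply: (eq_cmeas _ (cmeasD (mF i j) (mG i j))) => x.
by rewrite mxE.
Qed.

Lemma mxmeasN m n (F : T -> 'M[R[i]]_(m, n)) : mxmeas F -> mxmeas (fun x => - F x).
Proof.
by move=> mF i j; apply: (eq_cmeas _ (cmeasN (mF i j))) => x; rewrite mxE.
Qed.

Lemma mxmeasB m n (F G : T -> 'M[R[i]]_(m, n)) :
  mxmeas F -> mxmeas G -> mxmeas (fun x => F x - G x).
Proof. by move=> mF mG; exact: mxmeasD (mxmeasN mG). Qed.

Lemma mxmeasM m n k (F : T -> 'M[R[i]]_(m, n)) (G : T -> 'M[R[i]]_(n, k)) :
  mxmeas F -> mxmeas G -> mxmeas (fun x => F x *m G x).
Proof.
move=> mF mG i j.
apply: (eq_cmeas (f := fun x => \sum_l F x i l * G x l j)) => [x|].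
  by rewrite mxE.
by apply: cmeas_sum => l _; exact: cmeasM.
Qed.

Lemma mxmeasZ m n (f : T -> R[i]) (F : T -> 'M[R[i]]_(m, n)) :
  cmeas f -> mxmeas F -> mxmeas (fun x => f x *: F x).
Proof.
by move=> mf mF i j; apply: (eq_cmeas _ (cmeasM mf (mF i j))) => x; rewrite mxE.
Qed.

Lemma cmeas_det n (F : T -> 'M[R[i]]_n) : mxmeas F -> cmeas (fun x => \det (F x)).
Proof.
move=> mF; apply: cmeas_sum => s _; apply: cmeasM; first exact: cmeas_cst.
by apply: cmeas_prod => i; exact: mF.
Qed.

(** By Cramer's formula the entries of an inverse are rational functions of
those of the matrix. *)
Lemma mxmeas_inv n (F G : T -> 'M[R[i]]_n) :
  (forall x, F x *m G x = 1%:M) -> mxmeas F -> mxmeas G.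
Proof.
move=> FG mF.
apply: (eq_mxmeas (F := fun x => (\det (F x))^-1 *: \adj (F x))) => [x|].
  have [uF _] := mulmx1_unit (FG x).
  have -> : G x = invmx (F x) by rewrite -[RHS]mulmx1 -(FG x) mulKmx.
  by rewrite /invmx uF.
apply: mxmeasZ; first exact/cmeasV/cmeas_det.
move=> i j; apply: (eq_cmeas (f := fun x => cofactor (F x) j i)) => [x|].
  by rewrite mxE.
apply: cmeasM; first exact: cmeas_cst.
apply: cmeas_det => k l; apply: eq_cmeas (mF (lift j k) (lift i l)) => x.
by rewrite !mxE.
Qed.

End measurable_matrix.

Lemma mxmeas_comp d d' (T : measurableType d) (T' : measurableType d') (R : realType)
    (h : T' -> T) m n (F : T -> 'M[R[i]]_(m, n)) :
  measurable_fun setT h -> mxmeas F -> mxmeas (fun x => F (h x)).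
Proof.
move=> mh mF i j; have [h1 h2] := mF i j.
by split; [exact: (measurableT_comp h1 mh)|exact: (measurableT_comp h2 mh)].
Qed.

(** * Functional calculus and measurability of matrix powers *)

Section functional_calculus.
Context (R : realType) (n : nat).
Local Notation Re := complex.Re.
Local Notation Im := complex.Im.
Implicit Types (A : 'M[R[i]]_n) (f g : R -> R).

Definition of_spectrum A (D : 'rV[R[i]]_n) : 'M[R[i]]_n :=
  invmx (spectralmx A) *m diag_mx D *m spectralmx A.

(** The spectral functional calculus f(A), of which `mxpow` is the case of a
power. *)
Definition fcalc A f : 'M[R[i]]_n :=
  of_spectrum A (map_mx (fun z => (f (Re z))%:C) (spectral_diag A)).

Lemma of_spectrumM A D E :
  of_spectrum A D *m of_spectrum A E = of_spectrum A (\row_j (D 0 j * E 0 j)).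
Proof.
rewrite /of_spectrum; have := spectral_unit A; move: (spectralmx A) => P uP.
by rewrite !mulmxA (mulmxK uP) -(mulmxA (invmx P) (diag_mx D)) mulmx_diag.
Qed.

Lemma of_spectrumD A D E : of_spectrum A D + of_spectrum A E = of_spectrum A (D + E).
Proof. by rewrite /of_spectrum raddfD mulmxDr mulmxDl. Qed.

Lemma mxpowE A s : mxpow A s = fcalc A (fun t => t `^ s).
Proof. by []. Qed.

Lemma posdef_spectral A : posdef A ->
  A = of_spectrum A (spectral_diag A).
Proof. by move=> [/hermitian_normalmx/orthomx_spectralP]. Qed.

(** The eigenvalue with index j is the value of the quadratic form at
the eigenvector P^* e_j. *)
Lemma posdef_eigen_gt0 A : posdef A -> forall j, 0 < spectral_diag A 0 j.
Proof.
move=> pA j; have AE := posdef_spectral pA; have [_ hA] := pA.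
rewrite /of_spectrum in AE.
set P := spectralmx A in AE *; set D := spectral_diag A in AE *.
have uP : P \is unitarymx := spectral_unitarymx A.
have unP := unitarymx_unit uP.
pose v : 'cV[R[i]]_n := P ^t* *m ecol R j.
have Pv : P *m v = ecol R j.
  by rewrite /v mulmxA (unitarymxP uP) mul1mx.
have v0 : v != 0.
  apply/eqP => v0; have := Pv; rewrite v0 mulmx0 => /matrixP /(_ j 0).
  by rewrite !mxE !eqxx /= => /eqP; rewrite eq_sym oner_eq0.
have := hA v v0; rewrite AE invmx_unitary// -!mulmxA Pv mulmxA -adjM Pv.
have -> : diag_mx D *m ecol R j = D 0 j *: ecol R j.
  apply/colP => i; rewrite mul_diag_mx !mxE.
  by have [->|] := eqVneq i j; rewrite // !mulr0.
rewrite -scalemxAr mxE.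
suff -> : ((ecol R j) ^t* *m ecol R j) 0 0 = 1 by rewrite mulr1.
rewrite !mxE (bigD1 j)//= big1 => [|i ij].
  by rewrite !mxE !eqxx /= rmorph1 mulr1 addr0.
by rewrite !mxE (negbTE ij)/= mulr0.
Qed.

Lemma posdef_eigen_real A : posdef A ->
  forall j, spectral_diag A 0 j = (Re (spectral_diag A 0 j))%:C.
Proof.
move=> pA j; have /ltW/ger0_Im := posdef_eigen_gt0 pA j.
by case: (spectral_diag _ _ _) => a b /= ->.
Qed.

Lemma posdef_eigen_Re_gt0 A : posdef A ->
  forall j, 0 < Re (spectral_diag A 0 j).
Proof.
by move=> pA j; have := posdef_eigen_gt0 pA j; rewrite (posdef_eigen_real pA) ltcR.
Qed.

Lemma eq_fcalc A f g : posdef A -> (forall t : R, 0 < t -> f t = g t) ->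
  fcalc A f = fcalc A g.
Proof.
move=> pA fg; congr of_spectrum; apply/rowP => j.
by rewrite !mxE fg//; exact: posdef_eigen_Re_gt0.
Qed.

Lemma fcalc_id A : posdef A -> fcalc A id = A.
Proof.
move=> pA; rewrite [RHS](posdef_spectral pA); congr of_spectrum.
by apply/rowP => j; rewrite mxE -(posdef_eigen_real pA).
Qed.

Lemma fcalcM A f g : fcalc A f *m fcalc A g = fcalc A (fun t => f t * g t).
Proof.
rewrite /fcalc of_spectrumM; congr of_spectrum.
by apply/rowP => j; rewrite !mxE -rmorphM.
Qed.

Lemma fcalc_cst A a : fcalc A (fun=> a) = (a%:C)%:M.
Proof.
rewrite /fcalc /of_spectrum.
have -> : map_mx (fun z : R[i] => a%:C) (spectral_diag A) = const_mx a%:C.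
  by apply/rowP => j; rewrite !mxE.
by rewrite diag_const_mx mul_mx_scalar -scalemxAl mulVmx ?spectral_unit// scalemx1.
Qed.

Lemma fcalcD A f g : fcalc A f + fcalc A g = fcalc A (fun t => f t + g t).
Proof.
rewrite /fcalc of_spectrumD; congr of_spectrum.
by apply/rowP => j; rewrite !mxE rmorphD.
Qed.

Lemma fcalc_adj A f : (fcalc A f) ^t* = fcalc A f.
Proof.
rewrite /fcalc /of_spectrum !adjM invmx_unitary ?spectral_unitarymx// trmxCK.
rewrite mulmxA tr_diag_mx map_diag_mx.
congr (_ *m diag_mx _ *m _).
by apply/rowP => j; rewrite !mxE; exact: conjc_real.
Qed.

Lemma mxpow_adj A s : (mxpow A s) ^t* = mxpow A s.
Proof. by rewrite mxpowE fcalc_adj. Qed.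

Lemma mxpowNK A s : posdef A -> mxpow A s *m mxpow A (- s) = 1%:M.
Proof.
move=> pA; rewrite !mxpowE fcalcM.
rewrite (@eq_fcalc _ _ (fun=> 1))// ?fcalc_cst// => t t0.
by rewrite -powRD ?subrr ?powRr0//; apply/implyP => _; rewrite gt_eqF.
Qed.

End functional_calculus.

Section mxpow_measurable.
Context (R : realType) (n : nat) d (T : measurableType d).
Local Notation Re := complex.Re.
Local Notation Im := complex.Im.
Variable W : T -> 'M[R[i]]_n.
Hypothesis pW : forall x, posdef (W x).

(** The eigenvectors of W x need not be measurable functions of x, so
measurability of f(W) cannot be read off the spectral decomposition.  Instead, the
class of all f with f(W) measurable is shown to be closed under algebraic operations and
pointwise limits on the positive reals, and to contain the powers. *)
Definition calc_meas (f : R -> R) : Prop := mxmeas (fun x => fcalc (W x) f).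

Lemma calc_meas_eq f g : (forall t : R, 0 < t -> f t = g t) -> calc_meas f -> calc_meas g.
Proof. by move=> fg; apply: eq_mxmeas => x; exact: eq_fcalc. Qed.

Lemma calc_meas_cst a : calc_meas (fun=> a).
Proof.
by apply: eq_mxmeas (mxmeas_cst _ (a%:C)%:M) => x; rewrite fcalc_cst.
Qed.

Lemma calc_measD f g : calc_meas f -> calc_meas g -> calc_meas (fun t => f t + g t).
Proof.
by move=> mf mg; apply: eq_mxmeas (mxmeasD mf mg) => x; rewrite fcalcD.
Qed.

Lemma calc_measM f g : calc_meas f -> calc_meas g -> calc_meas (fun t => f t * g t).
Proof.
by move=> mf mg; apply: eq_mxmeas (mxmeasM mf mg) => x; rewrite fcalcM.
Qed.

Lemma calc_measV f : (forall t : R, 0 < t -> f t != 0) ->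
  calc_meas f -> calc_meas (fun t => (f t)^-1).
Proof.
move=> f0 mf; apply: mxmeas_inv mf => x; rewrite fcalcM.
by rewrite (@eq_fcalc _ _ _ _ (fun=> 1))// ?fcalc_cst// => t /f0 ?; rewrite mulfV.
Qed.

Lemma calc_measX f k : calc_meas f -> calc_meas (fun t => f t ^+ k).
Proof.
move=> mf; elim: k => [|k IH]; first exact: calc_meas_cst.
by apply: calc_meas_eq (calc_measM mf IH) => t _; rewrite exprS.
Qed.

(** For fixed x, the entries of f(W x) are linear combinations of the
values of f at the eigenvalues, with coefficients that do not depend on f. *)
Lemma calc_meas_lim (f : nat -> R -> R) g : (forall k, calc_meas (f k)) ->
  (forall t : R, 0 < t -> f k t @[k --> \oo] --> g t) -> calc_meas g.
Proof.
move=> mf fg i j.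
pose K x l := invmx (spectralmx (W x)) i l * spectralmx (W x) l j.
pose e x l := Re (spectral_diag (W x) 0 l).
have [F FE] : exists F : (R -> R) -> T -> R[i], forall h x, fcalc (W x) h i j = F h x.
  by exists (fun h x => fcalc (W x) h i j).
have E h x : F h x = \sum_l K x l * (h (e x l))%:C.
  rewrite -FE mxE; apply: eq_bigr => l _; rewrite mul_mx_diag !mxE /K /e.
  by rewrite mulrAC.
have ReE h x : Re (F h x) = \sum_l Re (K x l) * h (e x l).
  by rewrite E cRe_sum; apply: eq_bigr => l _; rewrite cReM /= mulr0 subr0.
have ImE h x : Im (F h x) = \sum_l Im (K x l) * h (e x l).
  by rewrite E cIm_sum; apply: eq_bigr => l _; rewrite cImM /= mulr0 add0r.
have {}mf k : cmeas (F (f k)) by apply: eq_cmeas (mf k i j) => x; exact: FE.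
apply: (@eq_cmeas _ _ _ (F g)) => [x|]; first by rewrite FE.
split.
  apply: (@measurable_fun_cvg _ _ _ _ (fun k x => Re (F (f k) x))).
    by move=> k; have [] := mf k.
  move=> x _; rewrite ReE; under eq_fun do rewrite ReE.
  apply: cvg_big => [|l _]; first exact: add_continuous.
  by apply: cvgMl_tmp; apply: fg; exact: posdef_eigen_Re_gt0.
apply: (@measurable_fun_cvg _ _ _ _ (fun k x => Im (F (f k) x))).
  by move=> k; have [] := mf k.
move=> x _; rewrite ImE; under eq_fun do rewrite ImE.
apply: cvg_big => [|l _]; first exact: add_continuous.
by apply: cvgMl_tmp; apply: fg; exact: posdef_eigen_Re_gt0.
Qed.

(** Heron's iteration for the square root: a rational function of t, hence
available in a class closed under sums, products and inverses. *)
Fixpoint newton (k : nat) (t : R) : R :=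
  if k is k'.+1 then (newton k' t + t / newton k' t) / 2 else 1 + t.

(** The iterates stay above the root, and the error at least halves:
the next error is (y - s)^2 / (2 y), and y - s is at most y. *)
Lemma newton_bound k (t : R) : 0 < t ->
  Num.sqrt t <= newton k t <= Num.sqrt t + (1 + t) / 2 ^+ k.
Proof.
move=> t0; set s := Num.sqrt t.
have s0 : 0 < s by rewrite sqrtr_gt0.
have ts : t = s ^+ 2 by rewrite sqr_sqrtr// ltW.
elim: k => [|k /andP[IH1 IH2]] /=.
  rewrite expr0 divr1 lerDr (ltW s0) andbT.
  by have := sqr_ge0 (s - 1); rewrite sqrrB expr1n mulr1 -ts; lra.
set y := newton k t in IH1 IH2 *.
have y0 : 0 < y by rewrite (lt_le_trans s0).
have E : (y + t / y) / 2 = s + (y - s) * ((y - s) / y) / 2.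
  by rewrite {1}ts; field; rewrite gt_eqF.
have h0 : 0 <= (y - s) / y by rewrite divr_ge0 ?subr_ge0// ltW.
have h1 : (y - s) / y <= 1 by rewrite ler_pdivrMr// mul1r gerBl ltW.
rewrite E; apply/andP; split.
  by rewrite lerDl divr_ge0// mulr_ge0// subr_ge0.
rewrite lerD2l exprSr.
have -> : (1 + t) / (2 ^+ k * 2) = (1 + t) / 2 ^+ k / 2 by rewrite invfM mulrA.
rewrite ler_wpM2r ?invr_ge0//.
by rewrite (@le_trans _ _ (y - s))// ?ler_piMr ?subr_ge0// lerBlDl.
Qed.

Lemma newton_cvg (t : R) : 0 < t -> newton k t @[k --> \oo] --> Num.sqrt t.
Proof.
move=> t0; apply: (@squeeze_cvgr _ _ _ _ (cst (Num.sqrt t)) 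
  (fun k => Num.sqrt t + geometric (1 + t) (2^-1) k)).
- by near=> k; have := newton_bound k t0; rewrite /geometric /= exprVn.
- exact: cvg_cst.
- rewrite -[X in _ --> X]addr0; apply: cvgD; first exact: cvg_cst.
  by apply: cvg_geometric; rewrite ger0_norm ?invr_ge0// invf_lt1// ltr1n.
Unshelve. all: by end_near.
Qed.

Hypothesis mW : mxmeas W.

Lemma calc_meas_id : calc_meas id.
Proof. by apply: eq_mxmeas mW => x; rewrite fcalc_id. Qed.

Lemma calc_meas_sqrt f : (forall t : R, 0 < t -> 0 < f t) ->
  calc_meas f -> calc_meas (fun t => Num.sqrt (f t)).
Proof.
move=> f0 mf; apply: (@calc_meas_lim (fun k t => newton k (f t))) => [k|t t0].
  elim: k => [|k IH]; first exact: (calc_measD (calc_meas_cst 1) mf).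
  pose g t := newton k (f t).
  suff gV : calc_meas (fun t => (g t)^-1).
    exact: (calc_measM (calc_measD IH (calc_measM mf gV)) (calc_meas_cst 2^-1)).
  apply: calc_measV IH => t t0; rewrite /g.
  have /andP[h _] := newton_bound k (f0 t t0).
  by rewrite gt_eqF// (lt_le_trans _ h)// sqrtr_gt0 f0.
by apply: newton_cvg; exact: f0.
Qed.

Lemma calc_meas_root k : calc_meas (fun t => t `^ (2 ^- k)).
Proof.
elim: k => [|k IH].
  by apply: calc_meas_eq calc_meas_id => t t0; rewrite expr0 invr1 powRr1// ltW.
apply: calc_meas_eq (calc_meas_sqrt _ IH) => t t0; last exact: powR_gt0.
by rewrite exprSr invfM powRrM powR12_sqrt// powR_ge0.
Qed.

(** Iterated square roots give the exponents 2^-k; integer powers of these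
approximate s from below. *)
Lemma calc_meas_powR s : 0 <= s -> calc_meas (fun t => t `^ s).
Proof.
move=> s0; pose m k := Num.truncn (s * 2 ^+ k).
apply: (@calc_meas_lim (fun k t => (t `^ (2 ^- k)) ^+ m k)) => [k|t t0].
  exact: calc_measX (calc_meas_root k).
have -> : (fun k => (t `^ (2 ^- k)) ^+ m k) =
    (fun k => expR (2 ^- k * (m k)%:R * ln t)).
  apply/funext => k.
  by rewrite -powR_mulrn ?powR_ge0// -powRrM /powR gt_eqF.
have -> : t `^ s = expR (s * ln t) by rewrite /powR gt_eqF.
apply: cvg_comp; last exact: continuous_expR.
apply: cvgMr_tmp.
apply: (@squeeze_cvgr _ _ _ _ (fun k => s - geometric 1 (2^-1) k) (cst s)).
- near=> k; rewrite /geometric /= mul1r exprVn.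
  have h : 0 <= s * 2 ^+ k by rewrite mulr_ge0// exprn_ge0.
  have /andP[h1 h2] := truncn_itv h; rewrite -/(m k) in h1 h2.
  have p0 : 0 < (2 : R) ^+ k by rewrite exprn_gt0.
  rewrite mulrC ler_pdivlMr// ler_pdivrMr// h1 andbT mulrBl mulVf ?gt_eqF//.
  by rewrite lerBlDr; apply: ltW; rewrite natr1.
- rewrite -[X in _ --> X]subr0; apply: cvgB; first exact: cvg_cst.
  by apply: cvg_geometric; rewrite ger0_norm ?invr_ge0// invf_lt1// ltr1n.
- exact: cvg_cst.
Unshelve. all: by end_near.
Qed.

Lemma mxmeas_mxpow s : mxmeas (fun x => mxpow (W x) s).
Proof.
change (calc_meas (fun t => t `^ s)).
have [s0|s0] := leP 0 s; first exact: calc_meas_powR.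
apply: (@calc_meas_eq (fun t => (t `^ (- s))^-1)) => [t t0|].
  by rewrite -powRN opprK.
apply: calc_measV => [t t0|]; first by rewrite gt_eqF// powR_gt0.
by apply: calc_meas_powR; rewrite oppr_ge0 ltW.
Qed.

End mxpow_measurable.

Section opnorm_measurable.
Context (R : realType) d (T : measurableType d).
Local Notation Re := complex.Re.
Local Notation Im := complex.Im.

Lemma measurable_vnorm n (v : T -> 'cV[R[i]]_n) : mxmeas v ->
  measurable_fun setT (fun x => vnorm (v x)).
Proof.
move=> mv; under eq_fun => x.
  rewrite /vnorm -powR12_sqrt; last first.
    by apply: sumr_ge0 => i _; rewrite addr_ge0// sqr_ge0.
  over.
apply: (measurableT_comp (measurable_powR _)); apply: measurable_sum => i.
by have [m1 m2] := mv i 0; apply: measurable_funD; exact: measurable_funX.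
Qed.

Definition ratvec n (w : 'cV[rat * rat]_n) : 'cV[R[i]]_n :=
  map_mx (fun z => ratr z.1 +i* ratr z.2) w.

Lemma ratvec_dense n (v : 'cV[R[i]]_n) (e : R) : 0 < e ->
  exists w : 'cV[rat * rat]_n, vnorm (v - ratvec w) <= e.
Proof.
move=> e0; pose c : R := e / (2 * n.+1%:R).
have c0 : 0 < c by rewrite divr_gt0// mulr_gt0.
have ex (t : R) : {q : rat | `|t - ratr q| <= c}.
  apply: cid; have /rat_in_itvoo[q] : t - c < t + c by lra.
  rewrite in_itv /= => /andP[q1 q2]; exists q.
  by rewrite ler_norml; apply/andP; split; lra.
exists (\col_i (sval (ex (Re (v i 0))), sval (ex (Im (v i 0))))).
set w := v - _.
rewrite -[w]mul1mx (le_trans (_ : _ <= \sum_j vnorm (w j 0 *: (1%:M *m ecol R j))))//.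
  by rewrite mulmx_cols ler_vnorm_sum.
apply: (@le_trans _ _ (\sum_(j < n) (2 * c))).
  apply: ler_sum => j _; rewrite mul1mx (le_trans (vnormZ_le _ _))//.
  rewrite vnorm_ecol mulr1 /w !mxE cReD cImD cReN cImN /=.
  by case: (ex _) => q1 /= h1; case: (ex _) => q2 /= h2; lra.
rewrite sumr_const card_ord -[_ *+ n]mulr_natr /c.
have -> : 2 * (e / (2 * n.+1%:R)) * n%:R = e * (n%:R / n.+1%:R).
  by field; rewrite addrC natr1 pnatr_eq0.
by rewrite ler_piMr ?(ltW e0)// ler_pdivrMr// mul1r ler_nat.
Qed.

(** Vectors with rational coordinates suffice to test the operator norm, by
density. *)
Lemma opnorm_le_ratvec m n (A : 'M[R[i]]_(m, n)) t : 0 <= t ->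
  (forall w, vnorm (A *m ratvec w) <= t * vnorm (ratvec w)) -> opnorm A <= t.
Proof.
move=> t0 h; apply: opnorm_le => // v; apply/ler_addgt0Pr => e e0.
pose K := opnorm A + t + 1.
have K0 : 0 < K by have := opnorm_ge0 A; rewrite /K; lra.
have [w hw] := ratvec_dense v (divr_gt0 e0 K0).
have -> : v = ratvec w + (v - ratvec w) by rewrite addrC subrK.
set z := v - ratvec w in hw *.
rewrite mulmxDr (le_trans (ler_vnormD _ _))//.
have h1 : vnorm (ratvec w) <= vnorm (ratvec w + z) + vnorm z.
  by rewrite -(vnormN z) -{1}[ratvec w](addrK z) ler_vnormD.
have h2 := vnorm_mulmx A z; have h3 := h w.
have h4 : (opnorm A + t) * vnorm z <= e.
  rewrite (le_trans (_ : _ <= K * vnorm z))//.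
    by rewrite ler_wpM2r ?vnorm_ge0// lerDl.
  by rewrite mulrC -ler_pdivlMr.
rewrite (le_trans (lerD h3 h2))// (le_trans (lerD (ler_wpM2l t0 h1) (lexx _)))//.
by rewrite mulrDr -addrA lerD2l -mulrDl addrC.
Qed.

(** The set where the norm exceeds t is a countable union, over the rational
test vectors, of measurable sets. *)
Lemma measurable_opnorm m n (F : T -> 'M[R[i]]_(m, n)) : mxmeas F ->
  measurable_fun setT (fun x => opnorm (F x)).
Proof.
move=> mF _; apply: (measurability _ (RGenOInfty.measurableE R)) => //.
move=> _ [_ [t ->] <-]; rewrite setTI.
have [t0|t0] := ltP t 0.
  rewrite (_ : _ @^-1` _ = setT)//; apply/seteqP; split => // x _ /=.
  by rewrite in_itv /= andbT (lt_le_trans t0)// opnorm_ge0.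
rewrite (_ : _ @^-1` _ = \bigcup_(k in setT)
    (if @unpickle 'cV[rat * rat]_n k is Some w
     then [set x | t * vnorm (ratvec w) < vnorm (F x *m ratvec w)] else set0)).
  apply: bigcupT_measurable => k; case: unpickle => // w.
  have h : measurable_fun setT
      (fun x => t * vnorm (ratvec w) < vnorm (F x *m ratvec w)).
    apply: measurable_fun_ltr; first exact: measurable_cst.
    by apply: measurable_vnorm; apply: mxmeasM => //; exact: mxmeas_cst.
  by have := h measurableT [set true] I; rewrite setTI.
apply/seteqP; split => [x /=|x [k _]].
  rewrite in_itv /= andbT => h; apply: contrapT => h'.
  have : opnorm (F x) <= t.
    apply: opnorm_le_ratvec => // w; rewrite leNgt; apply/negP => hw.
    by apply: h'; exists (pickle w) => //; rewrite pickleK.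
  by rewrite leNgt h.
case: unpickle => // w /= hw; rewrite in_itv /= andbT.
rewrite ltNge; apply/negP => h; move: hw; rewrite ltNge; apply/negP; rewrite negbK.
by rewrite (le_trans (vnorm_mulmx _ _))// ler_wpM2r// vnorm_ge0.
Qed.

End opnorm_measurable.

(** * Lebesgue measure and averages over cubes *)

Section lebesgue_euclid.
Context (R : realType) (d : nat).
Local Notation mu := (leb R d).

Lemma leb_sigma_finite : sigma_finite setT (leb R d).
Proof. exact: completed_measure_extension_sigma_finite (sigma_finiteT _). Qed.

(** A copy of Lebesgue measure that carries the sigma-finite structure required by
the theorem of Fubini and Tonelli. *)
Definition sigma_leb : set (euclid R d) -> \bar R := leb R d.

HB.instance Definition _ := Measure.copy sigma_leb (leb R d).

HB.instance Definition _ :=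
  Measure_isSigmaFinite.Build _ _ _ sigma_leb leb_sigma_finite.

Lemma leb_complete : measure_is_complete mu.
Proof. exact: measure_is_complete_caratheodory. Qed.

Lemma borel_measurable (A : set (d.-tuple R)) :
  measurable A -> measurable (A : set (euclid R d)).
Proof. by move=> mA; apply: caratheodory_measurable_mu_ext. Qed.

Lemma measurable_cube (Q : cube R d) : measurable (cube_set Q).
Proof.
by have [mA _] := borel_box (corner Q) (side_gt0 Q); exact: borel_measurable.
Qed.

(** Lebesgue measure is complete, so a change on a null set preserves
measurability. *)
Lemma ae_measurable_real (f g : euclid R d -> R) :
  {ae mu, forall x, f x = g x} -> measurable_fun setT f -> measurable_fun setT g.
Proof.
move=> fg /measurable_EFinP mf; apply/measurable_EFinP.
apply: (ae_measurable_fun leb_complete _ mf).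
by apply: filterS fg => x /= ->.
Qed.

Lemma ae_mxmeas m n (F G : euclid R d -> 'M[R[i]]_(m, n)) :
  {ae mu, forall x, F x = G x} -> mxmeas F -> mxmeas G.
Proof.
move=> FG mF i j; have [m1 m2] := mF i j; split.
  by apply: ae_measurable_real m1; apply: filterS FG => x /= ->.
by apply: ae_measurable_real m2; apply: filterS FG => x /= ->.
Qed.

End lebesgue_euclid.

#[global] Hint Extern 0 (measurable (cube_set _)) => exact: measurable_cube : core.

Lemma lee_poweR (R : realType) (x y : \bar R) (r : R) :
  0 <= r -> (0 <= x -> x <= y -> x `^ r <= y `^ r)%E.
Proof.
move=> r0 x0 xy; apply: gt0_ler_poweR => //; rewrite in_itv /= leey andbT//.
exact: le_trans xy.
Qed.

(** One of the summands is at most t, respectively t^-1, times the other.  The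
point of the parameter is that the factor of one summand can be taken close to 1. *)
Lemma powR_add_eps (R : realType) (t a b p : R) : 0 < t -> 0 <= a -> 0 <= b -> 0 < p ->
  (a + b) `^ p <= ((1 + t) * a) `^ p + ((1 + t^-1) * b) `^ p.
Proof.
move=> t0 a0 b0 p0; have tV0 : 0 < t^-1 by rewrite invr_gt0.
have [ba|ab] := leP b (t * a).
  rewrite (@le_trans _ _ (((1 + t) * a) `^ p))// ?lerDl ?powR_ge0//.
  rewrite ge0_ler_powR ?nnegrE ?addr_ge0 ?mulr_ge0 ?addr_ge0 ?(ltW p0) ?(ltW t0)//.
  by rewrite mulrDl mul1r lerD2l.
rewrite (@le_trans _ _ (((1 + t^-1) * b) `^ p))// ?lerDr ?powR_ge0//.
rewrite ge0_ler_powR ?nnegrE ?addr_ge0 ?mulr_ge0 ?addr_ge0 ?(ltW p0) ?(ltW tV0)//.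
rewrite mulrDl mul1r addrC lerD2l -(ler_pM2l t0) mulrA mulfV ?gt_eqF// mul1r.
exact: ltW.
Qed.

Section average_lemmas.
Context (R : realType) (d : nat).
Local Notation mu := (leb R d).
Implicit Types (Q : cube R d).
Local Open Scope ereal_scope.

Definition vol Q : R := (side Q ^+ d)%R.

Lemma vol_gt0 Q : (0 < vol Q)%R.
Proof. by rewrite exprn_gt0// side_gt0. Qed.

Lemma leb_vol Q : mu (cube_set Q) = (vol Q)%:E.
Proof. exact: leb_cube. Qed.

Lemma avgE Q f : avg Q f = ((vol Q)^-1)%:E * \int[mu]_(x in Q) f x.
Proof. by rewrite /avg leb_vol. Qed.

Lemma volK Q : (vol Q)%:E * ((vol Q)^-1)%:E = 1.
Proof. by rewrite -EFinM mulfV// gt_eqF// vol_gt0. Qed.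

Lemma integral_avg Q f : \int[mu]_(x in Q) f x = (vol Q)%:E * avg Q f.
Proof. by rewrite avgE muleA volK mul1e. Qed.

Lemma volV_ge0 Q : 0 <= ((vol Q)^-1)%:E :> \bar R.
Proof. by rewrite lee_fin invr_ge0 ltW// vol_gt0. Qed.

Lemma avg_ge0 Q f : (forall x, 0 <= f x) -> 0 <= avg Q f.
Proof. by move=> f0; rewrite avgE mule_ge0 ?volV_ge0// integral_ge0. Qed.

Lemma avg_le_ae Q f g : measurable_fun setT f -> measurable_fun setT g ->
  (forall x, 0 <= f x) -> (forall x, 0 <= g x) ->
  {ae mu, forall x, f x <= g x} -> avg Q f <= avg Q g.
Proof.
move=> mf mg f0 g0 fg; rewrite !avgE lee_wpmul2l ?volV_ge0//.
apply: ae_ge0_le_integral => //.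
- exact: measurable_funTS.
- exact: measurable_funTS.
- by apply: filterS fg => x h _.
Qed.

Lemma avg_le Q f g : measurable_fun setT f -> measurable_fun setT g ->
  (forall x, 0 <= f x) -> (forall x, 0 <= g x) ->
  (forall x, f x <= g x) -> avg Q f <= avg Q g.
Proof. by move=> mf mg f0 g0 fg; apply: avg_le_ae => //; exact: aeW. Qed.

Lemma avgZ Q k f : measurable_fun setT f -> (forall x, 0 <= f x) -> 0 <= k ->
  avg Q (fun x => k * f x) = k * avg Q f.
Proof.
move=> mf f0 k0; rewrite !avgE ge0_integralZl//; last exact: measurable_funTS.
by rewrite muleCA.
Qed.

Lemma avgD Q f g : measurable_fun setT f -> measurable_fun setT g ->
  (forall x, 0 <= f x) -> (forall x, 0 <= g x) ->
  avg Q (fun x => f x + g x) = avg Q f + avg Q g.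
Proof.
move=> mf mg f0 g0; rewrite !avgE ge0_integralD//; [|exact: measurable_funTS..].
by rewrite ge0_muleDr// integral_ge0.
Qed.

Lemma avg_cst Q k : avg Q (cst k) = k.
Proof.
by rewrite avgE integral_cst// leb_vol muleA (muleC _ k) -muleA (muleC _ (vol Q)%:E)
  volK mule1.
Qed.

Lemma avg_sum Q I (r : seq I) (f : I -> euclid R d -> \bar R) :
  (forall i, measurable_fun setT (f i)) -> (forall i x, 0 <= f i x) ->
  avg Q (fun x => \sum_(i <- r) f i x) = \sum_(i <- r) avg Q (f i).
Proof.
move=> mf f0; rewrite avgE ge0_integral_sum//; last first.
  by move=> i; exact: measurable_funTS.
rewrite ge0_sume_distrr; last by move=> i _; rewrite integral_ge0.
by apply: eq_bigr => i _; rewrite avgE.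
Qed.

Lemma measurable_powR_EFin (f : euclid R d -> R) r : measurable_fun setT f ->
  measurable_fun setT (fun x => (f x `^ r)%:E).
Proof.
move=> mf; apply/measurable_EFinP.
exact: measurableT_comp (measurable_powR r) mf.
Qed.

Lemma powR_EFin_ge0 (f : euclid R d -> R) r x : 0 <= (f x `^ r)%:E.
Proof. by rewrite lee_fin powR_ge0. Qed.

(** A bound on the normalized L^r norm, written for r-th powers so that no root
of an extended real is needed. *)
Definition avgLe Q (r : R) (f : euclid R d -> R) (X : R) : Prop :=
  avg Q (fun x => (f x `^ r)%:E) <= (X `^ r)%:E.

Lemma avgLe_ae Q (r : R) (f g : euclid R d -> R) (X : R) : (0 < r)%R ->
  measurable_fun setT f -> measurable_fun setT g ->
  (forall x, 0 <= f x)%R -> (forall x, 0 <= g x)%R ->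
  {ae mu, forall x, (f x <= g x)%R} -> avgLe Q r g X -> avgLe Q r f X.
Proof.
move=> r0 mf mg f0 g0 fg; apply: le_trans; apply: avg_le_ae.
- exact: measurable_powR_EFin.
- exact: measurable_powR_EFin.
- exact: powR_EFin_ge0.
- exact: powR_EFin_ge0.
by apply: filterS fg => x fgx; rewrite lee_fin ge0_ler_powR ?nnegrE ?(ltW r0).
Qed.

Lemma avgLe_le Q (r : R) (f g : euclid R d -> R) (X : R) : (0 < r)%R ->
  measurable_fun setT f -> measurable_fun setT g ->
  (forall x, 0 <= f x)%R -> (forall x, 0 <= g x)%R ->
  (forall x, (f x <= g x)%R) -> avgLe Q r g X -> avgLe Q r f X.
Proof. by move=> r0 mf mg f0 g0 fg; exact: (avgLe_ae r0 mf mg f0 g0 (aeW _ fg)). Qed.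

Lemma avgLe_mono Q (r : R) (f : euclid R d -> R) (X Y : R) :
  (0 < r)%R -> (0 <= X)%R -> (X <= Y)%R ->
  avgLe Q r f X -> avgLe Q r f Y.
Proof.
move=> r0 X0 XY h; apply: (le_trans h).
by rewrite lee_fin ge0_ler_powR ?nnegrE ?(ltW r0)// (le_trans X0).
Qed.

Lemma avgLeZ Q (r : R) (f : euclid R d -> R) (X k : R) : (0 <= k)%R -> measurable_fun setT f ->
  (forall x, 0 <= f x)%R -> (0 <= X)%R ->
  avgLe Q r f X -> avgLe Q r (fun x => k * f x)%R (k * X)%R.
Proof.
move=> k0 mf f0 X0 h; rewrite /avgLe powRM//.
under eq_fun do rewrite powRM// EFinM.
rewrite (avgZ _ (measurable_powR_EFin r mf) (powR_EFin_ge0 f r)) ?lee_fin ?powR_ge0//.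
by rewrite EFinM lee_wpmul2l// lee_fin powR_ge0.
Qed.

Lemma powR_add_le (a b r : R) : (0 <= a -> 0 <= b -> 0 < r ->
  (a + b) `^ r <= (2 * a) `^ r + (2 * b) `^ r)%R.
Proof.
by move=> a0 b0 r0; have := powR_add_eps ltr01 a0 b0 r0; rewrite invr1.
Qed.

Lemma powR_addn_le (a b r : R) : (0 <= a -> 0 <= b -> 1 <= r ->
  a `^ r + b `^ r <= (a + b) `^ r * 2)%R.
Proof.
move=> a0 b0 r1; have r0 : (0 <= r)%R by rewrite (le_trans _ r1).
have h1 : (a `^ r <= (a + b) `^ r)%R.
  by rewrite ge0_ler_powR ?nnegrE ?addr_ge0// lerDl.
have h2 : (b `^ r <= (a + b) `^ r)%R.
  by rewrite ge0_ler_powR ?nnegrE ?addr_ge0// lerDr.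
by lra.
Qed.

(** A triangle inequality with a constant that suffices here: a factor 2 comes from
(a + b)^r <= (2 a)^r + (2 b)^r, another one from A^r + B^r <= 2 (A + B)^r. *)
Lemma avgLeD Q (r : R) (f g : euclid R d -> R) (X Y : R) : (1 <= r)%R ->
  measurable_fun setT f -> measurable_fun setT g ->
  (forall x, 0 <= f x)%R -> (forall x, 0 <= g x)%R -> (0 <= X)%R -> (0 <= Y)%R ->
  avgLe Q r f X -> avgLe Q r g Y ->
  avgLe Q r (fun x => f x + g x)%R (4 * (X + Y))%R.
Proof.
move=> r1 mf mg f0 g0 X0 Y0 hf hg.
have r0 : (0 < r)%R by rewrite (lt_le_trans _ r1).
have m2 (h : euclid R d -> R) : measurable_fun setT h ->
    measurable_fun setT (fun x : euclid R d => (2 * h x)%R).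
  by move=> mh; apply: measurable_funM => //; exact: measurable_cst.
have h1 := avgLeZ (ler0n R 2) mf f0 X0 hf.
have h2 := avgLeZ (ler0n R 2) mg g0 Y0 hg.
apply: (@le_trans _ _ (avg Q (fun x => ((2 * f x) `^ r)%:E + ((2 * g x) `^ r)%:E))).
  apply: avg_le.
  - by apply: measurable_powR_EFin; exact: measurable_funD.
  - by apply: emeasurable_funD; apply: measurable_powR_EFin; exact: m2.
  - exact: powR_EFin_ge0.
  - by move=> x; rewrite adde_ge0// lee_fin powR_ge0.
  - by move=> x; rewrite -EFinD lee_fin powR_add_le.
rewrite (avgD _ (measurable_powR_EFin r (m2 _ mf)) (measurable_powR_EFin r (m2 _ mg))
  (powR_EFin_ge0 _ r) (powR_EFin_ge0 _ r)).
apply: (le_trans (leeD h1 h2)).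
rewrite -EFinD lee_fin.
rewrite (le_trans (powR_addn_le _ _ r1)) ?mulr_ge0//.
have -> : (4 * (X + Y) = (2 * X + 2 * Y) * 2)%R by ring.
rewrite [leRHS]powRM ?addr_ge0 ?mulr_ge0// ler_wpM2l ?powR_ge0//.
by rewrite le1r_powR// ler1n.
Qed.

(** The powers of the volume produced by the two norms multiply to the volume,
since the exponents are conjugate. *)
Lemma avg_hoelder Q (p q : R) (f g : euclid R d -> R) (X Y : R) :
  (0 < p)%R -> (0 < q)%R -> (p^-1 + q^-1 = 1)%R ->
  measurable_fun setT f -> measurable_fun setT g ->
  (forall x, 0 <= f x)%R -> (forall x, 0 <= g x)%R -> (0 <= X)%R -> (0 <= Y)%R ->
  avgLe Q p f X -> avgLe Q q g Y ->
  avg Q (fun x => (f x * g x)%:E) <= (X * Y)%:E.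
Proof.
move=> p0 q0 pq mf mg f0 g0 X0 Y0 hf hg.
have mfQ : measurable_fun setT (f \_ Q).
  apply/(measurable_restrictT _ (measurable_cube Q)). exact: measurable_funTS mf.
have mgQ : measurable_fun setT (g \_ Q).
  apply/(measurable_restrictT _ (measurable_cube Q)). exact: measurable_funTS mg.
have NE (r : R) (h : euclid R d -> R) (Z : R) : (0 < r)%R -> (forall x, 0 <= h x)%R -> (0 <= Z)%R ->
    avgLe Q r h Z -> Lnorm mu r%:E (EFin \o (h \_ Q)) <= (vol Q `^ r^-1 * Z)%:E.
  move=> r0 h0 Z0 hh; rewrite unlock.
  rewrite (_ : (vol Q `^ r^-1 * Z)%:E = ((vol Q)%:E * (Z `^ r)%:E) `^ r^-1); last first.
    rewrite -EFinM poweR_EFin powRM ?powR_ge0// ?ltW ?vol_gt0//.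
    by rewrite -powRrM mulfV ?gt_eqF// powRr1.
  apply: lee_poweR; first by rewrite invr_ge0 ltW.
    by apply: integral_ge0 => x _; exact: poweR_ge0.
  rewrite (_ : \int[mu]_x _ = \int[mu]_(x in Q) (h x `^ r)%:E).
    by rewrite integral_avg lee_wpmul2l// lee_fin ltW ?vol_gt0.
  rewrite [RHS]integral_mkcond; apply: eq_integral => x _.
  rewrite /= !patchE; case: ifPn => _ /=; first by rewrite ger0_norm.
  by rewrite normr0 powR0// gt_eqF.
rewrite avgE -(@lee_pmul2l _ (vol Q)%:E)//; last by rewrite lte_fin vol_gt0.
rewrite muleA volK mul1e.
have -> : \int[mu]_(x in Q) (f x * g x)%:E = Lnorm mu 1 (EFin \o ((f \_ Q) \* (g \_ Q))%R).
  rewrite Lnorm1 integral_mkcond; apply: eq_integral => x _.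
  rewrite /= !patchE; case: ifPn => _ /=; last by rewrite mulr0 normr0.
  by rewrite ger0_norm ?mulr_ge0.
apply: (le_trans (hoelder mu mfQ mgQ p0 q0 pq)).
apply: (le_trans (lee_pmul _ _ (NE _ _ _ p0 f0 X0 hf) (NE _ _ _ q0 g0 Y0 hg))).
- exact: Lnorm_ge0.
- exact: Lnorm_ge0.
have vE : (vol Q `^ p^-1 * vol Q `^ q^-1 = vol Q)%R.
  by rewrite -powRD pq ?oner_eq0// powRr1// ltW// vol_gt0.
by rewrite -!EFinM lee_fin mulrACA vE.
Qed.

Lemma measurable_avg2 Q (f : euclid R d * euclid R d -> \bar R) :
  measurable_fun setT f -> (forall z, 0 <= f z) ->
  measurable_fun setT (fun x => avg Q (fun y => f (x, y))).
Proof.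
move=> mf f0; under eq_fun do rewrite avgE integral_mkcond.
apply: measurable_funeM.
pose g z := f z * (\1_(cube_set Q) z.2)%:E.
rewrite [X in measurable_fun _ X](_ : _ = fun x => \int[@sigma_leb R d]_y g (x, y)).
  apply: measurable_fun_fubini_tonelli_F => [|z]; last first.
    by rewrite /g; apply: mule_ge0 => //; rewrite lee_fin.
  apply: emeasurable_funM => //; apply/measurable_EFinP.
  have mQ := @measurable_indic _ _ R setT _ (measurable_cube Q).
  exact: (measurableT_comp mQ measurable_snd).
apply/funext => x; transitivity (\int[mu]_y g (x, y)); last by [].
apply: eq_integral => y _; rewrite /g patchE indicE /=.
by case: ifPn => _; rewrite ?mule1// mule0.
Qed.

End average_lemmas.

(** * Averages of matrix functions *)

Section real_average.
Context (R : realType) (d : nat).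
Local Notation mu := (leb R d).
Implicit Types (Q : cube R d) (f g : euclid R d -> R).

Definition integ Q f : Prop :=
  measurable_fun setT f /\ (avg Q (fun x => `|f x|%:E) < +oo)%E.

Definition ravg Q f : R := fine (avg Q (fun x => (f x)%:E)).

Lemma integ_integrable Q f : integ Q f -> mu.-integrable Q (EFin \o f).
Proof.
move=> [mf]; rewrite avgE => foo; apply/integrableP; split.
  by apply/measurable_EFinP; exact: measurable_funTS mf.
case: (\int[mu]_(x in Q) _)%E foo => [r _|/=|//]; first exact: ltry.
by rewrite gt0_muley ?ltxx// lte_fin invr_gt0 vol_gt0.
Qed.

Lemma measurable_abs_EFin f : measurable_fun setT f ->
  measurable_fun setT (fun x => `|f x|%:E).
Proof.
move=> mf; apply/measurable_EFinP.
exact: measurableT_comp (@normr_measurable R setT) mf.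
Qed.

Lemma integ_le Q f g : measurable_fun setT f -> (forall x, `|f x| <= `|g x|) ->
  integ Q g -> integ Q f.
Proof.
move=> mf fg [mg goo]; split => //; apply: le_lt_trans goo.
apply: avg_le => [||x|x|x]; [exact: measurable_abs_EFin|exact: measurable_abs_EFin|..];
  by rewrite lee_fin.
Qed.

Lemma integ_cst Q a : integ Q (cst a).
Proof.
by split; [exact: measurable_cst|rewrite (avg_cst Q `|a|%:E) ltry].
Qed.

Lemma integD Q f g : integ Q f -> integ Q g -> integ Q (fun x => f x + g x).
Proof.
move=> [mf foo] [mg goo]; split; first exact: measurable_funD.
apply: (@le_lt_trans _ _ (avg Q (fun x => `|f x|%:E + `|g x|%:E)%E)).
  apply: avg_le => [||x|x|x].
  - by apply: measurable_abs_EFin; exact: measurable_funD.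
  - by apply: emeasurable_funD; exact: measurable_abs_EFin.
  - by rewrite lee_fin.
  - by rewrite adde_ge0// lee_fin.
  - by rewrite -EFinD lee_fin ler_normD.
rewrite avgD => [||| x|x]; last 2 first.
- by rewrite lee_fin.
- by rewrite lee_fin.
- by rewrite lte_add_pinfty.
- exact: measurable_abs_EFin.
- exact: measurable_abs_EFin.
Qed.

Lemma integZ Q a f : integ Q f -> integ Q (fun x => a * f x).
Proof.
move=> [mf foo]; split.
  by apply: measurable_funM => //; exact: measurable_cst.
rewrite (_ : (fun x => _) = (fun x => `|a|%:E * `|f x|%:E)%E); last first.
  by apply/funext => x; rewrite normrM EFinM.
rewrite (avgZ _ (measurable_abs_EFin mf)) => [|x|]; rewrite ?lee_fin//.
by rewrite lte_mul_pinfty// lee_fin.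
Qed.

Lemma integN Q f : integ Q f -> integ Q (fun x => - f x).
Proof.
by move=> /(integZ (-1)) h; under eq_fun do rewrite -mulN1r.
Qed.

Lemma integ_sum Q I (r : seq I) (f : I -> euclid R d -> R) :
  (forall i, integ Q (f i)) -> integ Q (fun x => \sum_(i <- r) f i x).
Proof.
move=> h; elim: r => [|a r IH].
  by under eq_fun do rewrite big_nil; exact: integ_cst.
by under eq_fun do rewrite big_cons; exact: integD.
Qed.

Lemma integ_ravg Q f : integ Q f -> avg Q (fun x => (f x)%:E) = (ravg Q f)%:E.
Proof.
move=> /integ_integrable/(integrable_fin_num (measurable_cube Q)) h.
by rewrite /ravg fineK// avgE fin_numM.
Qed.

Lemma ravgE Q f : integ Q f -> ravg Q f = (vol Q)^-1 * \int[mu]_(x in Q) f x.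
Proof.
move=> /integ_integrable/(integrable_fin_num (measurable_cube Q)) h.
by rewrite /ravg avgE fineM.
Qed.

Lemma ravgD Q f g : integ Q f -> integ Q g ->
  ravg Q (fun x => f x + g x) = ravg Q f + ravg Q g.
Proof.
move=> hf hg; rewrite (ravgE hf) (ravgE hg) (ravgE (integD hf hg)) -mulrDr.
by rewrite (RintegralD (measurable_cube Q) (integ_integrable hf) (integ_integrable hg)).
Qed.

Lemma ravgZ Q a f : integ Q f -> ravg Q (fun x => a * f x) = a * ravg Q f.
Proof.
move=> hf; rewrite (ravgE hf) (ravgE (integZ a hf)).
by rewrite (RintegralZl _ (measurable_cube Q) (integ_integrable hf)) mulrCA.
Qed.

Lemma ravgN Q f : integ Q f -> ravg Q (fun x => - f x) = - ravg Q f.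
Proof.
by move=> hf; under eq_fun do rewrite -mulN1r; rewrite (ravgZ _ hf) mulN1r.
Qed.

Lemma ravg_cst Q a : ravg Q (cst a) = a.
Proof. by rewrite /ravg (avg_cst Q a%:E). Qed.

Lemma ravg_sum Q I (r : seq I) (f : I -> euclid R d -> R) :
  (forall i, integ Q (f i)) ->
  ravg Q (fun x => \sum_(i <- r) f i x) = \sum_(i <- r) ravg Q (f i).
Proof.
move=> h; elim: r => [|a r IH].
  by under eq_fun do rewrite big_nil; rewrite big_nil (ravg_cst Q 0).
under eq_fun do rewrite big_cons.
by rewrite big_cons (ravgD (h a) (integ_sum r h)) IH.
Qed.

Lemma ravg_le_abs Q f : integ Q f ->
  ((ravg Q f)%:E <= avg Q (fun x => `|f x|%:E))%E.
Proof.
move=> hf; rewrite -(integ_ravg hf) !avgE lee_wpmul2l ?volV_ge0//.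
have [mf _] := hf; apply: (le_trans (lee_abs _)).
have mfQ : measurable_fun Q (EFin \o f).
  by apply/measurable_EFinP; exact: measurable_funTS mf.
exact: (le_trans (le_abse_integral mu (measurable_cube Q) mfQ)).
Qed.

Lemma ravg_le Q f (g : euclid R d -> \bar R) : integ Q f ->
  measurable_fun setT g -> (forall x, 0 <= g x)%E ->
  (forall x, `|f x|%:E <= g x)%E -> ((ravg Q f)%:E <= avg Q g)%E.
Proof.
move=> hf mg g0 fg; apply: (le_trans (ravg_le_abs hf)).
have [mf _] := hf.
apply: (avg_le _ (measurable_abs_EFin mf) mg _ g0 fg) => x.
by rewrite lee_fin.
Qed.

End real_average.

Section matrix_average.
Context (R : realType) (d : nat).
Local Notation mu := (leb R d).
Local Notation Re := complex.Re.
Local Notation Im := complex.Im.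
Implicit Types (Q : cube R d).

Definition mxinteg Q m n (F : euclid R d -> 'M[R[i]]_(m, n)) : Prop :=
  forall i j, integ Q (fun x => Re (F x i j)) /\ integ Q (fun x => Im (F x i j)).

(** The rectangular form of `mx_avg`, to which it is convertible for square
matrices. *)
Definition gavg Q m n (F : euclid R d -> 'M[R[i]]_(m, n)) : 'M[R[i]]_(m, n) :=
  \matrix_(i, j) (ravg Q (fun x => Re (F x i j)) +i* ravg Q (fun x => Im (F x i j))).

Lemma mxinteg_meas Q m n (F : euclid R d -> 'M[R[i]]_(m, n)) :
  mxinteg Q F -> mxmeas F.
Proof. by move=> h i j; have [[m1 _] [m2 _]] := h i j. Qed.

Lemma rdot_mul_sum m n (a : 'cV[R[i]]_m) (M : 'M[R[i]]_(m, n)) (b : 'cV[R[i]]_n) :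
  rdot a (M *m b) = \sum_i \sum_j
    ((Re (a i 0) * Re (b j 0) + Im (a i 0) * Im (b j 0)) * Re (M i j) +
     (Im (a i 0) * Re (b j 0) - Re (a i 0) * Im (b j 0)) * Im (M i j)).
Proof.
apply: eq_bigr => i _; rewrite !mxE cRe_sum cIm_sum !mulr_sumr -big_split /=.
by apply: eq_bigr => j _; rewrite cReM cImM; ring.
Qed.

Lemma integ_rdot Q m n (F : euclid R d -> 'M[R[i]]_(m, n)) a b : mxinteg Q F ->
  integ Q (fun x => rdot a (F x *m b)).
Proof.
move=> h; under eq_fun do rewrite rdot_mul_sum.
apply: integ_sum => i; apply: integ_sum => j; have [h1 h2] := h i j.
exact: (integD (integZ _ h1) (integZ _ h2)).
Qed.

Lemma ravg_rdot Q m n (F : euclid R d -> 'M[R[i]]_(m, n)) a b : mxinteg Q F ->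
  ravg Q (fun x => rdot a (F x *m b)) = rdot a (gavg Q F *m b).
Proof.
move=> h; under eq_fun do rewrite rdot_mul_sum; rewrite rdot_mul_sum.
have hij i j : integ Q (fun x =>
    (Re (a i 0) * Re (b j 0) + Im (a i 0) * Im (b j 0)) * Re (F x i j) +
    (Im (a i 0) * Re (b j 0) - Re (a i 0) * Im (b j 0)) * Im (F x i j)).
  by have [h1 h2] := h i j; exact: (integD (integZ _ h1) (integZ _ h2)).
rewrite (ravg_sum _ (fun i => integ_sum _ (hij i))).
apply: eq_bigr => i _; rewrite (ravg_sum _ (hij i)).
apply: eq_bigr => j _; have [h1 h2] := h i j.
by rewrite (ravgD (integZ _ h1) (integZ _ h2)) (ravgZ _ h1) (ravgZ _ h2) !mxE.
Qed.

Lemma measurable_opnorm_EFin m n (F : euclid R d -> 'M[R[i]]_(m, n)) : mxmeas F ->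
  measurable_fun setT (fun x => (opnorm (F x))%:E).
Proof. by move=> mF; apply/measurable_EFinP; exact: measurable_opnorm. Qed.

(** The norm is the supremum of the real forms Re <u, A F B v> over the unit
balls, and each of these commutes with the average. *)
Lemma opnorm_gavg Q m n k l (A : 'M[R[i]]_(m, n)) (F : euclid R d -> 'M[R[i]]_(n, k))
    (B : 'M[R[i]]_(k, l)) : mxinteg Q F ->
  ((opnorm (A *m gavg Q F *m B))%:E <= avg Q (fun x => (opnorm (A *m F x *m B))%:E))%E.
Proof.
move=> hF.
have a0 : (0 <= avg Q (fun x => (opnorm (A *m F x *m B))%:E))%E.
  by apply: avg_ge0 => x; rewrite lee_fin opnorm_ge0.
have mG : measurable_fun setT (fun x => (opnorm (A *m F x *m B))%:E).
  apply: measurable_opnorm_EFin.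
  exact: (mxmeasM (mxmeasM (mxmeas_cst _ A) (mxinteg_meas hF)) (mxmeas_cst _ B)).
case E : (avg Q _) a0 => [t| |] a0; [|by rewrite leey|by []]; move: a0.
rewrite !lee_fin => t0; apply: opnorm_leP => // u v u1 v1.
have E2 M : rdot u (A *m M *m B *m v) = rdot (A ^t* *m u) (M *m (B *m v)).
  by rewrite rdotC -!mulmxA rdot_adj rdotC.
rewrite E2 -(ravg_rdot _ _ hF) -lee_fin -E.
apply: (ravg_le (integ_rdot _ _ hF) mG) => x.
- by rewrite lee_fin opnorm_ge0.
- rewrite lee_fin -E2 ler_norml; apply/andP; split.
    rewrite lerNl -mulN1r -rdotZl (le_trans (rdot_opnorm _ _ _))//.
    rewrite vnormZ normrN1 mul1r -mulrA mulrCA -[leRHS]mulr1 ler_wpM2l ?opnorm_ge0//.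
    by rewrite mulr_ile1 ?vnorm_ge0.
  rewrite (le_trans (rdot_opnorm _ _ _))//.
  rewrite -mulrA mulrCA -[leRHS]mulr1 ler_wpM2l ?opnorm_ge0//.
  by rewrite mulr_ile1 ?vnorm_ge0.
Qed.

Lemma opnorm_col m (v : 'cV[R[i]]_m) : opnorm v = vnorm v.
Proof.
apply/eqP; rewrite eq_le; apply/andP; split.
  apply: opnorm_le => [|w]; first exact: vnorm_ge0.
  have -> : v *m w = w 0 0 *: v.
    by apply/colP => i; rewrite !mxE big_ord1 mulrC.
  rewrite mulrC le_eqVlt; apply/orP; left; apply/eqP.
  rewrite !vnorm_rdot -sqrtrM ?rdot_ge0//; congr Num.sqrt.
  rewrite /rdot big_ord1 mulr_sumr; apply: eq_bigr => i _.
  by rewrite mxE cReM cImM; ring.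
have := vnorm_cols_le v 0; suff -> : v *m ecol R 0 = v by [].
by apply/colP => i; rewrite !mxE big_ord1 !mxE mulr1.
Qed.

Lemma vnorm_gavg Q m n (A : 'M[R[i]]_(m, n)) (F : euclid R d -> 'cV[R[i]]_n) :
  mxinteg Q F ->
  ((vnorm (A *m gavg Q F))%:E <= avg Q (fun x => (vnorm (A *m F x))%:E))%E.
Proof.
move=> hF; have := opnorm_gavg A (1%:M : 'M[R[i]]_1) hF.
rewrite mulmx1 opnorm_col; congr (_ <= avg Q _)%E.
by apply/funext => x; rewrite mulmx1 opnorm_col.
Qed.

Lemma mxintegB Q m n (F : euclid R d -> 'M[R[i]]_(m, n)) M : mxinteg Q F ->
  mxinteg Q (fun x => F x - M).
Proof.
move=> hF i j; have [h1 h2] := hF i j; split.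
  under eq_fun do rewrite !mxE cReD.
  exact: (integD h1 (integ_cst _ _)).
under eq_fun do rewrite !mxE cImD.
exact: (integD h2 (integ_cst _ _)).
Qed.

Lemma gavgB Q m n (F : euclid R d -> 'M[R[i]]_(m, n)) M : mxinteg Q F ->
  gavg Q (fun x => F x - M) = gavg Q F - M.
Proof.
move=> hF; apply/matrixP => i j; have [h1 h2] := hF i j; rewrite !mxE.
under [in LHS]eq_fun do rewrite !mxE cReD.
under [X in _ +i* ravg Q X]eq_fun do rewrite !mxE cImD.
rewrite (ravgD h1 (integ_cst _ _)) (ravgD h2 (integ_cst _ _)) !(ravg_cst Q).
by case: (M i j).
Qed.

Lemma mxinteg_adj Q m n (F : euclid R d -> 'M[R[i]]_(m, n)) : mxinteg Q F ->
  mxinteg Q (fun x => (F x) ^t*).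
Proof.
move=> hF i j; have [h1 h2] := hF j i; split.
  by under eq_fun do rewrite !mxE cReC.
by under eq_fun do rewrite !mxE cImC; exact: integN.
Qed.

Lemma gavg_adj Q m n (F : euclid R d -> 'M[R[i]]_(m, n)) : mxinteg Q F ->
  gavg Q (fun x => (F x) ^t*) = (gavg Q F) ^t*.
Proof.
move=> hF; apply/matrixP => i j; have [h1 h2] := hF j i; rewrite !mxE.
under [in LHS]eq_fun do rewrite !mxE cReC.
under [X in _ +i* ravg Q X]eq_fun do rewrite !mxE cImC.
by rewrite (ravgN h2).
Qed.

Lemma measurable_ecoord (j : 'I_d) :
  measurable_fun setT (fun x : euclid R d => ecoord x j).
Proof.
move=> _ Y mY; rewrite setTI; apply: borel_measurable.
have := @measurable_tnth _ R d j; move=> /(_ measurableT Y mY).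
by rewrite setTI.
Qed.

(** A half-open cube lies in its closure, which is compact. *)
Lemma loc_integrable_integ (f : euclid R d -> R) Q :
  locally_integrable_euclid f -> integ Q f.
Proof.
move=> [mf foo]; split; first exact: mf.
pose I j := `[corner Q j, corner Q j + side Q]%classic.
pose K : set 'rV[R]_d := [set v | forall j, I j (v ord0 j)].
have cK : compact K.
  by apply: (rV_compact (A := I)) => j; exact: segment_compact.
rewrite avgE; apply: lte_mul_pinfty; rewrite ?volV_ge0//.
apply: le_lt_trans (foo K cK).
apply: (ge0_subset_integral mu (measurable_cube Q)).
- rewrite (_ : [set x | _] = \bigcap_(j in [set: 'I_d])
      ((fun x : euclid R d => ecoord x j) @^-1` I j)).
    apply: fin_bigcap_measurable => // j _.
    rewrite -[X in measurable X]setTI; apply: measurable_ecoord => //.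
    exact: measurable_itv.
  apply/seteqP; split => x /= h j; first by have := h j; rewrite mxE.
  by rewrite mxE; exact: h.
- exact: measurable_funTS (measurable_abs_EFin mf).
- by move=> x _; rewrite lee_fin.
- move=> x Qx j; rewrite /I /= mxE in_itv /=.
  by have /andP[-> /ltW ->] := Qx j.
Qed.

Lemma loc_mxinteg Q n (B : euclid R d -> 'M[R[i]]_n) :
  mx_locally_integrable B -> mxinteg Q B.
Proof. by move=> h i j; have [h1 h2] := h i j; split; exact: loc_integrable_integ. Qed.

End matrix_average.

(** * Dyadic subcubes *)

Section dyadic.
Context (R : realType) (d : nat).
Local Notation mu := (leb R d).
Implicit Types (Q : cube R d) (x y : euclid R d) (N : nat).

Lemma half_side_gt0 Q : 0 < side Q / 2.
Proof. by rewrite divr_gt0// side_gt0. Qed.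

(** The half-open dyadic subcubes of Q, indexed by the set of coordinates in which
the upper half is taken; since they are half-open they partition Q exactly. *)
Definition child Q (b : {ffun 'I_d -> bool}) : cube R d :=
  Cube (fun i => corner Q i + (side Q / 2) * (b i)%:R) (half_side_gt0 Q).

Definition dindex Q x : {ffun 'I_d -> bool} :=
  [ffun i => corner Q i + side Q / 2 <= ecoord x i].

Lemma child_sub Q b : cube_set (child Q b) `<=` cube_set Q.
Proof.
move=> x h i; have /andP[h1 h2] := h i; move: h1 h2 => /=.
have := side_gt0 Q; set s := side Q; set c := corner Q i => s0.
by case: (b i); rewrite ?mulr1 ?mulr0 => h1 h2; apply/andP; split; lra.
Qed.

Lemma child_cover Q x : cube_set Q x -> cube_set (child Q (dindex Q x)) x.
Proof.
move=> h i; have /andP[h1 h2] := h i; rewrite /= ffunE.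
move: h1 h2; have := side_gt0 Q; set s := side Q; set c := corner Q i => s0 h1 h2.
by case: (leP (c + s / 2)) => hs; rewrite ?mulr1 ?mulr0; apply/andP; split; lra.
Qed.

Lemma child_dindex Q b x : cube_set (child Q b) x -> dindex Q x = b.
Proof.
move=> h; apply/ffunP => i; rewrite ffunE; have /andP[/=] := h i.
have := side_gt0 Q; set s := side Q; set c := corner Q i => s0.
by case: (b i); rewrite ?mulr1 ?mulr0 => h1 h2; case: leP => // hs; lra.
Qed.

Lemma children_disjoint Q (D : set {ffun 'I_d -> bool}) :
  trivIset D (fun b => cube_set (child Q b)).
Proof. by move=> b b' _ _ [x [/child_dindex <- /child_dindex <-]]. Qed.

Lemma children_cover Q :
  cube_set Q = \big[setU/set0]_(b : {ffun 'I_d -> bool}) cube_set (child Q b).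
Proof.
rewrite -bigcup_seq; apply/seteqP; split => [x Qx|x [b _]]; last exact: child_sub.
by exists (dindex Q x); [rewrite /= mem_index_enum|exact: child_cover].
Qed.

Lemma vol_child Q b : vol (child Q b) = vol Q / 2 ^+ d.
Proof. by rewrite /vol /= expr_div_n. Qed.

Lemma integral_children Q (f : euclid R d -> \bar R) :
  measurable_fun setT f -> (forall x, 0 <= f x)%E ->
  (\int[mu]_(x in Q) f x = \sum_b \int[mu]_(x in child Q b) f x)%E.
Proof.
move=> mf f0; rewrite {1}(children_cover Q).
rewrite ge0_integral_bigsetU//.
- exact: index_enum_uniq.
- exact: children_disjoint.
- exact: measurable_funTS.
Qed.

(** The dyadic subcube of depth N that contains x.  It is total in x: outside Q it
follows the same tests on the coordinates. *)
Fixpoint dcube N Q x : cube R d :=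
  if N is N'.+1 then dcube N' (child Q (dindex Q x)) x else Q.

Lemma dcube_mem N Q x : cube_set Q x -> cube_set (dcube N Q x) x.
Proof. by elim: N Q => //= N IH Q Qx; apply: IH; exact: child_cover. Qed.

Lemma dcube_sub N Q x : cube_set (dcube N Q x) `<=` cube_set Q.
Proof.
by elim: N Q => [|N IH] Q y //= /IH; exact: child_sub.
Qed.

Lemma side_dcube N Q x : side (dcube N Q x) = side Q / 2 ^+ N.
Proof.
elim: N Q => [|N IH] Q /=; first by rewrite divr1.
by rewrite IH /= exprS invfM mulrA.
Qed.

Lemma measurable_dindex Q b : measurable [set x | dindex Q x = b].
Proof.
rewrite (_ : [set x | _] = \bigcap_(i in [set: 'I_d])
  ((fun x => corner Q i + side Q / 2 <= ecoord x i) @^-1` [set b i])).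
  apply: fin_bigcap_measurable => // i _.
  have h : measurable_fun setT (fun x => corner Q i + side Q / 2 <= ecoord x i).
    by apply: measurable_fun_ler; [exact: measurable_cst|exact: measurable_ecoord].
  by have := h measurableT [set b i] I; rewrite setTI.
apply/seteqP; split => [x <- i _ /=|x h]; first by rewrite ffunE.
by apply/ffunP => i; rewrite ffunE; exact: h.
Qed.

Lemma measurable_glue Q (F : {ffun 'I_d -> bool} -> euclid R d -> R) :
  (forall b, measurable_fun setT (F b)) -> measurable_fun setT (fun x => F (dindex Q x) x).
Proof.
move=> mF; rewrite (_ : (fun x => _) = fun x => \sum_(b : {ffun 'I_d -> bool})
   (\1_[set x | dindex Q x = b] x * F b x)).
  apply: measurable_sum => b; apply: measurable_funM; last exact: mF.
  by apply: measurable_indic; exact: measurable_dindex.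
apply/funext => x; rewrite (bigD1 (dindex Q x))//= big1 => [|b bx].
  by rewrite indicE mem_set// mul1r addr0.
by rewrite indicE memNset ?mul0r//= => h; move: bx; rewrite h eqxx.
Qed.

Lemma measurable_dcube (g : cube R d -> R) N Q :
  measurable_fun setT (fun x => g (dcube N Q x)).
Proof.
elim: N Q => [|N IH] Q; first exact: (measurable_cst (g Q)).
exact: (measurable_glue (F := fun b x => g (dcube N (child Q b) x)) _ (fun b => IH _)).
Qed.

(** Belonging to the same dyadic cube of depth N, expressed through the successive
tests on coordinates, so that it is an equivalence relation on the whole space. *)
Fixpoint same N Q x y : Prop :=
  if N is N'.+1 then dindex Q x = dindex Q y /\ same N' (child Q (dindex Q x)) x y
  else True.

Lemma same_sym N Q x y : same N Q x y -> same N Q y x.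
Proof. by elim: N Q => //= N IH Q [h1 h2]; split=> //; rewrite -h1; exact: IH. Qed.

Lemma same_le N N' Q x y : (N <= N')%N -> same N' Q x y -> same N Q x y.
Proof.
elim: N N' Q => //= N IH [//|N'] Q NN' /= [h1 h2]; split => //.
exact: (IH N').
Qed.

Lemma same_dcube N Q x y : same N Q x y -> dcube N Q x = dcube N Q y.
Proof.
by elim: N Q => //= N IH Q [h1 h2]; rewrite (IH _ h2) h1.
Qed.

Lemma dcube_same N Q x y : cube_set (dcube N Q x) y -> same N Q x y.
Proof.
elim: N Q => //= N IH Q h; split; last exact: IH.
by have /dcube_sub/child_dindex := h.
Qed.

(** Up to a set outside Q, a finite union of dyadic subcubes of depth N. *)
Definition depth_set Q N (S : set (euclid R d)) : Prop :=
  measurable S /\ forall x y, same N Q x y -> S x -> S y.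

(** The sets that can be approximated in measure, within Q, by finite unions of
dyadic subcubes.  They form a sigma-algebra that turns out to contain all measurable
sets, which yields the convergence in mean of dyadic averages. *)
Definition appr Q (A : set (euclid R d)) : Prop :=
  measurable A /\ forall e : R, 0 < e -> exists N S, depth_set Q N S /\
    (mu (cube_set Q `&` ((A `\` S) `|` (S `\` A))) <= e%:E)%E.

Lemma depth_setC Q N S : depth_set Q N S -> depth_set Q N (~` S).
Proof.
move=> [mS h]; split; first exact: measurableC.
by move=> x y xy Sx Sy; apply: Sx; apply: h Sy; exact: same_sym.
Qed.

Lemma depth_setU Q N N' S S' : depth_set Q N S -> depth_set Q N' S' ->
  depth_set Q (maxn N N') (S `|` S').
Proof.
move=> [mS h] [mS' h']; split; first exact: measurableU.
move=> x y xy [Sx|Sx]; [left; apply: h Sx|right; apply: h' Sx].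
  by apply: same_le xy; exact: leq_maxl.
by apply: same_le xy; exact: leq_maxr.
Qed.

Lemma appr_depth Q N S : depth_set Q N S -> appr Q S.
Proof.
move=> hS; split; first by case: hS.
move=> e e0; exists N, S; split => //.
by rewrite !setDv setU0 setI0 measure0 lee_fin ltW.
Qed.

Lemma apprC Q A : appr Q A -> appr Q (~` A).
Proof.
move=> [mA h]; split; first exact: measurableC.
move=> e /h [N [S [hS le]]]; exists N, (~` S); split; first exact: depth_setC.
by rewrite !setDE !setCK (setIC (~` A)) (setIC (~` S)) setUC -!setDE.
Qed.

Lemma symdiff_measurable (A S : set (euclid R d)) : measurable A -> measurable S ->
  measurable ((A `\` S) `|` (S `\` A)).
Proof. by move=> mA mS; apply: measurableU; exact: measurableD. Qed.

Lemma apprU Q A A' : appr Q A -> appr Q A' -> appr Q (A `|` A').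
Proof.
move=> [mA h] [mA' h']; split; first exact: measurableU.
move=> e e0; have e2 : 0 < e / 2 by rewrite divr_gt0.
have [N [S [hS le]]] := h _ e2; have [N' [S' [hS' le']]] := h' _ e2.
exists (maxn N N'), (S `|` S'); split; first exact: depth_setU.
have mD := measurableI _ _ (measurable_cube Q) (symdiff_measurable mA hS.1).
have mD' := measurableI _ _ (measurable_cube Q) (symdiff_measurable mA' hS'.1).
apply: (@le_trans _ _ (mu ((cube_set Q `&` ((A `\` S) `|` (S `\` A))) `|`
   (cube_set Q `&` ((A' `\` S') `|` (S' `\` A'))))%classic)); last first.
  apply: (le_trans (measureU2 _ mD mD')); apply: (le_trans (leeD le le')).
  by rewrite -EFinD lee_fin -splitr.
apply: le_measure.
- rewrite inE; apply: measurableI => //; apply: symdiff_measurable.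
    exact: measurableU.
  by apply: measurableU; [case: hS|case: hS'].
- by rewrite inE; exact: measurableU.
- by move=> x [Qx [[[Ax|Ax] /not_orP[nS nS']]|[[Sx|Sx] /not_orP[nA nA']]]];
    [left|right|left|right]; split => //; [left|left|right|right].
Qed.

Lemma appr_close Q A : measurable A ->
  (forall e : R, 0 < e -> exists2 A', appr Q A' &
    (mu (cube_set Q `&` ((A `\` A') `|` (A' `\` A))) <= e%:E)%E) ->
  appr Q A.
Proof.
move=> mA h; split => // e e0; have e2 : 0 < e / 2 by rewrite divr_gt0.
have [A' [mA' h'] le'] := h _ e2; have [N [S [hS le]]] := h' _ e2; exists N, S; split => //.
have mD := measurableI _ _ (measurable_cube Q) (symdiff_measurable mA' hS.1).
have mD' := measurableI _ _ (measurable_cube Q) (symdiff_measurable mA mA').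
apply: (@le_trans _ _ (mu ((cube_set Q `&` ((A `\` A') `|` (A' `\` A))) `|`
   (cube_set Q `&` ((A' `\` S) `|` (S `\` A'))))%classic)); last first.
  apply: (le_trans (measureU2 _ mD' mD)); apply: (le_trans (leeD le' le)).
  by rewrite -EFinD lee_fin -splitr.
apply: le_measure.
- by rewrite inE; apply: measurableI => //; apply: symdiff_measurable => //; case: hS.
- by rewrite inE; exact: measurableU.
- move=> x [Qx AS]; have [A'x|nA'x] := pselect (A' x); case: AS => -[h1 h2].
  + by right; split => //; left.
  + by left; split => //; right.
  + by left; split => //; left.
  + by right; split => //; right.
Qed.

(** The measures of the sets within Q converge to that of their union, by continuity
from below, and they are finite. *)
Lemma appr_incr Q (A : (set (euclid R d))^nat) : (forall k, appr Q (A k)) ->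
  nondecreasing_seq A -> appr Q (\bigcup_k A k).
Proof.
move=> hA ndA; have mA k : measurable (A k) by case: (hA k).
have mU : measurable (\bigcup_k A k) by exact: bigcupT_measurable.
apply: appr_close => // e e0.
have mQA k : measurable (cube_set Q `&` A k) by exact: measurableI.
have QUE : \bigcup_k (cube_set Q `&` A k) = cube_set Q `&` \bigcup_k A k.
  by rewrite setI_bigcupr.
have cv : mu (cube_set Q `&` A k) @[k --> \oo] --> mu (cube_set Q `&` \bigcup_k A k).
  rewrite -QUE; apply: (nondecreasing_cvg_mu (mu := mu)) => //.
    by rewrite QUE; exact: measurableI.
  by move=> k l kl; apply/subsetPset; apply: setIS; apply/subsetPset; exact: ndA.
have fin B : measurable B -> (mu (cube_set Q `&` B) \is a fin_num)%E.
  move=> mB; rewrite ge0_fin_numE//; apply: (@le_lt_trans _ _ (mu (cube_set Q))).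
    by apply: le_measure; rewrite ?inE//; exact: measurableI.
  by rewrite leb_vol ltry.
have [k hk] : exists k, (mu (cube_set Q `&` \bigcup_k A k) <
    mu (cube_set Q `&` A k) + e%:E)%E.
  apply: contrapT => /forallNP h.
  have : (mu (cube_set Q `&` \bigcup_k A k) <=
      mu (cube_set Q `&` \bigcup_k A k) - e%:E)%E.
    have cvl := cvg_lim (@ereal_hausdorff R) cv.
    rewrite -{1}cvl; apply: lime_le; first by apply/cvg_ex; eexists; exact: cv.
    apply: nearW => k; rewrite leeBrDr//.
    by have /negP := h k; rewrite -leNgt.
  by rewrite leeBrDr// -[leRHS]adde0 leeD2lE ?fin// lee_fin leNgt e0.
exists (A k); first exact: hA.
have -> : cube_set Q `&` ((\bigcup_k A k `\` A k) `|` (A k `\` \bigcup_k A k)) =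
    (cube_set Q `&` \bigcup_k A k) `\` (cube_set Q `&` A k).
  apply/seteqP; split => [x [Qx [[UAx nAx]|[Ax nUx]]]|x [[Qx UAx] nAx]].
  - by split=> // -[].
  - by exfalso; apply: nUx; exists k.
  - by split => //; left; split => // Ax; apply: nAx.
rewrite measureD//; last 2 first.
- exact: measurableI.
- by rewrite -ge0_fin_numE// fin.
have -> : cube_set Q `&` \bigcup_k A k `&` (cube_set Q `&` A k) = cube_set Q `&` A k.
  by apply/setIidr => x [Qx Ax]; split => //; exists k.
by rewrite leeBlDl ?fin// ltW.
Qed.

Lemma appr_sigma_algebra Q : sigma_algebra setT (appr Q).
Proof.
split.
- by apply: (@appr_depth Q 0); split.
- by move=> A hA; rewrite setTD; exact: apprC.
- move=> F hF; rewrite -bigcup_bigsetU_bigcup.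
  apply: appr_incr => [k|k l kl]; last first.
    by apply/subsetPset; exact: subset_bigsetU.
  elim: k => [|k IH]; first by rewrite big_ord_recl big_ord0 setU0; exact: hF.
  by rewrite big_ord_recr; exact: apprU.
Qed.

End dyadic.

(** * Approximation of measurable sets by dyadic cubes *)

Section density.
Context (R : realType) (d : nat).
Local Notation mu := (leb R d).
Implicit Types (Q : cube R d) (x y : euclid R d) (N : nat).

Lemma appr_eq Q (A A' : set (euclid R d)) : measurable A ->
  cube_set Q `&` A = cube_set Q `&` A' -> appr Q A' -> appr Q A.
Proof.
move=> mA AA' [mA' h]; split => // e /h [N [S [hS le]]]; exists N, S; split => //.
have AE x : cube_set Q x -> A x <-> A' x.
  move=> Qx; have : (cube_set Q `&` A) x <-> (cube_set Q `&` A') x by rewrite AA'.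
  by move=> [h1 h2]; split => Ax; [have [] := h1 (conj Qx Ax)|have [] := h2 (conj Qx Ax)].
rewrite (_ : _ `&` _ = cube_set Q `&` ((A' `\` S) `|` (S `\` A')))//.
apply/seteqP; split => x [Qx [[h1 h2]|[h1 h2]]]; split => //; (have [h3 h4] := AE x Qx);
  [left|right|left|right]; split; tauto.
Qed.

(** Within Q, the half-space is the union over N of the dyadic cubes of depth N
whose upper face lies in its closure. *)
Lemma appr_ray Q (i : 'I_d) (a : R) : appr Q [set x | ecoord x i < a].
Proof.
pose S N : set (euclid R d) := [set x | corner (dcube N Q x) i + side Q / 2 ^+ N <= a].
have mray : measurable [set x : euclid R d | ecoord x i < a].
  have := @measurable_ecoord R d i measurableT `]-oo, a[%classic (measurable_itv _).
  rewrite setTI; congr measurable; apply/seteqP; split => x /=; rewrite in_itv //=.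
apply: (@appr_eq _ _ (\bigcup_N S N)) => //; last first.
  have [_ _ h] := appr_sigma_algebra Q; apply: h => N; apply: (@appr_depth _ _ _ N); split.
    have h := measurable_dcube (fun Q' => corner Q' i + side Q / 2 ^+ N) N Q.
    have := h measurableT `]-oo, a]%classic (measurable_itv _).
    rewrite setTI; congr measurable; apply/seteqP; split => x /=; rewrite in_itv //=.
  by move=> x y /same_dcube E; rewrite /S /= E.
apply/seteqP; split => x [Qx].
  move=> /= xa; split => //.
  have [N hN] : exists N, side Q / 2 ^+ N <= a - ecoord x i.
    have := @cvg_geometric R (side Q) 2^-1.
    rewrite ger0_norm ?invr_ge0// invf_lt1// ltr1n => /(_ isT).
    move=> /cvgrPdist_le /(_ (a - ecoord x i)); rewrite subr_gt0 => /(_ xa)[N _ /(_ N (leqnn N))].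
    rewrite /geometric /= sub0r normrN exprVn ger0_norm; first by exists N.
    by rewrite divr_ge0 ?exprn_ge0// ltW// side_gt0.
  exists N => //; rewrite /S /=.
  by have /andP[h1 h2] := dcube_mem N Qx i; move: h1 hN; lra.
move=> [N _]; rewrite /S /= => h; split => //=.
have /andP[h1 h2] := dcube_mem N Qx i.
by move: h2; rewrite side_dcube => /lt_le_trans; apply.
Qed.

Lemma appr_coord Q (i : 'I_d) (Y : set R) : measurable Y ->
  appr Q ((fun x => ecoord x i) @^-1` Y).
Proof.
have [h0 hC hU] := appr_sigma_algebra Q.
rewrite -[measurable Y]/((@ocitv R).-sigma.-measurable Y).
rewrite RGenInftyO.measurableE.
pose C := [set Y : set R | appr Q ((fun x => ecoord x i) @^-1` Y)].
suff h : <<s @RGenInftyO.G R >> `<=` C by move=> /h.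
apply: smallest_sub.
  split.
  - by rewrite /C /= preimage_set0.
  - by move=> A hA; rewrite /C /= setTD preimage_setC; exact: apprC.
  - by move=> F hF; rewrite /C /= preimage_bigcup; apply: hU.
move=> _ [a ->]; rewrite /C /=; have := appr_ray Q i a.
by congr appr; apply/seteqP; split => x /=; rewrite in_itv.
Qed.

Lemma appr_borel Q (A : set (d.-tuple R)) : measurable A -> appr Q (A : set (euclid R d)).
Proof.
apply: smallest_sub; first exact: appr_sigma_algebra.
move=> B; rewrite -bigcup_seq => -[i _ [Y mY <-]]; rewrite setTI.
exact: (appr_coord Q i mY).
Qed.

(** The definition of the outer measure covers a Lebesgue set, inside Q, by a
Borel set of nearly the same measure. *)
Lemma appr_measurable Q (A : set (euclid R d)) : measurable A -> appr Q A.
Proof.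
move=> mA; apply: appr_close => // e e0.
have mQ := measurable_cube Q.
have mQA : measurable (cube_set Q `&` A) by exact: measurableI.
have fin : (mu (cube_set Q `&` A) \is a fin_num)%E.
  rewrite ge0_fin_numE//; apply: (@le_lt_trans _ _ (mu (cube_set Q))).
    by apply: le_measure; rewrite ?inE.
  by rewrite leb_vol ltry.
have [_ [F [mF QF] <-] hF] := lb_ereal_inf_adherent e0 fin.
pose B : set (euclid R d) := \bigcup_k F k.
have mB : measurable (\bigcup_k F k) by exact: bigcupT_measurable.
have mB' : measurable B := borel_measurable mB.
have muB : (mu B <= mu (cube_set Q `&` A) + e%:E)%E.
  apply: le_trans (ltW hF).
  apply: (@le_trans _ _ (\sum_(k <oo) mu (F k : set (euclid R d)))%E).
    by apply: measure_sigma_subadditive => // k; exact: borel_measurable.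
  apply: lee_nneseries => k _ //; rewrite /= /completed_measure_extension.
  by rewrite measurable_mu_extE.
exists B; first exact: appr_borel.
apply: (@le_trans _ _ (mu (B `\` (cube_set Q `&` A)))).
  apply: le_measure.
  - by rewrite inE; apply: measurableI => //; exact: symdiff_measurable.
  - by rewrite inE; exact: measurableD.
  - move=> x [Qx [[Ax nBx]|[Bx nAx]]]; last by split => // -[].
    by exfalso; apply: nBx; apply: QF.
rewrite measureD//; last first.
  by rewrite (le_lt_trans muB)// lte_add_pinfty ?ltry// -ge0_fin_numE.
by rewrite (setIidr QF) leeBlDl.
Qed.

End density.

(** * Convergence in mean of dyadic averages *)

Section conditional_expectation.
Import HBSimple.
Context (R : realType) (d : nat).
Local Notation mu := (leb R d).
Implicit Types (Q : cube R d) (x y : euclid R d) (N : nat) (f g : euclid R d -> R).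

(** The conditional expectation of f with respect to the dyadic subcubes of Q of
depth N. *)
Definition EN N Q f x : R := ravg (dcube N Q x) f.

Lemma measurable_EN N Q f : measurable_fun setT (EN N Q f).
Proof. exact: (measurable_dcube (fun Q' => ravg Q' f)). Qed.

Lemma integ_sub Q Q' f : cube_set Q' `<=` cube_set Q -> integ Q f -> integ Q' f.
Proof.
move=> QQ' hf; split; first by case: hf.
have /integrableP[mf foo] := integ_integrable hf.
rewrite avgE; apply: lte_mul_pinfty; rewrite ?volV_ge0//.
apply: le_lt_trans foo.
have mfQ : measurable_fun Q (fun x => `|f x|%:E).
  exact: measurable_funTS (measurable_abs_EFin (proj1 hf)).
apply: (ge0_subset_integral mu (measurable_cube Q') (measurable_cube Q) mfQ _ QQ').
by move=> x _; rewrite lee_fin.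
Qed.

Lemma ravg_eq_on Q f g : (forall x, cube_set Q x -> f x = g x) -> ravg Q f = ravg Q g.
Proof.
move=> fg; rewrite /ravg !avgE; congr (fine (_ * _)).
by apply: eq_integral => x; rewrite inE => Qx; rewrite fg.
Qed.

Lemma ravg_cst_on Q f a : (forall x, cube_set Q x -> f x = a) -> ravg Q f = a.
Proof. by move=> h; rewrite (ravg_eq_on (g := cst a)) ?ravg_cst. Qed.

Lemma norm_ravg_le Q f : integ Q f -> (`|ravg Q f|%:E <= avg Q (fun x => `|f x|%:E))%E.
Proof.
move=> hf; have h1 := ravg_le_abs hf; have h2 := ravg_le_abs (integN hf).
rewrite (ravgN hf) in h2.
case: (leP 0 (ravg Q f)) => s0; first by rewrite ger0_norm.
rewrite ltr0_norm// (le_trans h2)//.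
by under eq_fun do rewrite normrN.
Qed.

(** Averaging does not increase the integral of the modulus on each subcube. *)
Lemma EN_contraction N Q f : integ Q f ->
  (\int[mu]_(x in Q) `|EN N Q f x|%:E <= \int[mu]_(x in Q) `|f x|%:E)%E.
Proof.
elim: N Q => [|N IH] Q hf.
  rewrite !integral_avg lee_wpmul2l ?lee_fin ?(ltW (vol_gt0 Q))//.
  have -> : (fun x => `|EN 0 Q f x|%:E) = cst `|ravg Q f|%:E by [].
  by rewrite avg_cst norm_ravg_le.
have mE : measurable_fun setT (fun x => `|EN N.+1 Q f x|%:E).
  exact: measurable_abs_EFin (measurable_EN N.+1 Q f).
have mf : measurable_fun setT (fun x => `|f x|%:E).
  exact: measurable_abs_EFin (proj1 hf).
have p0 h x : (0 <= `|(h x : R)|%:E)%E by rewrite lee_fin.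
rewrite (integral_children Q mE (p0 (EN N.+1 Q f))) (integral_children Q mf (p0 f)).
apply: lee_sum => b _; apply: le_trans (IH _ (integ_sub (@child_sub _ _ Q b) hf)).
rewrite le_eqVlt; apply/orP; left; apply/eqP.
by apply: eq_integral => x; rewrite inE => /child_dindex; rewrite /EN /= => ->.
Qed.

Lemma avg_EN_le N Q f : integ Q f ->
  (avg Q (fun x => `|EN N Q f x|%:E) <= avg Q (fun x => `|f x|%:E))%E.
Proof. by move=> hf; rewrite !avgE lee_wpmul2l ?volV_ge0// EN_contraction. Qed.

Lemma ENB N Q f g x : integ Q f -> integ Q g ->
  EN N Q (fun x => f x - g x) x = EN N Q f x - EN N Q g x.
Proof.
move=> /(integ_sub (@dcube_sub _ _ N Q x)) hf /(integ_sub (@dcube_sub _ _ N Q x)) hg.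
by rewrite /EN (ravgD hf (integN hg)) (ravgN hg).
Qed.

Lemma END N Q f g x : integ Q f -> integ Q g ->
  EN N Q (fun x => f x + g x) x = EN N Q f x + EN N Q g x.
Proof.
move=> /(integ_sub (@dcube_sub _ _ N Q x)) hf /(integ_sub (@dcube_sub _ _ N Q x)) hg.
by rewrite /EN (ravgD hf hg).
Qed.

Lemma ENZ N Q a f x : integ Q f -> EN N Q (fun x => a * f x) x = a * EN N Q f x.
Proof. by move=> /(integ_sub (@dcube_sub _ _ N Q x)) hf; rewrite /EN (ravgZ _ hf). Qed.

Definition dist1 Q f g : \bar R := avg Q (fun x => `|f x - g x|%:E).

Lemma measurable_dist f g : measurable_fun setT f -> measurable_fun setT g ->
  measurable_fun setT (fun x => `|f x - g x|%:E).
Proof. by move=> mf mg; apply: measurable_abs_EFin; exact: measurable_funB. Qed.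

Lemma dist1_triangle Q f g h : measurable_fun setT f -> measurable_fun setT g ->
  measurable_fun setT h -> (dist1 Q f h <= dist1 Q f g + dist1 Q g h)%E.
Proof.
move=> mf mg mh; have m1 := measurable_dist mf mg; have m2 := measurable_dist mg mh.
have p0 (k l : euclid R d -> R) x : (0 <= `|k x - l x|%:E)%E by rewrite lee_fin.
rewrite /dist1 -(avgD _ m1 m2 (p0 _ _) (p0 _ _)).
apply: (avg_le _ (measurable_dist mf mh) (emeasurable_funD m1 m2) (p0 _ _)) => x.
- by rewrite adde_ge0// lee_fin.
- by rewrite -EFinD lee_fin (le_trans _ (ler_normD _ _))// addrA subrK.
Qed.

Definition L1conv Q f : Prop := integ Q f /\
  forall e : R, 0 < e -> exists N0, forall N, (N0 <= N)%N ->
    (dist1 Q f (EN N Q f) <= e%:E)%E.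

(** The functions with convergent dyadic averages form a closed set, because
the averages are contractions. *)
Lemma L1conv_approx Q f : integ Q f ->
  (forall e : R, 0 < e -> exists2 g, L1conv Q g & (dist1 Q f g <= e%:E)%E) ->
  L1conv Q f.
Proof.
move=> hf h; split => // e e0; have e3 : 0 < e / 3 by rewrite divr_gt0.
have [g [hg cg] fg] := h _ e3; have [N0 hN0] := cg _ e3.
exists N0 => N /hN0 gE.
have [mf mg] := (proj1 hf, proj1 hg).
have mEf := measurable_EN N Q f; have mEg := measurable_EN N Q g.
apply: (le_trans (dist1_triangle Q mf mg mEf)).
have -> : e%:E = (e / 3)%:E + ((e / 3)%:E + (e / 3)%:E) :> \bar R.
  by rewrite -!EFinD; congr EFin; field.
apply: (leeD fg (le_trans (dist1_triangle Q mg mEg mEf) (leeD gE _))).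
rewrite /dist1.
have -> : (fun x => `|EN N Q g x - EN N Q f x|%:E) =
    (fun x => `|EN N Q (fun x => f x - g x) x|%:E).
  by apply/funext => x; rewrite (ENB _ _ hf hg) distrC.
by apply: (le_trans (avg_EN_le N (integD hf (integN hg)))).
Qed.

Lemma integ_indic Q (A : set (euclid R d)) : measurable A -> integ Q (\1_A : _ -> R).
Proof.
move=> mA; apply: (integ_le (g := cst 1)); last exact: integ_cst.
  exact: measurable_indic.
by move=> x; rewrite indicE normr1 ger0_norm// lern1; case: (_ \in _).
Qed.

(** A function that is constant on the dyadic cubes of depth N is reproduced by
all averages of depth at least N. *)
Lemma L1conv_depth Q N S : depth_set Q N S -> L1conv Q (\1_S : _ -> R).
Proof.
move=> [mS hS]; split; first exact: integ_indic.
move=> e e0; exists N => N' NN'.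
rewrite (_ : dist1 _ _ _ = 0%E) ?lee_fin ?(ltW e0)//.
rewrite /dist1 avgE (_ : integral _ _ _ = 0%E) ?mule0//.
apply: integral0_eq => x Qx.
rewrite /EN (ravg_cst_on (a := \1_S x)) ?subrr ?normr0// => y /dcube_same/(same_le NN') xy.
rewrite !indicE; congr (nat_of_bool _)%:R; apply/idP/idP; rewrite !inE => h.
  by apply: hS h; exact: same_sym.
exact: hS h.
Qed.

Lemma L1conv_indic Q (A : set (euclid R d)) : measurable A -> L1conv Q (\1_A : _ -> R).
Proof.
move=> mA; apply: L1conv_approx => [|e e0]; first exact: integ_indic.
have e2 : 0 < e * vol Q by rewrite mulr_gt0// vol_gt0.
have [N [S [hS le]]] := (appr_measurable Q mA).2 _ e2.
exists (\1_S); first exact: L1conv_depth hS.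
have mD := symdiff_measurable mA hS.1.
rewrite /dist1 (_ : (fun x => _) = (fun x => (\1_((A `\` S) `|` (S `\` A)) x)%:E)).
  rewrite avgE integral_indic// setIC -(@lee_pmul2l _ (vol Q)%:E)//; last first.
    by rewrite lte_fin vol_gt0.
  by rewrite muleA volK mul1e -EFinM mulrC.
apply/funext => x; congr EFin; rewrite !indicE.
rewrite in_setU !in_setD.
by case: (x \in A); case: (x \in S); rewrite /= ?subrr ?subr0 ?sub0r ?normrN ?normr0 ?normr1.
Qed.

Lemma L1convD Q f g : L1conv Q f -> L1conv Q g -> L1conv Q (fun x => f x + g x).
Proof.
move=> [hf cf] [hg cg]; split; first exact: integD.
move=> e e0; have e2 : 0 < e / 2 by rewrite divr_gt0.
have [N1 h1] := cf _ e2; have [N2 h2] := cg _ e2.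
exists (maxn N1 N2) => N; rewrite geq_max => /andP[/h1 {}h1 /h2 {}h2].
have m1 := measurable_dist (proj1 hf) (measurable_EN N Q f).
have m2 := measurable_dist (proj1 hg) (measurable_EN N Q g).
apply: (@le_trans _ _ (dist1 Q f (EN N Q f) + dist1 Q g (EN N Q g))%E); last first.
  by apply: (le_trans (leeD h1 h2)); rewrite -EFinD -splitr.
have p0 (k l : euclid R d -> R) x : (0 <= `|k x - l x|%:E)%E by rewrite lee_fin.
have m3 := measurable_dist (measurable_funD (proj1 hf) (proj1 hg))
  (measurable_EN N Q (fun x => f x + g x)).
rewrite /dist1 -(avgD _ m1 m2 (p0 _ _) (p0 _ _)).
apply: (avg_le _ m3 (emeasurable_funD m1 m2) (p0 _ _)) => x.
- by rewrite adde_ge0// lee_fin.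
- rewrite (END _ _ hf hg) -EFinD lee_fin (le_trans _ (ler_normD _ _))//.
  by rewrite opprD addrACA.
Qed.

Lemma L1convZ Q a f : L1conv Q f -> L1conv Q (fun x => a * f x).
Proof.
move=> [hf cf]; split; first exact: integZ.
move=> e e0; have e2 : 0 < e / (`|a| + 1) by rewrite divr_gt0// ltr_wpDl.
have [N0 h0] := cf _ e2; exists N0 => N /h0 {}h0.
have m1 := measurable_dist (proj1 hf) (measurable_EN N Q f).
rewrite /dist1 (_ : (fun x => _) = (fun x => `|a|%:E * `|f x - EN N Q f x|%:E)%E); last first.
  by apply/funext => x; rewrite (ENZ _ _ _ hf) -mulrBr normrM EFinM.
rewrite (avgZ _ m1) => [|x|]; rewrite ?lee_fin//.
apply: (@le_trans _ _ (`|a|%:E * (e / (`|a| + 1))%:E)%E).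
  by rewrite lee_wpmul2l// lee_fin.
rewrite -EFinM lee_fin mulrCA ler_piMr ?(ltW e0)// ler_pdivrMr ?ltr_wpDl// mul1r.
by rewrite lerDl.
Qed.

Lemma L1conv_cst0 Q : L1conv Q (fun=> 0).
Proof.
have := L1convZ 0 (@L1conv_indic Q setT measurableT).
by congr L1conv; apply/funext => x; rewrite mul0r.
Qed.

Lemma L1conv_sum Q I (r : seq I) (f : I -> euclid R d -> R) :
  (forall i, L1conv Q (f i)) -> L1conv Q (fun x => \sum_(i <- r) f i x).
Proof.
move=> h; elim: r => [|a r IH].
  by under eq_fun do rewrite big_nil; exact: L1conv_cst0.
by under eq_fun do rewrite big_cons; exact: (L1convD (h a) IH).
Qed.

Lemma L1conv_sfun Q (g : {sfun (euclid R d) >-> R}) : L1conv Q g.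
Proof.
pose s : seq R := finmap.enum_fset (fset_set (range g)).
have -> : (g : euclid R d -> R) = fun x => \sum_(i < size s)
    (s`_i * \1_(g @^-1` [set s`_i]) x).
  by apply/funext => x; exact: fimfunEord.
apply: L1conv_sum => i; apply: L1convZ; apply: L1conv_indic.
exact: measurable_sfunP.
Qed.

(** Density: from unions of dyadic cubes to measurable sets, then to simple
functions, then to integrable functions. *)
Lemma L1conv_integ Q f : integ Q f -> L1conv Q f.
Proof.
move=> hf; apply: L1conv_approx => // e e0.
have [g [_ _ cg]] := approximation_sfun_integrable (measurable_cube Q) (integ_integrable hf).
have e2 : 0 < e * vol Q by rewrite mulr_gt0// vol_gt0.
move/fine_cvgP: cg => [[N1 _ h1]] /cvgrPdist_le /(_ _ e2) [N2 _ h2].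
pose k := maxn N1 N2; exists (g k); first exact: L1conv_sfun.
have := h2 k (leq_maxr _ _); have := h1 k (leq_maxl _ _).
rewrite sub0r normrN /dist1 avgE => fk; rewrite -lee_fin => le.
rewrite -(@lee_pmul2l _ (vol Q)%:E)//; last by rewrite lte_fin vol_gt0.
rewrite muleA volK mul1e -EFinM mulrC.
apply: le_trans le.
rewrite ger0_norm ?fine_ge0 ?integral_ge0// fineK//.
Qed.

End conditional_expectation.

(** * From dyadic averages to the function *)

Section fatou_average.
Context (R : realType) (d : nat).
Local Notation mu := (leb R d).
Local Notation Re := complex.Re.
Local Notation Im := complex.Im.
Implicit Types (Q : cube R d) (x y : euclid R d) (N : nat).

Lemma cvg_powR (f : nat -> R) (a p : R) : 0 < p -> (forall k, 0 <= f k) ->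
  f k @[k --> \oo] --> a -> f k `^ p @[k --> \oo] --> a `^ p.
Proof.
move=> p0 f0 fa.
have a0 : 0 <= a.
  rewrite -(cvg_lim (@Rhausdorff R) fa).
  by apply: limr_ge; [exact: cvgP fa|exact: nearW].
move: a0; rewrite le_eqVlt => /orP[/eqP a0|a0]; last first.
  have ca : {for a, continuous (fun t : R => t `^ p)}.
    apply: differentiable_continuous; apply/derivable1_diffP.
    by apply: derivable_powR; rewrite in_itv/= a0.
  exact: (cvg_comp _ _ fa ca).
rewrite -a0 powR0 ?gt_eqF//; rewrite -a0 in fa.
apply/cvgrPdist_le => e e0.
move/cvgrPdist_le : fa => /(_ (e `^ p^-1) (powR_gt0 _ e0)).
apply: filterS => k; rewrite !sub0r !normrN !ger0_norm ?powR_ge0// => h.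
have -> : e = (e `^ p^-1) `^ p by rewrite -powRrM mulVf ?gt_eqF// powRr1// ltW.
by rewrite ge0_ler_powR ?nnegrE ?powR_ge0 ?(ltW p0).
Qed.

Definition entry_sum m n (A : 'M[R[i]]_(m, n)) : R :=
  \sum_j \sum_i (`|Re (A i j)| + `|Im (A i j)|).

Lemma opnorm_le_entries m n (A : 'M[R[i]]_(m, n)) : opnorm A <= 2 * entry_sum A.
Proof.
rewrite (le_trans (opnorm_le_cols _))// ler_wpM2l//; apply: ler_sum => j _.
rewrite -[A *m _]mul1mx mulmx_cols (le_trans (ler_vnorm_sum _ _ _))//.
apply: ler_sum => i _; rewrite mul1mx (le_trans (vnormZ_le _ _))// vnorm_ecol mulr1.
suff -> : (A *m ecol R j) i 0 = A i j by [].
rewrite mxE (bigD1 j)//= big1 => [|k kj]; first by rewrite !mxE !eqxx /= mulr1 addr0.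
by rewrite !mxE (negbTE kj) mulr0.
Qed.

Definition mxEN N Q m n (F : euclid R d -> 'M[R[i]]_(m, n)) x := gavg (dcube N Q x) F.

Lemma mxmeas_mxEN N Q m n (F : euclid R d -> 'M[R[i]]_(m, n)) : mxmeas (mxEN N Q F).
Proof.
move=> i j; split.
  apply: (eq_measurable_fun (EN N Q (fun x => Re (F x i j)))); last exact: measurable_EN.
  by move=> x _; rewrite mxE.
apply: (eq_measurable_fun (EN N Q (fun x => Im (F x i j)))); last exact: measurable_EN.
by move=> x _; rewrite mxE.
Qed.

Lemma avg_entry_sum_cvg Q m n (F : euclid R d -> 'M[R[i]]_(m, n)) : mxinteg Q F ->
  forall e : R, 0 < e -> exists N,
    (avg Q (fun x => (entry_sum (F x - mxEN N Q F x))%:E) <= e%:E)%E.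
Proof.
move=> hF e e0.
pose D N j i x : R := `|Re (F x i j) - EN N Q (fun x => Re (F x i j)) x| +
  `|Im (F x i j) - EN N Q (fun x => Im (F x i j)) x|.
have E N : (fun x => (entry_sum (F x - mxEN N Q F x))%:E) =
    (fun x => (\sum_j \sum_i (D N j i x)%:E)%E).
  apply/funext => x; rewrite /entry_sum -sumEFin; apply: eq_bigr => j _.
  rewrite -sumEFin; apply: eq_bigr => i _.
  by rewrite !mxE cReD cImD cReN cImN.
pose c : R := e / ((m * n)%:R + 1).
have c0 : 0 < c by rewrite divr_gt0// ltr_wpDl.
have hij j i : exists N0, forall N, (N0 <= N)%N ->
    (avg Q (fun x => (D N j i x)%:E) <= c%:E)%E.
  have [h1 h2] := hF i j; have c2 : 0 < c / 2 by rewrite divr_gt0.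
  have [_ /(_ _ c2) [N1 hN1]] := L1conv_integ h1.
  have [_ /(_ _ c2) [N2 hN2]] := L1conv_integ h2.
  exists (maxn N1 N2) => N; rewrite geq_max => /andP[/hN1 {}hN1 /hN2 {}hN2].
  have m1 := measurable_dist (proj1 h1) (measurable_EN N Q (fun x => Re (F x i j))).
  have m2 := measurable_dist (proj1 h2) (measurable_EN N Q (fun x => Im (F x i j))).
  have p0 (k l : euclid R d -> R) x : (0 <= `|k x - l x|%:E)%E by rewrite lee_fin.
  rewrite (_ : (fun x => _) = (fun x => `|Re (F x i j) - EN N Q (fun x => Re (F x i j)) x|%:E +
     `|Im (F x i j) - EN N Q (fun x => Im (F x i j)) x|%:E)%E)//.
  rewrite (avgD _ m1 m2 (p0 _ _) (p0 _ _)).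
  by apply: (le_trans (leeD hN1 hN2)); rewrite -EFinD -splitr.
pose N1 j i := sval (cid (hij j i)).
have hN1 j i N : (N1 j i <= N)%N -> (avg Q (fun x => (D N j i x)%:E) <= c%:E)%E.
  by rewrite /N1; case: (cid _) => /= k hk /hk.
pose N := (\max_j \max_i N1 j i)%N; exists N.
have mD j i : measurable_fun setT (fun x => (D N j i x)%:E).
  have [h1 h2] := hF i j; apply/measurable_EFinP; apply: measurable_funD.
    apply: measurableT_comp; first exact: normr_measurable.
    exact: (measurable_funB (proj1 h1) (measurable_EN N Q _)).
  apply: measurableT_comp; first exact: normr_measurable.
  exact: (measurable_funB (proj1 h2) (measurable_EN N Q _)).
have D0 j i x : (0 <= (D N j i x)%:E)%E by rewrite lee_fin addr_ge0.
rewrite E avg_sum; last 2 first.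
- by move=> j; apply: emeasurable_sum => i; exact: mD.
- by move=> j x; apply: sume_ge0 => i _; exact: D0.
apply: (@le_trans _ _ (\sum_(j < n) \sum_(i < m) c%:E)%E).
  apply: lee_sum => j _; rewrite (avg_sum _ _ (mD j) (D0 j)); apply: lee_sum => i _.
  apply: hN1; rewrite /N.
  by rewrite (leq_trans _ (leq_bigmax j))// (leq_trans _ (leq_bigmax i)).
under eq_bigr do rewrite sumEFin.
rewrite sumEFin lee_fin !sumr_const !card_ord -mulrnA -[_ *+ _]mulr_natl /c mulrCA.
by rewrite ler_piMr ?(ltW e0)// ler_pdivrMr ?ltr_wpDl// mul1r lerDl.
Qed.

(** Along a subsequence the mean distances are at most 2^-l, hence summable, so
the distances are summable almost everywhere. *)
Lemma ae_subseq Q m n (F : euclid R d -> 'M[R[i]]_(m, n)) : mxinteg Q F ->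
  exists k : nat -> nat, {ae mu, forall x, cube_set Q x ->
    entry_sum (F x - mxEN (k l) Q F x) @[l --> \oo] --> (0 : R)}.
Proof.
move=> hF; have h l : (0 : R) < 2 ^- l by rewrite invr_gt0 exprn_gt0.
pose k l := sval (cid (avg_entry_sum_cvg hF (h l))).
have hk l : (avg Q (fun x => (entry_sum (F x - mxEN (k l) Q F x))%:E) <= (2 ^- l)%:E)%E.
  by rewrite /k; case: (cid _).
exists k; pose g l x : \bar R := (entry_sum (F x - mxEN (k l) Q F x))%:E.
have mg l : measurable_fun setT (g l).
  apply/measurable_EFinP; apply: measurable_sum => j; apply: measurable_sum => i.
  have [m1 m2] := mxmeasB (mxinteg_meas hF) (mxmeas_mxEN (k l) Q F) i j.
  by apply: measurable_funD; apply: measurableT_comp => //; exact: normr_measurable.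
have g0 l x : (0 <= g l x)%E.
  by rewrite lee_fin; apply: sumr_ge0 => j _; apply: sumr_ge0 => i _; rewrite addr_ge0.
have mQ := measurable_cube Q.
have hS : (\int[mu]_(x in Q) (\sum_(l <oo) g l x) < +oo)%E.
  rewrite integral_nneseries//; last by move=> l; exact: measurable_funTS (mg l).
  apply: (@le_lt_trans _ _ (\sum_(l <oo) ((vol Q * 2) / (2 ^ (l + 1))%:R)%:E)%E).
    apply: lee_nneseries => l _; first by move=> *; apply: integral_ge0.
    rewrite integral_avg (le_trans (lee_wpmul2l _ (hk l)))//.
      by rewrite lee_fin ltW// vol_gt0.
    rewrite -EFinM lee_fin -mulrA ler_wpM2l ?(ltW (vol_gt0 Q))//.
    by rewrite addn1 expnS natrM invfM mulrA mulfV// mul1r natrX.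
  have /cvg_lim := @cvg_geometric_eseries_half R (vol Q * 2) 0.
  by rewrite /eseries => ->//; rewrite ltry.
have intS : mu.-integrable Q (fun x => \sum_(l <oo) g l x)%E.
  apply/integrableP; split.
    by apply: ge0_emeasurable_sum => // l _; exact: measurable_funTS (mg l).
  apply: le_lt_trans hS; rewrite le_eqVlt; apply/orP; left; apply/eqP.
  by apply: eq_integral => x _; rewrite gee0_abs// nneseries_ge0.
apply: filterS (integrable_ae mQ intS) => x fin Qx.
have {}fin := fin Qx.
have tl := @nneseries_tail_cvg R (g ^~ x) xpredT.
have {}tl : (\sum_(N <= l <oo) g l x)%E @[N --> \oo] --> 0%E.
  by apply: tl => //; rewrite -ge0_fin_numE// nneseries_ge0.
have gc : g l x @[l --> \oo] --> 0%E.
  apply: (@squeeze_cvge _ _ _ _ (cst 0%E) _ (fun N => \sum_(N <= l <oo) g l x)%E) => //;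
    last exact: cvg_cst.
  apply: nearW => N; rewrite g0 /= (@nneseries_split _ _ N 1)//.
  rewrite addn1 big_nat1 leeDl// nneseries_ge0//.
by move/fine_cvgP: gc => [_].
Qed.

(** A bound that is uniform in the depth passes to F: the integrands converge
almost everywhere along a subsequence, and Fatou's lemma applies. *)
Lemma fatou_EN Q n (F v : euclid R d -> 'M[R[i]]_n) (M : 'M[R[i]]_n) (e : 'cV[R[i]]_n)
    (p : R) (X : \bar R) : 0 < p -> mxinteg Q F -> mxmeas v ->
  (forall N, \int[mu]_(x in Q) (vnorm (v x *m (mxEN N Q F x - M) *m e) `^ p)%:E <= X)%E ->
  (\int[mu]_(x in Q) (vnorm (v x *m (F x - M) *m e) `^ p)%:E <= X)%E.
Proof.
move=> p0 hF mv hX; have [k hk] := ae_subseq hF.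
have mQ := measurable_cube Q.
pose f G x : \bar R := (vnorm (v x *m (G x - M) *m e) `^ p)%:E.
have mf G : mxmeas G -> measurable_fun setT (f G).
  move=> mG; apply: measurable_powR_EFin; apply: measurable_vnorm.
  exact: (mxmeasM (mxmeasM mv (mxmeasB mG (mxmeas_cst _ M))) (mxmeas_cst _ e)).
have mfl l : measurable_fun Q (f (mxEN (k l) Q F)).
  exact: measurable_funTS (mf _ (mxmeas_mxEN (k l) Q F)).
have f0 l x : cube_set Q x -> (0 <= f (mxEN (k l) Q F) x)%E.
  by move=> _; rewrite lee_fin powR_ge0.
apply: (@le_trans _ _ (\int[mu]_(x in Q) limn_einf (fun l => f (mxEN (k l) Q F) x))%E).
  apply: (ae_ge0_le_integral mQ).
  - by move=> x _; rewrite lee_fin powR_ge0.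
  - exact: measurable_funTS (mf _ (mxinteg_meas hF)).
  - move=> x Qx; rewrite limn_einf_lim; apply: lime_ge; first exact: is_cvg_einfs.
    by apply: nearW => N; apply: le_ereal_inf_tmp => _ [l _ <-]; exact: f0.
  - have h := measurable_fun_limn_esup
      (fun l => measurableT_comp (@oppe_measurable R setT) (mfl l)).
    exact: (measurableT_comp (@oppe_measurable R setT) h).
  apply: filterS hk => x hx Qx; have {}hx := hx Qx.
  pose a G := vnorm (v x *m (G x - M) *m e).
  have ac : a (mxEN (k l) Q F) @[l --> \oo] --> a F.
    apply/cvgrPdist_le => t t0.
    (* 2 * opnorm (v x) * vnorm e is a Lipschitz constant of a with respect to
       entry_sum; adding 1 makes it positive *)
    pose c := 2 * (opnorm (v x) * vnorm e) + 1.
    have c0 : 0 < c by rewrite ltr_wpDl// !mulr_ge0 ?opnorm_ge0 ?vnorm_ge0.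
    move/cvgrPdist_le : hx => /(_ (t / c) (divr_gt0 t0 c0)).
    apply: filterS => l; rewrite sub0r normrN => h.
    set D := F x - mxEN (k l) Q F x in h.
    have hD : vnorm (v x *m D *m e) <= t.
      rewrite -mulmxA (le_trans (vnorm_mulmx _ _))//.
      rewrite (@le_trans _ _ (opnorm (v x) * (2 * entry_sum D * vnorm e)))//.
        rewrite ler_wpM2l ?opnorm_ge0// (le_trans (vnorm_mulmx _ _))//.
        by rewrite ler_wpM2r ?vnorm_ge0// opnorm_le_entries.
      rewrite (_ : _ * _ = 2 * (opnorm (v x) * vnorm e) * entry_sum D); last by ring.
      rewrite (@le_trans _ _ (c * (t / c)))//; last by rewrite mulrCA mulfV ?mulr1// gt_eqF.
      rewrite ler_pM//.
      - by rewrite !mulr_ge0 ?opnorm_ge0 ?vnorm_ge0.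
      - by apply: sumr_ge0 => j _; apply: sumr_ge0 => i _; rewrite addr_ge0.
      - by rewrite /c lerDl.
      - exact: le_trans (ler_norm _) h.
    have E1 : v x *m (F x - M) *m e = v x *m (mxEN (k l) Q F x - M) *m e + v x *m D *m e.
      rewrite -mulmxDl -mulmxDr; congr (_ *m _ *m _).
      by rewrite /D [RHS]addrC addrA subrK.
    rewrite /a ler_norml; apply/andP; split.
      rewrite lerBrDl -lerBrDr opprK.
      have -> : v x *m (mxEN (k l) Q F x - M) *m e = v x *m (F x - M) *m e - v x *m D *m e.
        by rewrite E1 addrK.
      by rewrite (le_trans (ler_vnormD _ _))// vnormN lerD2l.
    by rewrite lerBlDl E1 (le_trans (ler_vnormD _ _))// lerD2l.
  have fc : f (mxEN (k l) Q F) x @[l --> \oo] --> f F x.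
    apply: cvg_EFin; first exact: nearW.
    by apply: cvg_powR ac => // l; exact: vnorm_ge0.
  by have [-> _] := cvg_limn_einf_sup fc.
apply: (le_trans (fatou mu mQ mfl f0)).
rewrite limn_einf_lim; apply: lime_le; first exact: is_cvg_einfs.
apply: nearW => N; apply: le_trans (hX (k N)).
by apply: ereal_inf_lbound; exists N => //=.
Qed.

End fatou_average.

(** * Reducing matrices and the A_p condition on one cube *)

Section columns.
Context (R : realType) (d : nat).
Implicit Types (Q : cube R d).

Lemma powR_sum_le n (a : 'I_n -> R) (r : R) : (forall j, 0 <= a j) -> 0 < r ->
  (\sum_j a j) `^ r <= \sum_j (n%:R * a j) `^ r.
Proof.
move=> a0 r0; case: n a a0 => [|n] a a0.
  by rewrite !big_ord0 powR0// gt_eqF.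
have [j _ hj] := @arg_maxP _ _ _ (@ord0 n) xpredT a isT.
rewrite (@le_trans _ _ ((n.+1%:R * a j) `^ r))//; last first.
  rewrite [leRHS](bigD1 j)//= lerDl; apply: sumr_ge0 => i _; exact: powR_ge0.
rewrite ge0_ler_powR ?(ltW r0)// ?nnegrE ?sumr_ge0// ?mulr_ge0//.
rewrite (@le_trans _ _ (\sum_(i < n.+1) a j))//.
  by apply: ler_sum => i _; exact: hj.
by rewrite sumr_const card_ord [leRHS]mulr_natl.
Qed.

(** The operator norm is at most twice the sum of the norms of the n columns,
which costs a constant; matrix estimates thus follow from estimates for vectors. *)
Lemma avgLe_opnorm_cols Q m n (F : euclid R d -> 'M[R[i]]_(m, n)) (r X : R) :
  1 <= r -> 0 <= X -> mxmeas F ->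
  (forall j, avgLe Q r (fun x => vnorm (F x *m ecol R j)) X) ->
  avgLe Q r (fun x => opnorm (F x)) (2 * n%:R ^+ 2 * X).
Proof.
move=> r1 X0 mF h; have r0 : 0 < r by rewrite (lt_le_trans _ r1).
pose g j x := 2 * n%:R * vnorm (F x *m ecol R j).
have mv j : measurable_fun setT (fun x => vnorm (F x *m ecol R j)).
  by apply: measurable_vnorm; exact: (mxmeasM mF (mxmeas_cst _ _)).
have mg j : measurable_fun setT (g j).
  exact: (measurable_funM (measurable_cst _) (mv j)).
have g0 j x : 0 <= g j x by rewrite /g !mulr_ge0// vnorm_ge0.
apply: (@le_trans _ _ (avg Q (fun x => (\sum_j (g j x `^ r)%:E)%E))).
  apply: avg_le.
  - by apply: measurable_powR_EFin; exact: measurable_opnorm.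
  - by apply: emeasurable_sum => j; exact: measurable_powR_EFin.
  - exact: powR_EFin_ge0.
  - by move=> x; apply: sume_ge0 => j _; exact: powR_EFin_ge0.
  move=> x; rewrite sumEFin lee_fin.
  rewrite (@le_trans _ _ ((\sum_j 2 * vnorm (F x *m ecol R j)) `^ r))//.
    rewrite ge0_ler_powR ?nnegrE ?(ltW r0) ?opnorm_ge0//.
      by apply: sumr_ge0 => j _; rewrite mulr_ge0// vnorm_ge0.
    by rewrite -mulr_sumr opnorm_le_cols.
  rewrite (le_trans (powR_sum_le _ _))// => [j|]; first by rewrite mulr_ge0// vnorm_ge0.
  by apply: ler_sum => j _; rewrite /g mulrA (mulrC 2).
rewrite (avg_sum _ _ (fun j => measurable_powR_EFin r (mg j)) (fun j => powR_EFin_ge0 (g j) r)).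
apply: (@le_trans _ _ (\sum_(j < n) (((2 * n%:R * X) `^ r)%:E))%E).
  apply: lee_sum => j _.
  apply: (avgLeZ _ (mv j) _ X0 (h j)); first by rewrite mulr_ge0.
  by move=> x; rewrite vnorm_ge0.
rewrite sumEFin lee_fin sumr_const card_ord -[_ *+ n]mulr_natl.
have -> : 2 * n%:R ^+ 2 * X = n%:R * (2 * n%:R * X) by ring.
rewrite [leRHS]powRM ?mulr_ge0// ler_wpM2r ?powR_ge0//.
by case: n {F mF h g mv mg g0} => [|n]; rewrite ?powR_ge0// le1r_powR// ler1n.
Qed.

End columns.

Lemma conjugate_gt1 (R : realFieldType) (p q : R) : 1 < p -> p^-1 + q^-1 = 1 -> 1 < q.
Proof.
move=> p1 pq; have p0 : 0 < p by exact: lt_trans p1.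
have qV : q^-1 = (p - 1) / p.
  by rewrite mulrBl mulfV ?gt_eqF// mul1r -pq addrAC subrr add0r.
have : 0 < q^-1 by rewrite qV divr_gt0// subr_gt0.
rewrite invr_gt0 => q0; rewrite -invf_lt1// -pq ltrDr.
by rewrite invr_gt0.
Qed.

Section weight.
Context (R : realType) (d n : nat).
Local Notation mu := (leb R d).
Implicit Types (K : R) (Q : cube R d) (w : euclid R d -> 'M[R[i]]_n) (M : 'M[R[i]]_n).

(** The properties of the powers w = W^(1/p) and w' = W^(-1/p) of a weight that the
estimates use; they are symmetric in the two. *)
Record dual_pair (w w' : euclid R d -> 'M[R[i]]_n) : Prop := DualPair {
  dp_meas : mxmeas w;
  dp_meas' : mxmeas w';
  dp_adj : forall x, (w x) ^t* = w x;
  dp_adj' : forall x, (w' x) ^t* = w' x;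
  dp_inv : {ae mu, forall x, w x *m w' x = 1%:M} }.

Lemma dual_pairC w w' : dual_pair w w' -> dual_pair w' w.
Proof.
case=> h1 h2 h3 h4 h5; split => //.
by apply: filterS h5 => x /mulmx1C.
Qed.

(** The condition of `reducing` for one cube, with positivity of M replaced by the
two consequences that matter. *)
Definition reduces (c r : R) w Q M : Prop :=
  [/\ M ^t* = M, M \in unitmx & forall e : 'cV[R[i]]_n,
   (avg Q (fun x => (vnorm (w x *m e) `^ r)%:E) <= c%:E * (vnorm (M *m e) `^ r)%:E)%E
   /\ ((vnorm (M *m e) `^ r)%:E <= c%:E * avg Q (fun x => (vnorm (w x *m e) `^ r)%:E))%E].

Variables (c : R) (c0 : 0 < c).

Lemma reduces_avgLe r w Q M (e : 'cV[R[i]]_n) : 0 < r -> reduces c r w Q M ->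
  avgLe Q r (fun x => vnorm (w x *m e)) (c `^ r^-1 * vnorm (M *m e)).
Proof.
move=> r0 [_ _ /(_ e)[h _]]; apply: (le_trans h).
rewrite -EFinM lee_fin powRM ?powR_ge0 ?vnorm_ge0// -powRrM mulVf ?gt_eqF//.
by rewrite powRr1// ltW.
Qed.

Lemma avgLe_reduces r w Q M (e : 'cV[R[i]]_n) X : 0 < r -> 0 <= X ->
  reduces c r w Q M -> avgLe Q r (fun x => vnorm (w x *m e)) X ->
  vnorm (M *m e) <= c `^ r^-1 * X.
Proof.
move=> r0 X0 [_ _ /(_ e)[_ h]] hX.
have : (vnorm (M *m e) `^ r <= c * X `^ r)%R.
  by rewrite -lee_fin (le_trans h)// EFinM lee_wpmul2l// lee_fin ltW.
move=> {}h; have := ge0_ler_powR (r := r^-1); rewrite invr_ge0 (ltW r0) => /(_ isT).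
move=> /(_ _ _ _ _ h); rewrite !nnegrE powR_ge0 mulr_ge0 ?powR_ge0 ?(ltW c0)// => /(_ isT isT).
rewrite powRM ?powR_ge0 ?(ltW c0)// -!powRrM mulfV ?gt_eqF//.
by rewrite !powRr1// vnorm_ge0.
Qed.

Definition Kred (r : R) : R := 2 * n%:R ^+ 2 * c `^ r^-1.

Lemma Kred_ge0 r : 0 <= Kred r.
Proof. by rewrite /Kred !mulr_ge0// ?exprn_ge0// powR_ge0. Qed.

(** The column j of w M^-1 is w e with e = M^-1 e_j, whose mean norm is comparable to
|M e| = 1. *)
Lemma avg_reduced r w Q M : 1 <= r -> mxmeas w -> reduces c r w Q M ->
  avgLe Q r (fun x => opnorm (w x *m invmx M)) (Kred r).
Proof.
move=> r1 mw hM; have [_ uM _] := hM.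
apply: (avgLe_opnorm_cols r1 (powR_ge0 _ _) (mxmeasM mw (mxmeas_cst _ _))).
move=> j; have := reduces_avgLe (invmx M *m ecol R j) (lt_le_trans ltr01 r1) hM.
rewrite mulmxA mulmxV// mul1mx vnorm_ecol mulr1.
by under eq_fun do rewrite mulmxA.
Qed.

Section Ap.
Variables (p q : R) (w w' : euclid R d -> 'M[R[i]]_n).
Hypotheses (p1 : 1 < p) (pq : p^-1 + q^-1 = 1) (ww' : dual_pair w w').

Let p0 : 0 < p. Proof. exact: lt_trans p1. Qed.

Let q1 : 1 < q. Proof. exact: conjugate_gt1 p1 pq. Qed.

Let q0 : 0 < q. Proof. exact: lt_trans q1. Qed.

Let qV : q^-1 = (p - 1) / p.
Proof. by move: pq => /(congr1 (fun t => t - p^-1)); rewrite addrAC subrr add0r => ->;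
  field; rewrite gt_eqF. Qed.

Let qE : q = p / (p - 1).
Proof. by rewrite -[q]invrK qV invf_div. Qed.

Definition ApLe Q (K : R) : Prop :=
  (avg Q (fun x => (avg Q (fun y => (opnorm (w x *m w' y) `^ q)%:E)) `^ (p / q)) <= K%:E)%E.

Lemma measurable_mixed r :
  measurable_fun setT (fun z : euclid R d * euclid R d =>
    (opnorm (w z.1 *m w' z.2) `^ r)%:E).
Proof.
apply/measurable_EFinP; apply: (measurableT_comp (measurable_powR r)).
apply: measurable_opnorm; apply: mxmeasM.
  exact: (mxmeas_comp measurable_fst (dp_meas ww')).
exact: (mxmeas_comp measurable_snd (dp_meas' ww')).
Qed.

Lemma measurable_inner Q : measurable_fun setT (fun x =>
  avg Q (fun y => (opnorm (w x *m w' y) `^ q)%:E)).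
Proof.
by apply: (measurable_avg2 _ (measurable_mixed q)) => z; rewrite lee_fin powR_ge0.
Qed.

Lemma measurable_innerX Q : measurable_fun setT (fun x =>
  (avg Q (fun y => (opnorm (w x *m w' y) `^ q)%:E)) `^ (p / q))%E.
Proof. exact: (measurableT_comp (measurable_poweR _) (measurable_inner Q)). Qed.

Lemma inner_ge0 Q x : (0 <= avg Q (fun y => (opnorm (w x *m w' y) `^ q)%:E))%E.
Proof. by apply: avg_ge0 => y; rewrite lee_fin powR_ge0. Qed.

(** The A_p integral is finite, so the inner mean is finite at some x where w x
is invertible; there |w' y| is at most |w' x| |w x w' y|. *)
Lemma Ap_dual_finite Q K : ApLe Q K ->
  (avg Q (fun y => (opnorm (w' y) `^ q)%:E) < +oo)%E.
Proof.
move=> hK; rewrite ltey; apply/eqP => Soo.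
have mop : measurable_fun setT (fun y => opnorm (w' y)).
  exact: measurable_opnorm (dp_meas' ww').
suff h : {ae mu, forall x, (+oo <=
    (avg Q (fun y => (opnorm (w x *m w' y) `^ q)%:E)) `^ (p / q))%E}.
  have := le_trans (avg_le_ae (f := cst +oo%E) Q (measurable_cst _) (measurable_innerX Q) _ _ h) hK.
  by rewrite avg_cst => /(_ (fun=> leey _) (fun=> poweR_ge0 _ _)).
apply: filterS (dp_inv ww') => x /mulmx1C wi.
rewrite leye_eq; apply/eqP; apply: eqy_poweR; first by rewrite divr_gt0.
have key (N : \bar R) (k : R) : (0 <= N -> +oo <= k%:E * N -> N = +oo)%E.
  by case: N.
apply: (key _ (opnorm (w' x) `^ q) (inner_ge0 Q x)); rewrite -{1}Soo.
have : (avg Q (fun y => (opnorm (w' y) `^ q)%:E) <=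
  (opnorm (w' x) `^ q)%:E * avg Q (fun y => (opnorm (w x *m w' y) `^ q)%:E))%E.
  have mi : measurable_fun setT (fun y => opnorm (w x *m w' y)).
    by apply: measurable_opnorm; exact: (mxmeasM (mxmeas_cst _ (w x)) (dp_meas' ww')).
  rewrite -(avgZ _ (measurable_powR_EFin q mi) (powR_EFin_ge0 _ _)) ?lee_fin ?powR_ge0//.
  apply: (avg_le _ (measurable_powR_EFin q mop) _ (powR_EFin_ge0 _ _)).
  - apply: measurable_funeM; exact: measurable_powR_EFin.
  - by move=> y; rewrite -EFinM lee_fin mulr_ge0 ?powR_ge0.
  move=> y; rewrite -EFinM lee_fin -powRM ?opnorm_ge0//.
  rewrite ge0_ler_powR ?nnegrE ?mulr_ge0 ?opnorm_ge0 ?(ltW q0)//.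
  have := opnormM (w' x) (w x *m w' y).
  by rewrite mulmxA wi mul1mx.
exact.
Qed.

(** Duality.  With f = M e, let S be the mean of |w' f|^q and let g be the mean
of G = |w' f|^(q-2) w' w' f.  The pairing <f, G> is |w' f|^q, so that
S = <e, M g> is at most |M g|.  By the reducing property |M g|^p is at most c times
the mean of |w g|^p, and by Hoelder's inequality |w(x) g|^p is at most
S times the p/q-th power of the mean over y of |w(x) w'(y)|^q.  The A_p condition
gives S^p <= c K S, and finiteness of S allows dividing. *)
Lemma Ap_dual_vec Q K M (e : 'cV[R[i]]_n) : 0 <= K -> ApLe Q K -> reduces c p w Q M ->
  vnorm e <= 1 -> avgLe Q q (fun y => vnorm (w' y *m (M *m e))) ((c * K) `^ p^-1).
Proof.
move=> K0 hK [Mh uM hM] e1; set f := M *m e.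
have cK0 : 0 <= c * K by rewrite mulr_ge0// ltW.
pose S := avg Q (fun y => (vnorm (w' y *m f) `^ q)%:E).
have mop : measurable_fun setT (fun y => opnorm (w' y)).
  exact: measurable_opnorm (dp_meas' ww').
have mwf : mxmeas (fun y => w' y *m f) := mxmeasM (dp_meas' ww') (mxmeas_cst _ f).
have mvn : measurable_fun setT (fun y => vnorm (w' y *m f)) := measurable_vnorm mwf.
have S0 : (0 <= S)%E by apply: avg_ge0 => y; rewrite lee_fin powR_ge0.
have Sfin : (S < +oo)%E.
  have h := Ap_dual_finite hK.
  apply: (@le_lt_trans _ _ ((vnorm f `^ q)%:E * avg Q (fun y => (opnorm (w' y) `^ q)%:E))%E).
    rewrite -(avgZ _ (measurable_powR_EFin q mop) (powR_EFin_ge0 _ _)) ?lee_fin ?powR_ge0//.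
    apply: (avg_le _ (measurable_powR_EFin q mvn) _ (powR_EFin_ge0 _ _)).
    - apply: measurable_funeM; exact: measurable_powR_EFin.
    - by move=> y; rewrite -EFinM lee_fin mulr_ge0 ?powR_ge0.
    move=> y; rewrite -EFinM lee_fin -powRM ?opnorm_ge0 ?vnorm_ge0//.
    rewrite ge0_ler_powR ?nnegrE ?mulr_ge0 ?opnorm_ge0 ?vnorm_ge0 ?(ltW q0)//.
    by rewrite mulrC vnorm_mulmx.
  by rewrite lte_mul_pinfty// lee_fin powR_ge0.
rewrite /avgLe -/S.
case SE : S S0 Sfin => [s| |]//; rewrite !lee_fin le_eqVlt => /orP[/eqP <- _|s0 _].
  exact: powR_ge0.
(* the pairing of f with G attains the mean of |w' f|^q *)
pose G y := ((vnorm (w' y *m f) `^ (q - 2))%:C *: (w' y *m (w' y *m f))).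
have vG y : vnorm (w' y *m f) `^ (q - 2) * vnorm (w' y *m f) = vnorm (w' y *m f) `^ (q - 1).
  have [->|v0] := eqVneq (vnorm (w' y *m f)) 0.
    by rewrite mulr0 powR0// subr_eq0 gt_eqF.
  rewrite -[X in _ * X]powRr1 ?vnorm_ge0// -powRD; last by rewrite v0 implybT.
  by congr (_ `^ _); ring.
have vG2 y : vnorm (w' y *m f) `^ (q - 1) * vnorm (w' y *m f) = vnorm (w' y *m f) `^ q.
  by rewrite mulrC mulr_powRB1// vnorm_ge0.
have mG : mxmeas G.
  apply: mxmeasZ; last exact: (mxmeasM (dp_meas' ww') mwf).
  by apply: cmeas_real; exact: (measurableT_comp (measurable_powR _) mvn).
have fG y : rdot f (G y) = vnorm (w' y *m f) `^ q.
  have -> : rdot f (G y) = vnorm (w' y *m f) `^ (q - 2) * rdot (w' y *m f) (w' y *m f).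
    by rewrite [in RHS]rdot_adj (dp_adj' ww' y) /G rdotZr.
  rewrite -sqr_vnorm expr2 mulrA.
  by rewrite vG vG2.
have nG y : vnorm (G y) <= opnorm (w' y) `^ q * vnorm f `^ (q - 1).
  rewrite /G vnormZ ger0_norm ?powR_ge0//.
  apply: (@le_trans _ _ (opnorm (w' y) * vnorm (w' y *m f) `^ (q - 1))).
    rewrite -vG mulrCA ler_wpM2l ?powR_ge0//; exact: vnorm_mulmx.
  rewrite -(mulr_powRB1 (opnorm_ge0 _) q0) -mulrA ler_wpM2l ?opnorm_ge0//.
  rewrite -powRM ?opnorm_ge0 ?vnorm_ge0// ge0_ler_powR ?nnegrE ?mulr_ge0 ?opnorm_ge0 ?vnorm_ge0//.
    by rewrite subr_ge0 ltW.
  exact: vnorm_mulmx.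
have iG : mxinteg Q G.
  have ig : integ Q (fun y => opnorm (w' y) `^ q * vnorm f `^ (q - 1)).
    under eq_fun do rewrite mulrC; apply: integZ; split.
      exact: (measurableT_comp (measurable_powR q) mop).
    by under eq_fun do rewrite ger0_norm ?powR_ge0//; exact: Ap_dual_finite hK.
  move=> i j; have [m1 m2] := mG i j; rewrite (ord1 j) in m1 m2 *.
  have g0 y : 0 <= opnorm (w' y) `^ q * vnorm f `^ (q - 1).
    by rewrite mulr_ge0 ?powR_ge0.
  split; [apply: (integ_le m1 _ ig)|apply: (integ_le m2 _ ig)] => y;
    rewrite (ger0_norm (g0 y)) (le_trans _ (nG y))//;
    by have [h1 h2] := coord_le_vnorm (G y) i.
pose g := gavg Q G.
have sE : s = rdot e (M *m g).
  have -> : s = ravg Q (fun y => rdot f (G y)).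
    by rewrite /ravg; under eq_fun do rewrite fG; rewrite -/S SE.
  have -> : (fun y => rdot f (G y)) = (fun y => rdot ((f ^t*) ^t*) (G y *m 1%:M)).
    by apply/funext => y; rewrite mulmx1 trmxCK.
  rewrite (ravg_rdot _ _ iG) mulmx1 trmxCK /f rdot_adj Mh. by [].
have sle : s <= vnorm (M *m g).
  rewrite sE (le_trans (rdot_le _ _))// ler_piMl ?vnorm_ge0//.
(* Hoelder's inequality in y at fixed x; an infinite inner mean makes the bound trivial,
   as s > 0 *)
have wg x : ((vnorm (w x *m g) `^ p)%:E <=
    s%:E * (avg Q (fun y => (opnorm (w x *m w' y) `^ q)%:E)) `^ (p / q))%E.
  case E : (avg Q (fun y => (opnorm (w x *m w' y) `^ q)%:E)) (inner_ge0 Q x) => [t| |]// => [|_].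
    rewrite lee_fin => t0.
    have mi : measurable_fun setT (fun y => opnorm (w x *m w' y)).
      by apply: measurable_opnorm; exact: (mxmeasM (mxmeas_cst _ (w x)) (dp_meas' ww')).
    have mv1 : measurable_fun setT (fun y => vnorm (w' y *m f) `^ (q - 1)).
      exact: (measurableT_comp (measurable_powR _) mvn).
    have h1 : avgLe Q p (fun y => vnorm (w' y *m f) `^ (q - 1)) (s `^ p^-1).
      rewrite /avgLe -powRrM mulVf ?gt_eqF// powRr1 ?(ltW s0)//.
      have -> : (fun x0 => ((vnorm (w' x0 *m f) `^ (q - 1)) `^ p)%:E) =
                (fun y => (vnorm (w' y *m f) `^ q)%:E).
        apply/funext => y; rewrite -powRrM; congr (_ `^ _)%:E.
        by rewrite qE; field; rewrite subr_eq0 gt_eqF.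
      by rewrite -/S SE.
    have h2 : avgLe Q q (fun y => opnorm (w x *m w' y)) (t `^ q^-1).
      by rewrite /avgLe -powRrM mulVf ?gt_eqF// powRr1// E.
    have := avg_hoelder p0 q0 pq mv1 mi (fun y => powR_ge0 _ _) (fun y => opnorm_ge0 _)
      (powR_ge0 _ _) (powR_ge0 _ _) h1 h2.
    move=> h3; have h4 : vnorm (w x *m g) <= s `^ p^-1 * t `^ q^-1.
      rewrite -lee_fin; apply: (le_trans _ h3); apply: (le_trans (vnorm_gavg (w x) iG)).
      apply: avg_le.
      - apply/measurable_EFinP; apply: measurable_vnorm; exact: (mxmeasM (mxmeas_cst _ (w x)) mG).
      - by apply/measurable_EFinP; exact: (measurable_funM mv1 mi).
      - by move=> y; rewrite lee_fin vnorm_ge0.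
      - by move=> y; rewrite lee_fin mulr_ge0 ?powR_ge0 ?opnorm_ge0.
      move=> y; rewrite lee_fin /G -scalemxAr vnormZ ger0_norm ?powR_ge0// -vG.
      rewrite -mulrA ler_wpM2l ?powR_ge0//.
      by have := vnorm_mulmx (w x *m w' y) (w' y *m f); rewrite -mulmxA mulrC.
    rewrite poweR_EFin -EFinM lee_fin.
    have -> : s * t `^ (p / q) = (s `^ p^-1 * t `^ q^-1) `^ p.
      rewrite powRM ?powR_ge0// -!powRrM mulVf ?gt_eqF// powRr1 ?(ltW s0)//.
      by rewrite (mulrC q^-1).
    by rewrite ge0_ler_powR ?nnegrE ?mulr_ge0 ?powR_ge0 ?vnorm_ge0 ?(ltW p0).
  rewrite poweRyr; last by rewrite gt_eqF// divr_gt0.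
  by rewrite gt0_muley ?leey// lte_fin.
have mwg : measurable_fun setT (fun x => vnorm (w x *m g)).
  by apply: measurable_vnorm; exact: (mxmeasM (dp_meas ww') (mxmeas_cst _ g)).
have hs : s `^ p <= c * (s * K).
  rewrite (@le_trans _ _ (vnorm (M *m g) `^ p))//.
    by rewrite ge0_ler_powR ?nnegrE ?vnorm_ge0 ?(ltW p0) ?(ltW s0).
  have [_ h] := hM g; rewrite -lee_fin; apply: (le_trans h).
  rewrite EFinM lee_wpmul2l ?lee_fin ?(ltW c0)//.
  apply: (@le_trans _ _ (s%:E * avg Q (fun x =>
    (avg Q (fun y => (opnorm (w x *m w' y) `^ q)%:E)) `^ (p / q)))%E); last first.
    by rewrite EFinM lee_wpmul2l// lee_fin ltW.
  rewrite -(avgZ _ (measurable_innerX Q) (fun x => poweR_ge0 _ _)) ?lee_fin ?(ltW s0)//.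
  apply: (avg_le _ (measurable_powR_EFin p mwg) _ (powR_EFin_ge0 _ _) _ wg).
  - by apply: measurable_funeM; exact: measurable_innerX.
  - by move=> x; rewrite mule_ge0 ?poweR_ge0// lee_fin ltW.
have {}hs : s `^ (p - 1) <= c * K.
  rewrite -(ler_pM2l s0) (mulr_powRB1 (ltW s0) p0) (le_trans hs)//.
  by rewrite mulrCA.
(* the exponents satisfy (p - 1) (q / p) = 1 *)
have -> : s = (s `^ (p - 1)) `^ (q / p).
  rewrite -powRrM qE mulrA.
  have -> : (p - 1) * (p / (p - 1)) / p = 1.
    by field; rewrite subr_eq0 !gt_eqF.
  by rewrite powRr1// ltW.
have -> : ((c * K) `^ p^-1) `^ q = (c * K) `^ (q / p) by rewrite -powRrM (mulrC q).
rewrite ge0_ler_powR ?nnegrE ?powR_ge0//.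
by rewrite divr_ge0// ltW.
Qed.

Definition KAp (K : R) : R := 2 * n%:R ^+ 2 * (c * K) `^ p^-1.

Lemma KAp_ge0 K : 0 <= KAp K.
Proof. by rewrite /KAp !mulr_ge0// ?exprn_ge0// powR_ge0. Qed.

(** Apply the bound for vectors to the columns of M. *)
Lemma Ap_dual Q K M : 0 <= K -> ApLe Q K -> reduces c p w Q M ->
  avgLe Q q (fun y => opnorm (w' y *m M)) (KAp K).
Proof.
move=> K0 hK hM.
apply: (avgLe_opnorm_cols (ltW q1) (powR_ge0 _ _) (mxmeasM (dp_meas' ww') (mxmeas_cst _ M))).
move=> j; have := Ap_dual_vec (e := ecol R j) K0 hK hM.
rewrite vnorm_ecol => /(_ (lexx _)).
by under eq_fun do rewrite mulmxA.
Qed.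

Lemma opnorm_swap (A B : 'M[R[i]]_n) : A ^t* = A -> B ^t* = B ->
  opnorm (A *m B) = opnorm (B *m A).
Proof. by move=> hA hB; rewrite -opnorm_adj adjM hA hB. Qed.

Lemma inv_adj (A : 'M[R[i]]_n) : A \in unitmx -> A ^t* = A -> (invmx A) ^t* = invmx A.
Proof.
move=> uA hA.
have h : A *m (invmx A) ^t* = 1%:M.
  by rewrite -{1}hA -adjM mulVmx// trmx1 map_mx1.
by rewrite -[LHS]mul1mx -(mulVmx uA) -mulmxA h mulmx1.
Qed.

Definition Kprod (K : R) : R := 2 * \sum_(j < n) c `^ q^-1 * (c * K) `^ p^-1.

Lemma Kprod_ge0 K : 0 <= Kprod K.
Proof. by rewrite mulr_ge0// sumr_ge0// => j _; rewrite mulr_ge0 ?powR_ge0. Qed.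

(** M' is a reducing matrix for w', so |M' M e_j| is comparable to the mean
of |w' M e_j|, which the A_p condition bounds. *)
Lemma reduced_prod_le Q K M M' : 0 <= K -> ApLe Q K ->
  reduces c p w Q M -> reduces c q w' Q M' -> opnorm (M' *m M) <= Kprod K.
Proof.
move=> K0 hK hM hM'; rewrite (le_trans (opnorm_le_cols _))// ler_wpM2l//.
apply: ler_sum => j _.
have := Ap_dual_vec (e := ecol R j) K0 hK hM; rewrite vnorm_ecol => /(_ (lexx _)) h.
rewrite -mulmxA; exact: (avgLe_reduces q0 (powR_ge0 _ _) hM' h).
Qed.

(** Write w M' as (w M^-1)(M M') and use the bound on the product of the reducing
matrices. *)
Lemma avg_reduced_dual Q K M M' : 0 <= K -> ApLe Q K ->
  reduces c p w Q M -> reduces c q w' Q M' ->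
  avgLe Q p (fun x => opnorm (w x *m M')) (Kprod K * Kred p).
Proof.
move=> K0 hK hM hM'; have [Mh uM _] := hM; have [Mh' _ _] := hM'.
have mo (N : 'M[R[i]]_n) : measurable_fun setT (fun x => opnorm (w x *m N)).
  by apply: measurable_opnorm; exact: (mxmeasM (dp_meas ww') (mxmeas_cst _ N)).
have h := avgLeZ (Kprod_ge0 K) (mo (invmx M)) (fun x => opnorm_ge0 _) (Kred_ge0 p)
  (avg_reduced (ltW p1) (dp_meas ww') hM).
apply: (avgLe_le p0 (mo M') _ (fun x => opnorm_ge0 _) _ _ h).
- exact: (measurable_funM (measurable_cst _) (mo _)).
- by move=> x; rewrite mulr_ge0 ?Kprod_ge0 ?opnorm_ge0.
move=> x; have -> : w x *m M' = (w x *m invmx M) *m (M *m M').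
  by rewrite mulmxA mulmxKV.
apply: (le_trans (opnormM _ _)); rewrite [leRHS]mulrC.
apply: ler_wpM2l; first exact: opnorm_ge0.
by rewrite (opnorm_swap Mh Mh') (reduced_prod_le K0 hK hM hM').
Qed.

(** Insert w' w = 1: the pairing <a, M'^-1 M^-1 b> equals
<w' M'^-1 a, w M^-1 b> at almost every point, and Hoelder's inequality applies to
its mean. *)
Lemma reduced_inv_prod_le Q M M' :
  reduces c p w Q M -> reduces c q w' Q M' ->
  opnorm (invmx M' *m invmx M) <= Kred q * Kred p.
Proof.
move=> hM hM'; have [Mh uM _] := hM; have [Mh' uM' _] := hM'.
apply: opnorm_leP => [|a b a1 b1]; first by rewrite mulr_ge0 ?Kred_ge0.
have m1 : measurable_fun setT (fun x => opnorm (w' x *m invmx M')).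
  by apply: measurable_opnorm; exact: (mxmeasM (dp_meas' ww') (mxmeas_cst _ _)).
have m2 : measurable_fun setT (fun x => opnorm (w x *m invmx M)).
  by apply: measurable_opnorm; exact: (mxmeasM (dp_meas ww') (mxmeas_cst _ _)).
have qp : q^-1 + p^-1 = 1 by rewrite addrC.
have h := avg_hoelder q0 p0 qp m1 m2 (fun x => opnorm_ge0 _) (fun x => opnorm_ge0 _)
  (Kred_ge0 q) (Kred_ge0 p) (avg_reduced (ltW q1) (dp_meas' ww') hM')
  (avg_reduced (ltW p1) (dp_meas ww') hM).
set t := rdot _ _; have [t0|t0] := ltP t 0.
  by rewrite (le_trans (ltW t0))// mulr_ge0 ?Kred_ge0.
rewrite -lee_fin; apply: le_trans h; rewrite -(avg_cst Q t%:E).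
apply: avg_le_ae.
- exact: measurable_cst.
- by apply/measurable_EFinP; exact: (measurable_funM m1 m2).
- by move=> x; rewrite lee_fin.
- by move=> x; rewrite lee_fin mulr_ge0 ?opnorm_ge0.
apply: filterS (dp_inv ww') => x /mulmx1C wi; rewrite lee_fin /t.
have -> : rdot a (invmx M' *m invmx M *m b) =
    rdot (w' x *m invmx M' *m a) (w x *m invmx M *m b).
  rewrite -!mulmxA rdot_adj (dp_adj' ww') (mulmxA (w' x) (w x)) wi mul1mx.
  by rewrite rdot_adj inv_adj.
rewrite (le_trans (rdot_le _ _))// ler_pM ?vnorm_ge0//.
  by rewrite (le_trans (vnorm_mulmx _ _))// ler_piMr// opnorm_ge0.
by rewrite (le_trans (vnorm_mulmx _ _))// ler_piMr// opnorm_ge0.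
Qed.

End Ap.

End weight.

(** * The weighted John-Nirenberg inequality *)

Section stopping.
Context (R : realType) (d : nat).
Local Notation mu := (leb R d).
Implicit Types (Q S : cube R d) (x : euclid R d) (M : nat).
Variables (f : euclid R d -> R) (t : R).
Hypotheses (mf : measurable_fun setT f) (f0 : forall x, 0 <= f x).

Definition large Q : bool := `[< (t%:E * (vol Q)%:E < \int[mu]_(x in Q) (f x)%:E)%E >].

(** The indicator function of the union of the maximal large dyadic subcubes of Q of depth at
most M. *)
Fixpoint stopf M Q x : R :=
  if large Q then 1
  else if M is M'.+1 then stopf M' (child Q (dindex Q x)) x else 0.

Lemma stopf_ge0 M Q x : 0 <= stopf M Q x.
Proof. by elim: M Q => [|M IH] Q /=; case: ifP. Qed.

Lemma stopf_01 M Q x : stopf M Q x = 0 \/ stopf M Q x = 1.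
Proof. by elim: M Q => [|M IH] Q /=; case: ifP => _; auto. Qed.

Lemma measurable_stopf M Q : measurable_fun setT (stopf M Q).
Proof.
elim: M Q => [|M IH] Q.
  have -> : stopf 0 Q = cst (if large Q then 1 else 0) by [].
  exact: measurable_cst.
have [lQ|lQ] := boolP (large Q).
  rewrite (_ : stopf _ _ = cst 1); first exact: measurable_cst.
  by apply/funext => x /=; rewrite lQ.
rewrite (_ : stopf _ _ = fun x => stopf M (child Q (dindex Q x)) x); last first.
  by apply/funext => x /=; rewrite (negbTE lQ).
exact: (measurable_glue (F := fun b => stopf M (child Q b)) _ (fun b => IH _)).
Qed.

Lemma stopf_child M Q b x : ~~ large Q -> cube_set (child Q b) x ->
  stopf M.+1 Q x = stopf M (child Q b) x.
Proof. by move=> /= /negbTE -> /child_dindex ->. Qed.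

(** The weak type inequality: on each of the disjoint stopped cubes the
integral of f exceeds t times the volume. *)
Lemma integral_stopf_le M Q :
  (t%:E * \int[mu]_(x in Q) (stopf M Q x)%:E <= \int[mu]_(x in Q) (f x)%:E)%E.
Proof.
have fE0 x : (0 <= (f x)%:E)%E by rewrite lee_fin.
have mfE : measurable_fun setT (fun x => (f x)%:E) by apply/measurable_EFinP.
have i0 S : (0 <= \int[mu]_(x in S) (f x)%:E)%E by apply: integral_ge0.
have stopped N S : large S ->
    (t%:E * \int[mu]_(x in S) (stopf N S x)%:E <= \int[mu]_(x in S) (f x)%:E)%E.
  move=> lQ; have -> : (\int[mu]_(x in S) (stopf N S x)%:E = \int[mu]_(x in S) cst 1 x)%E.
    by apply: eq_integral => x _; case: N => [|N] /=; rewrite lQ.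
  by rewrite integral_cst// mul1e leb_vol; apply: ltW; move/asboolP : lQ.
elim: M Q => [|M IH] Q; have [lQ|lQ] := boolP (large Q); try exact: stopped.
  have -> : (\int[mu]_(x in Q) (stopf 0 Q x)%:E = 0)%E.
    by apply: integral0_eq => x _ /=; rewrite (negbTE lQ).
  by rewrite mule0.
have ms : measurable_fun setT (fun x => (stopf M.+1 Q x)%:E).
  by apply/measurable_EFinP; exact: measurable_stopf.
rewrite (integral_children Q mfE fE0) (integral_children Q ms) => [|x]; last first.
  by rewrite lee_fin stopf_ge0.
rewrite ge0_sume_distrr => [|b _]; last first.
  by apply: integral_ge0 => x _; rewrite lee_fin stopf_ge0.
apply: lee_sum => b _; apply: le_trans (IH _).
rewrite le_eqVlt; apply/orP; left; apply/eqP; congr (_ * _)%E.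
by apply: eq_integral => x; rewrite inE => Qx; rewrite (stopf_child _ lQ Qx).
Qed.

End stopping.

Section John_Nirenberg.
Context (R : realType) (d n : nat).
Local Notation mu := (leb R d).
Implicit Types (Q S : cube R d) (x : euclid R d) (M N : nat) (X : R).
Variables (p q : R) (v u u' : euclid R d -> 'M[R[i]]_n) (VQ UQ : cube R d -> 'M[R[i]]_n).
Variables (c C1 C2 : R).
Hypotheses (p1 : 1 < p) (q0 : 0 < q) (pq : p^-1 + q^-1 = 1).
Hypotheses (mv : mxmeas v) (mu_ : mxmeas u) (mu' : mxmeas u').
Hypothesis uu' : {ae mu, forall x, u' x *m u x = 1%:M}.
Hypotheses (unitV : forall Q, VQ Q \in unitmx) (unitU : forall Q, UQ Q \in unitmx).
Hypotheses (c0 : 0 < c) (C10 : 0 <= C1) (C20 : 0 <= C2).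
Hypothesis HV : forall Q, avgLe Q p (fun x => opnorm (v x *m invmx (VQ Q))) C1.
Hypothesis HU' : forall Q, avgLe Q q (fun x => opnorm (UQ Q *m u' x)) C2.
Hypothesis HU : forall Q (e : 'cV[R[i]]_n),
  (avg Q (fun x => (vnorm (u x *m e) `^ p)%:E) <= c%:E * (vnorm (UQ Q *m e) `^ p)%:E)%E.

Let p0 : 0 < p. Proof. exact: lt_trans p1. Qed.

Section fixed_vector.
Variable e : 'cV[R[i]]_n.

Definition wt x : R := vnorm (u x *m e) `^ p.

Lemma wt_ge0 x : 0 <= wt x. Proof. exact: powR_ge0. Qed.

Lemma measurable_ue : measurable_fun setT (fun x => vnorm (u x *m e)).
Proof. by apply: measurable_vnorm; exact: (mxmeasM mu_ (mxmeas_cst _ e)). Qed.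

Lemma measurable_wt : measurable_fun setT wt.
Proof. exact: (measurableT_comp (measurable_powR p) measurable_ue). Qed.

(** Insert u' u = 1 and apply Hoelder's inequality to
|UQ e| g <= |UQ u'| (g |u e|). *)
Lemma reduced_le_portion Q (g : euclid R d -> R) : measurable_fun setT g ->
  (forall x, g x = 0 \/ g x = 1) ->
  ((vnorm (UQ Q *m e))%:E * avg Q (fun x => (g x)%:E) <=
   (C2 * fine (avg Q (fun x => (g x * wt x)%:E)) `^ p^-1)%:E)%E.
Proof.
move=> mg g01; set a := avg Q (fun x => (g x * wt x)%:E).
have g0 x : 0 <= g x by case: (g01 x) => ->.
have gp x : (g x * vnorm (u x *m e)) `^ p = g x * wt x.
  by rewrite /wt; case: (g01 x) => ->; rewrite ?mul0r ?mul1r// powR0// gt_eqF.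
have mgw : measurable_fun setT (fun x => (g x * wt x)%:E).
  by apply/measurable_EFinP; exact: (measurable_funM mg measurable_wt).
have mgv : measurable_fun setT (fun x => g x * vnorm (u x *m e)).
  exact: (measurable_funM mg measurable_ue).
have mop : measurable_fun setT (fun x => opnorm (UQ Q *m u' x)).
  by apply: measurable_opnorm; exact: (mxmeasM (mxmeas_cst _ (UQ Q)) mu').
have a0 : (0 <= a)%E by apply: avg_ge0 => x; rewrite lee_fin mulr_ge0 ?wt_ge0.
have afin : (a \is a fin_num)%E.
  rewrite ge0_fin_numE//; apply: (@le_lt_trans _ _ (avg Q (fun x => (wt x)%:E))).
    apply: (avg_le _ mgw); first by apply/measurable_EFinP; exact: measurable_wt.
    - by move=> x; rewrite lee_fin mulr_ge0 ?wt_ge0.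
    - by move=> x; rewrite lee_fin wt_ge0.
    - by move=> x; rewrite lee_fin; case: (g01 x) => ->; rewrite ?mul0r ?mul1r ?wt_ge0.
  by apply: le_lt_trans (HU Q e) _; rewrite -EFinM ltry.
have h1 : avgLe Q p (fun x => g x * vnorm (u x *m e)) (fine a `^ p^-1).
  rewrite /avgLe; under eq_fun do rewrite gp.
  by rewrite -/a -powRrM mulVf ?gt_eqF// powRr1 ?fine_ge0// fineK.
have qp : q^-1 + p^-1 = 1 by rewrite addrC.
have := avg_hoelder q0 p0 qp mop mgv (fun x => opnorm_ge0 _) _ C20 (powR_ge0 _ _) (HU' Q) h1.
move=> h; have {}h := h (fun x => mulr_ge0 (g0 x) (vnorm_ge0 _)).
have mgE : measurable_fun setT (fun x => (g x)%:E) by apply/measurable_EFinP.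
have gE0 x : (0 <= (g x)%:E)%E by rewrite lee_fin.
rewrite -(avgZ _ mgE gE0) ?lee_fin ?vnorm_ge0//.
apply: le_trans h; apply: avg_le_ae.
- exact: measurable_funeM.
- by apply/measurable_EFinP; exact: (measurable_funM mop mgv).
- by move=> x; rewrite -EFinM lee_fin mulr_ge0 ?vnorm_ge0.
- by move=> x; rewrite lee_fin !mulr_ge0 ?opnorm_ge0 ?vnorm_ge0.
apply: filterS uu' => x ux; rewrite -EFinM lee_fin.
have := vnorm_mulmx (UQ Q *m u' x) (u x *m e).
rewrite -(mulmxA (UQ Q)) (mulmxA (u' x)) ux mul1mx => h.
by rewrite mulrCA (mulrC (vnorm _)) ler_wpM2l.
Qed.

Lemma reduced_le_wt Q : vnorm (UQ Q *m e) `^ p * vol Q <=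
  C2 `^ p * fine (\int[mu]_(x in Q) (wt x)%:E)%E.
Proof.
have := @reduced_le_portion Q (cst 1) (measurable_cst _) (fun=> or_intror erefl).
rewrite (avg_cst Q 1%E) mule1 lee_fin; under eq_fun do rewrite /= mul1r.
set a := avg Q _ => h.
have a0 : 0 <= fine a by rewrite fine_ge0// avg_ge0// => x; rewrite lee_fin wt_ge0.
have afin : (a \is a fin_num)%E.
  rewrite ge0_fin_numE ?avg_ge0//; last by move=> x; rewrite lee_fin wt_ge0.
  by apply: le_lt_trans (HU Q e) _; rewrite -EFinM ltry.
rewrite integral_avg -/a fineM// mulrCA [leRHS]mulrC; apply: ler_wpM2r.
  by rewrite ltW// vol_gt0.
rewrite (@le_trans _ _ ((C2 * fine a `^ p^-1) `^ p))//.
  by rewrite ge0_ler_powR ?nnegrE ?vnorm_ge0 ?mulr_ge0 ?powR_ge0 ?(ltW p0).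
by rewrite powRM ?powR_ge0// -powRrM mulVf ?gt_eqF// powRr1.
Qed.

(** If a set occupies at least half of Q, the weight of Q is at most this multiple
of the weight of the set. *)
Definition total_ratio : R := 1 + c * (2 * C2) `^ p.
(** A bound for the proportion of the weight of Q that a set of at most half the
volume carries. *)
Definition rho : R := total_ratio / (1 + total_ratio).

Lemma total_ratio_ge1 : 1 <= total_ratio.
Proof. by rewrite lerDl mulr_ge0 ?powR_ge0// ltW. Qed.

Lemma rho_gt0 : 0 < rho.
Proof. by have := total_ratio_ge1 => h; rewrite divr_gt0//; lra. Qed.

Lemma rho_lt1 : rho < 1.
Proof. by have := total_ratio_ge1 => h; rewrite ltr_pdivrMr; lra. Qed.

(** The A_infinity property of the weight |u e|^p.  The complement of a small set
has at least half the volume; lemma reduced_le_portion bounds |UQ e|^p, hence the total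
weight, by the weight of the complement. *)
Lemma wt_small_portion Q (g : euclid R d -> R) : measurable_fun setT g ->
  (forall x, g x = 0 \/ g x = 1) ->
  (\int[mu]_(x in Q) (g x)%:E <= (vol Q / 2)%:E)%E ->
  (\int[mu]_(x in Q) (g x * wt x)%:E <= rho%:E * \int[mu]_(x in Q) (wt x)%:E)%E.
Proof.
move=> mg g01 small; pose h x := 1 - g x.
have mh : measurable_fun setT h by apply: measurable_funB => //; exact: measurable_cst.
have h01 x : h x = 0 \/ h x = 1.
  by rewrite /h; case: (g01 x) => ->; rewrite ?subr0 ?subrr; auto.
have g0 x : 0 <= g x by case: (g01 x) => ->.
have h0 x : 0 <= h x by case: (h01 x) => ->.
have v0 := vol_gt0 Q.
have mE (k : euclid R d -> R) : measurable_fun setT k -> measurable_fun setT (fun x => (k x)%:E).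
  by move=> mk; apply/measurable_EFinP.
have mkw (k : euclid R d -> R) : measurable_fun setT k ->
    measurable_fun setT (fun x => (k x * wt x)%:E).
  by move=> mk; apply: mE; exact: (measurable_funM mk measurable_wt).
have hhalf : ((2^-1 : R)%:E <= avg Q (fun x => (h x)%:E))%E.
  have E1 : (avg Q (fun x => (g x)%:E) + avg Q (fun x => (h x)%:E) = 1)%E.
    rewrite -(avgD _ (mE _ mg) (mE _ mh)) => [|x|x]; rewrite ?lee_fin//.
    by rewrite -(avg_cst Q 1%E); congr avg; apply/funext => x; rewrite -EFinD /h addrC subrK.
  have gs : (avg Q (fun x => (g x)%:E) <= (2^-1)%:E)%E.
    rewrite avgE -(@lee_pmul2l _ (vol Q)%:E)//.
    by rewrite muleA volK mul1e -EFinM.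
  case: (avg Q (fun x => (h x)%:E)) E1 => [b| |]; last first.
  - by case: (avg Q (fun x => (g x)%:E)) gs.
  - by move=> _; rewrite leey.
  - case: (avg Q (fun x => (g x)%:E)) gs => [a| |]//; rewrite lee_fin => ga [E1].
    by rewrite lee_fin; lra.
have key := reduced_le_portion Q mh h01.
set a := (\int[mu]_(x in Q) (g x * wt x)%:E)%E.
pose b := (\int[mu]_(x in Q) (h x * wt x)%:E)%E.
have ab : (\int[mu]_(x in Q) (wt x)%:E = a + b)%E.
  have kw0 (k : euclid R d -> R) : (forall x, 0 <= k x) ->
      forall x, cube_set Q x -> (0 <= (k x * wt x)%:E)%E.
    by move=> k0 x _; rewrite lee_fin mulr_ge0 ?wt_ge0.
  rewrite -(ge0_integralD mu (measurable_cube Q) (kw0 _ g0) (measurable_funTS (mkw _ mg))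
    (kw0 _ h0) (measurable_funTS (mkw _ mh))).
  by apply: eq_integral => x _; rewrite -EFinD /h -mulrDl addrC subrK mul1r.
have wfin : (\int[mu]_(x in Q) (wt x)%:E < +oo)%E.
  rewrite integral_avg; apply: lte_mul_pinfty; rewrite ?lee_fin ?(ltW v0)//.
  by apply: le_lt_trans (HU Q e) _; rewrite -EFinM ltry.
have a0 : (0 <= a)%E by apply: integral_ge0 => x _; rewrite lee_fin mulr_ge0 ?wt_ge0.
have b0 : (0 <= b)%E by apply: integral_ge0 => x _; rewrite lee_fin mulr_ge0 ?wt_ge0.
have hw : avg Q (fun x => (h x * wt x)%:E) = (((vol Q)^-1)%:E * b)%E by rewrite avgE.
have W := HU Q e; rewrite -[X in (X <= _)%E]/(avg Q (fun x => (wt x)%:E)) avgE in W.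
rewrite ab in W wfin *; rewrite hw in key.
clear ab hw; clearbody a b.
case: a a0 W wfin => [a| |]//; case: b b0 key => [b| |]//.
rewrite !lee_fin => b0 key a0 W _.
have {}key : vnorm (UQ Q *m e) / 2 <= C2 * ((vol Q)^-1 * b) `^ p^-1.
  rewrite -lee_fin; apply: le_trans key; rewrite EFinM.
  by apply: lee_wpmul2l; rewrite ?lee_fin ?vnorm_ge0.
have vb0 : 0 <= (vol Q)^-1 * b by rewrite mulr_ge0// invr_ge0 ltW.
have k2 : vnorm (UQ Q *m e) `^ p <= (2 * C2) `^ p * ((vol Q)^-1 * b).
  rewrite (@le_trans _ _ ((2 * (C2 * ((vol Q)^-1 * b) `^ p^-1)) `^ p))//.
    rewrite ge0_ler_powR ?nnegrE ?vnorm_ge0 ?(ltW p0) ?mulr_ge0 ?powR_ge0//.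
    by rewrite -ler_pdivrMl// mulrC.
  rewrite mulrA powRM ?mulr_ge0 ?powR_ge0// -powRrM mulVf ?gt_eqF// powRr1//.
have k3 : a + b <= total_ratio * b.
  have : (vol Q)^-1 * (a + b) <= c * ((2 * C2) `^ p * ((vol Q)^-1 * b)).
    by apply: (le_trans W); rewrite ler_wpM2l// ltW.
  have vi : 0 < (vol Q)^-1 by rewrite invr_gt0.
  rewrite (_ : c * _ = (vol Q)^-1 * (c * (2 * C2) `^ p * b)); last by ring.
  rewrite ler_pM2l// => k; apply: (le_trans k).
  by rewrite /total_ratio [leRHS]mulrDl mul1r lerDr.
have L1 := total_ratio_ge1.
rewrite /rho mulrAC ler_pdivlMr; last by lra.
by lra.
Qed.

Variables (B : euclid R d -> 'M[R[i]]_n) (X : R).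
Hypotheses (hB : forall Q, mxinteg Q B) (X0 : 0 < X).
Hypothesis Ba : forall Q,
  (avg Q (fun x => (opnorm (VQ Q *m (B x - gavg Q B) *m invmx (UQ Q)))%:E) <= X%:E)%E.

(** The midpoint choice: theta > 1 but theta * rho = (1 + rho) / 2 < 1. *)
Definition theta : R := (1 + rho) / (2 * rho).

Lemma theta_gt1 : 1 < theta.
Proof.
have r0 := rho_gt0; have r1 := rho_lt1.
rewrite /theta; move: rho r0 r1 => r r0 r1.
by rewrite ltr_pdivlMr ?mulr_gt0//; lra.
Qed.

Lemma theta_rho : theta * rho = (1 + rho) / 2.
Proof. by rewrite /theta; field; rewrite gt_eqF// rho_gt0. Qed.

(** Chosen so that (1 + tau)^p = theta: in powR_add_eps, the factor in front of the
oscillation that is to be absorbed becomes theta. *)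
Definition tau : R := theta `^ p^-1 - 1.

Lemma tau_gt0 : 0 < tau.
Proof.
have t1 := theta_gt1.
have pV : 0 < p^-1 by rewrite invr_gt0.
have : 1 `^ p^-1 < theta `^ p^-1.
  by rewrite gt0_ltr_powR ?nnegrE// ltW// (lt_trans _ t1).
by rewrite powR1 subr_gt0.
Qed.

Lemma tau_theta : (1 + tau) `^ p = theta.
Proof.
have t1 := theta_gt1; rewrite /tau addrC subrK -powRrM mulVf ?gt_eqF// powRr1//.
by rewrite ltW// (lt_trans _ t1).
Qed.

(** The factor that powR_add_eps puts on the other summand. *)
Definition eta : R := 1 + tau^-1.

Lemma eta_ge1 : 1 <= eta.
Proof. by rewrite lerDl invr_ge0 ltW// tau_gt0. Qed.

(** A subcube whose parent is not stopped has mean of f at most 2^d times that of the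
parent, which is at most 2 X. *)
Definition kappa : R := 2 ^+ d * 2.

(** The fixed point of the recursion A <= (1 + rho)/2 * A + (eta kappa C1 C2)^p that the
stopping argument produces. *)
Definition JN_const : R := (eta * kappa * C1 * C2) `^ p / (1 - (1 + rho) / 2).

Lemma JN_const_ge0 : 0 <= JN_const.
Proof. by rewrite divr_ge0 ?powR_ge0//; have := rho_lt1; lra. Qed.

Definition osc N Q (Y : 'M[R[i]]_n) x : R :=
  vnorm (v x *m (mxEN N Q B x - Y) *m e) `^ p.

Lemma osc_ge0 N Q (Y : 'M[R[i]]_n) x : 0 <= osc N Q Y x. Proof. exact: powR_ge0. Qed.

Lemma measurable_oscv N Q (Y : 'M[R[i]]_n) :
  measurable_fun setT (fun x => vnorm (v x *m (mxEN N Q B x - Y) *m e)).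
Proof.
apply: measurable_vnorm.
exact: (mxmeasM (mxmeasM mv (mxmeasB (mxmeas_mxEN N Q B) (mxmeas_cst _ Y))) (mxmeas_cst _ e)).
Qed.

Lemma measurable_osc N Q (Y : 'M[R[i]]_n) : measurable_fun setT (fun x => (osc N Q Y x)%:E).
Proof. exact: (measurable_powR_EFin p (measurable_oscv N Q Y)). Qed.

Lemma osc_child N Q b (Y : 'M[R[i]]_n) x : cube_set (child Q b) x ->
  osc N.+1 Q Y x = osc N (child Q b) Y x.
Proof. by move=> /child_dindex; rewrite /osc /mxEN /= => ->. Qed.

Lemma integral_osc_children N Q (Y : 'M[R[i]]_n) :
  (\int[mu]_(x in Q) (osc N.+1 Q Y x)%:E =
   \sum_b \int[mu]_(x in child Q b) (osc N (child Q b) Y x)%:E)%E.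
Proof.
rewrite (integral_children Q (measurable_osc N.+1 Q Y)) => [|x]; last first.
  by rewrite lee_fin osc_ge0.
apply: eq_bigr => b _; apply: eq_integral => x; rewrite inE => Qx.
by rewrite (osc_child _ _ Qx).
Qed.

Section one_cube.
Variable Q0 : cube R d.
Let a := gavg Q0 B.
Let f x : R := opnorm (VQ Q0 *m (B x - a) *m invmx (UQ Q0)).
Let f0 x : 0 <= f x. Proof. exact: opnorm_ge0. Qed.
Let mf : measurable_fun setT f.
Proof.
apply: measurable_opnorm.
exact: (mxmeasM (mxmeasM (mxmeas_cst _ _) (mxmeasB (mxinteg_meas (hB Q0)) (mxmeas_cst _ a)))
  (mxmeas_cst _ _)).
Qed.
Let k x : R := opnorm (v x *m invmx (VQ Q0)) `^ p.
Let k0 x : 0 <= k x. Proof. exact: powR_ge0. Qed.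
Let mk : measurable_fun setT k.
Proof.
apply: (measurableT_comp (measurable_powR p)); apply: measurable_opnorm.
exact: (mxmeasM mv (mxmeas_cst _ _)).
Qed.
Let mkE : measurable_fun setT (fun x => (k x)%:E).
Proof. by apply/measurable_EFinP. Qed.
Let K : R := kappa * X * vnorm (UQ Q0 *m e).
Let K0 : 0 <= K.
Proof. by rewrite !mulr_ge0 ?exprn_ge0 ?vnorm_ge0// ltW. Qed.
Let stop M S x := stopf f (2 * X) M S x.

(** The difference of the two averages of B is the mean over S of B - a, and
f is the norm of this function after reduction, whose mean over S is at most kappa X. *)
Lemma jump_le S :
  (\int[mu]_(x in S) (f x)%:E <= (kappa * X)%:E * (vol S)%:E)%E ->
  forall x, vnorm (v x *m (gavg S B - a) *m e) `^ p <= K `^ p * k x.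
Proof.
move=> hS x; have hav : opnorm (VQ Q0 *m (gavg S B - a) *m invmx (UQ Q0)) <= kappa * X.
  rewrite -lee_fin -(gavgB _ (hB S)).
  apply: (le_trans (opnorm_gavg _ _ (mxintegB _ (hB S)))).
  rewrite -(@lee_pmul2l _ (vol S)%:E)//; last by rewrite lte_fin vol_gt0.
  by rewrite -integral_avg [leRHS]muleC.
have E : v x *m (gavg S B - a) *m e = v x *m invmx (VQ Q0) *m
   ((VQ Q0 *m (gavg S B - a) *m invmx (UQ Q0)) *m (UQ Q0 *m e)).
  rewrite !mulmxA (mulmxKV (unitU Q0)); congr (_ *m _ *m _).
  by rewrite (mulmxKV (unitV Q0)).
have le : vnorm (v x *m (gavg S B - a) *m e) <= K * opnorm (v x *m invmx (VQ Q0)).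
  rewrite E; apply: (le_trans (vnorm_mulmx _ _)); rewrite [leRHS]mulrC.
  apply: ler_wpM2l; first exact: opnorm_ge0.
  apply: (le_trans (vnorm_mulmx _ _)); rewrite /K.
  by apply: ler_wpM2r; first exact: vnorm_ge0.
rewrite /k -(powRM _ K0 (opnorm_ge0 _)); apply: ge0_ler_powR => //.
- exact: ltW.
- by rewrite nnegrE vnorm_ge0.
- by rewrite nnegrE mulr_ge0 ?opnorm_ge0.
Qed.

Lemma wt_integral_ge0 S : (0 <= \int[mu]_(x in S) (wt x)%:E)%E.
Proof. by apply: integral_ge0 => x _; rewrite lee_fin wt_ge0. Qed.

Let swt M S x : \bar R := (stop M S x * wt x)%:E.
Let swt0 M S x : (0 <= swt M S x)%E.
Proof. by rewrite lee_fin mulr_ge0 ?wt_ge0// stopf_ge0. Qed.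
Let mswt M S : measurable_fun setT (swt M S).
Proof.
apply/measurable_EFinP; exact: (measurable_funM (measurable_stopf f (2 * X) M S) measurable_wt).
Qed.

Let A : R := JN_const * X `^ p.
Let A0 : 0 <= A. Proof. by rewrite mulr_ge0 ?JN_const_ge0 ?powR_ge0. Qed.
Let th0 : 0 <= theta. Proof. by rewrite ltW// (lt_trans _ theta_gt1). Qed.
Let eta0 : 0 <= eta. Proof. by rewrite (le_trans _ eta_ge1). Qed.
Let kE0 x : (0 <= (k x)%:E)%E. Proof. by rewrite lee_fin. Qed.
Let D : R := (eta * K) `^ p.
Let D0 : 0 <= D. Proof. exact: powR_ge0. Qed.
Let KD : K `^ p <= D.
Proof.
apply: ge0_ler_powR; rewrite ?nnegrE ?(ltW p0) ?(mulr_ge0 eta0 K0)//.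
by rewrite ler_peMl// eta_ge1.
Qed.

Let intZ (S : cube R d) (l : R) (g : euclid R d -> \bar R) : measurable_fun setT g ->
  (forall x, 0 <= g x)%E -> 0 <= l ->
  (\int[mu]_(x in S) (l%:E * g x) = l%:E * \int[mu]_(x in S) g x)%E.
Proof.
move=> mg g0 l0; apply: ge0_integralZl_EFin => //; exact: measurable_funTS.
Qed.

Lemma split_powR (al be z : R) : 0 <= al -> 0 <= be -> 0 <= z ->
  be `^ p <= K `^ p * z -> (al + be) `^ p <= theta * al `^ p + D * z.
Proof.
move=> al0 be0 z0 h; have t0 : 0 <= 1 + tau by rewrite addr_ge0// ltW// tau_gt0.
apply: (le_trans (powR_add_eps tau_gt0 al0 be0 p0)).
rewrite (powRM p t0 al0) tau_theta (powRM p eta0 be0) lerD2l.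
by rewrite /D (powRM p eta0 K0) -mulrA ler_wpM2l ?powR_ge0.
Qed.

(** On a stopped cube S, the induction hypothesis bounds the oscillation around the mean
over S; passing to the mean over Q0 costs the jump and a factor theta. *)
Lemma osc_stopped M S :
  (\int[mu]_(x in S) (osc M S (gavg S B) x)%:E <= A%:E * \int[mu]_(x in S) (wt x)%:E)%E ->
  (\int[mu]_(x in S) (f x)%:E <= (kappa * X)%:E * (vol S)%:E)%E ->
  (\int[mu]_(x in S) (osc M S a x)%:E <=
     (theta * A)%:E * \int[mu]_(x in S) (wt x)%:E + D%:E * \int[mu]_(x in S) (k x)%:E)%E.
Proof.
move=> IH /jump_le jump.
have mo := measurable_osc M S.
have o0 Y x : (0 <= (osc M S Y x)%:E)%E by rewrite lee_fin osc_ge0.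
have mT : measurable_fun setT (fun x => theta%:E * (osc M S (gavg S B) x)%:E)%E.
  exact: measurable_funeM.
have mD : measurable_fun setT (fun x => D%:E * (k x)%:E)%E by exact: measurable_funeM.
have T0 x : (0 <= theta%:E * (osc M S (gavg S B) x)%:E)%E.
  by apply: mule_ge0; rewrite lee_fin// osc_ge0.
have D0' x : (0 <= D%:E * (k x)%:E)%E by rewrite mule_ge0 ?lee_fin.
apply: (@le_trans _ _ (\int[mu]_(x in S)
   (theta%:E * (osc M S (gavg S B) x)%:E + D%:E * (k x)%:E))%E).
  apply: ge0_le_integral; first exact: measurable_cube.
  - by move=> x _; exact: o0.
  - exact: measurable_funTS (mo a).
  - exact: measurable_funTS (emeasurable_funD mT mD).
  move=> x _; rewrite -!EFinM -EFinD lee_fin.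
  apply: (le_trans _ (split_powR (vnorm_ge0 _) (vnorm_ge0 _) (k0 x) (jump x))).
  apply: ge0_ler_powR; rewrite ?nnegrE ?addr_ge0 ?vnorm_ge0 ?(ltW p0)//.
  apply: le_trans (ler_vnormD _ _); rewrite -mulmxDl -mulmxDr.
  by rewrite addrA subrK.
rewrite (ge0_integralD mu (measurable_cube S) (fun x _ => T0 x) (measurable_funTS mT)
  (fun x _ => D0' x) (measurable_funTS mD)).
rewrite (intZ S (mo (gavg S B)) (o0 (gavg S B)) th0) (intZ S mkE kE0 D0).
apply: leeD; last exact: lexx.
by rewrite (EFinM theta A) -muleA; apply: lee_wpmul2l; rewrite ?lee_fin.
Qed.

(** Descend the dyadic tree from S until a cube is stopped or the depth is exhausted.  At a
stopped cube the previous lemma applies; at a cube of depth 0 that is not stopped, the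
dyadic average is the mean over that cube and only the jump remains. *)
Lemma osc_tree N
  (IH : forall M, (M < N)%N -> forall S,
    (\int[mu]_(x in S) (osc M S (gavg S B) x)%:E <=
      A%:E * \int[mu]_(x in S) (wt x)%:E)%E) M S :
  (M <= N)%N -> (large f (2 * X) S -> (M < N)%N) ->
  (\int[mu]_(x in S) (f x)%:E <= (kappa * X)%:E * (vol S)%:E)%E ->
  (\int[mu]_(x in S) (osc M S a x)%:E <=
     (theta * A)%:E * \int[mu]_(x in S) swt M S x +
     D%:E * \int[mu]_(x in S) (k x)%:E)%E.
Proof.
have ik S' : (0 <= \int[mu]_(x in S') (k x)%:E)%E by apply: integral_ge0 => x _.
have isw M' S' : (0 <= \int[mu]_(x in S') swt M' S' x)%E.
  by apply: integral_ge0 => x _; exact: swt0.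
have thA : (0 <= (theta * A)%:E)%E by rewrite lee_fin mulr_ge0.
have stopped M' S' : (M' < N)%N -> large f (2 * X) S' ->
    (\int[mu]_(x in S') (f x)%:E <= (kappa * X)%:E * (vol S')%:E)%E ->
    (\int[mu]_(x in S') (osc M' S' a x)%:E <=
     (theta * A)%:E * \int[mu]_(x in S') swt M' S' x +
     D%:E * \int[mu]_(x in S') (k x)%:E)%E.
  move=> MN lS hS; apply: (le_trans (osc_stopped (IH _ MN S') hS)).
  rewrite le_eqVlt; apply/orP; left; apply/eqP; congr (_ * _ + _)%E.
  apply: eq_integral => x _; rewrite /swt /stop.
  by case: M' {MN} => [|M'] /=; rewrite lS mul1r.
elim: M S => [|M IHM] S MN lM hS.
  have [lS|lS] := boolP (large f (2 * X) S); first exact: (stopped _ _ (lM lS) lS hS).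
  have jump := jump_le hS.
  apply: (@le_trans _ _ (D%:E * \int[mu]_(x in S) (k x)%:E)%E); last first.
    by rewrite leeDr// mule_ge0.
  rewrite -(intZ S mkE kE0 D0); apply: ge0_le_integral; first exact: measurable_cube.
  - by move=> x _; rewrite lee_fin osc_ge0.
  - exact: measurable_funTS (measurable_osc 0 S a).
  - by apply: measurable_funTS; exact: measurable_funeM.
  - move=> x _; rewrite -EFinM lee_fin /osc /mxEN /=.
    by rewrite (le_trans (jump x))// ler_wpM2r// KD.
have [lS|lS] := boolP (large f (2 * X) S); first exact: (stopped _ _ (lM lS) lS hS).
have fE0 x : (0 <= (f x)%:E)%E by rewrite lee_fin.
have mfE : measurable_fun setT (fun x => (f x)%:E) by apply/measurable_EFinP.
rewrite integral_osc_children (integral_children S (mswt M.+1 S) (swt0 M.+1 S)).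
rewrite (integral_children S mkE kE0).
rewrite (ge0_sume_distrr _ _ (fun b _ => ik (child S b))).
rewrite ge0_sume_distrr => [|b _]; last by apply: integral_ge0 => x _; exact: swt0.
rewrite -big_split /=; apply: lee_sum => b _.
have hb : (\int[mu]_(x in child S b) (f x)%:E <= (kappa * X)%:E * (vol (child S b))%:E)%E.
  have : (\int[mu]_(x in S) (f x)%:E <= (2 * X)%:E * (vol S)%:E)%E.
    by rewrite leNgt; apply/negP => h; move/negP: lS; apply; apply/asboolP.
  rewrite -EFinM => h; apply: (@le_trans _ _ (\int[mu]_(x in S) (f x)%:E)%E).
    rewrite (integral_children S mfE fE0) (bigD1 b)//= leeDl//.
    by apply: sume_ge0 => b' _; apply: integral_ge0 => x _.
  apply: (le_trans h); rewrite -EFinM lee_fin vol_child /kappa.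
  rewrite (_ : _ * _ * X * _ = 2 * X * vol S)//.
  by field; rewrite expf_eq0 pnatr_eq0 andbF.
apply: (le_trans (IHM (child S b) (ltnW MN) (fun=> MN) hb)).
rewrite le_eqVlt; apply/orP; left; apply/eqP; congr (_ * _ + _)%E.
apply: eq_integral => x; rewrite inE => Sx; rewrite /swt /stop.
by rewrite (stopf_child (f := f) (t := 2 * X) M lS Sx).
Qed.

(** Since Q0 is not stopped, the stopped cubes occupy at most half of it
and carry at most rho of its weight: the two terms of osc_tree add up to A times the
weight of Q0 by the choice of JN_const. *)
Lemma osc_one_cube N
  (IH : forall M, (M < N)%N -> forall S,
    (\int[mu]_(x in S) (osc M S (gavg S B) x)%:E <=
      A%:E * \int[mu]_(x in S) (wt x)%:E)%E) :
  (\int[mu]_(x in Q0) (osc N Q0 a x)%:E <= A%:E * \int[mu]_(x in Q0) (wt x)%:E)%E.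
Proof.
have v0 := vol_gt0 Q0.
have fX : (\int[mu]_(x in Q0) (f x)%:E <= X%:E * (vol Q0)%:E)%E.
  rewrite integral_avg muleC lee_wpmul2r ?lee_fin ?(ltW v0)//; exact: Ba.
have lQ : ~~ large f (2 * X) Q0.
  apply/negP => /asboolP; apply/negP; rewrite -leNgt (le_trans fX)//.
  rewrite -!EFinM lee_fin; apply: ler_wpM2r; first exact: ltW.
  by rewrite ler_peMl ?ler1n// ltW.
have hQ : (\int[mu]_(x in Q0) (f x)%:E <= (kappa * X)%:E * (vol Q0)%:E)%E.
  apply: (le_trans fX); rewrite -!EFinM lee_fin; apply: ler_wpM2r; first exact: ltW.
  rewrite ler_peMl ?(ltW X0)// /kappa.
  have : 1 <= (2 : R) ^+ d by rewrite exprn_ege1// ler1n.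
  by lra.
have lN : large f (2 * X) Q0 -> (N < N)%N by rewrite (negbTE lQ).
apply: (le_trans (osc_tree IH (leqnn N) lN hQ)).
have ms := measurable_stopf f (2 * X) N Q0.
have small : (\int[mu]_(x in Q0) (stop N Q0 x)%:E <= (vol Q0 / 2)%:E)%E.
  have := @integral_stopf_le _ _ f (2 * X) mf f0 N Q0.
  move=> h; have {}h := le_trans h fX.
  rewrite -(@lee_pmul2l _ (2 * X)%:E)//; last by rewrite lte_fin mulr_gt0.
  apply: (le_trans h); rewrite -!EFinM lee_fin.
  by rewrite (_ : 2 * X * _ = X * vol Q0)//; field.
have sw := wt_small_portion ms (stopf_01 f (2 * X) N Q0) small.
have W := reduced_le_wt Q0.
have wfin : (\int[mu]_(x in Q0) (wt x)%:E \is a fin_num)%E.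
  rewrite ge0_fin_numE ?wt_integral_ge0// integral_avg; apply: lte_mul_pinfty.
  - by rewrite lee_fin ltW.
  - by [].
  - by apply: le_lt_trans (HU Q0 e) _; rewrite -EFinM ltry.
have ki : (\int[mu]_(x in Q0) (k x)%:E <= (vol Q0 * C1 `^ p)%:E)%E.
  by rewrite integral_avg EFinM lee_wpmul2l ?lee_fin ?(ltW v0)//; exact: HV.
apply: (@le_trans _ _ ((theta * A)%:E * (rho%:E * \int[mu]_(x in Q0) (wt x)%:E) +
    D%:E * (vol Q0 * C1 `^ p)%:E)%E).
  apply: leeD; first by apply: lee_wpmul2l; [rewrite lee_fin mulr_ge0|exact: sw].
  by apply: lee_wpmul2l; [rewrite lee_fin|exact: ki].
have := wt_integral_ge0 Q0.
case: (\int[mu]_(x in Q0) (wt x)%:E)%E wfin W => [w| |]// _ /= W; rewrite lee_fin => w0.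
rewrite -!EFinM -EFinD lee_fin.
have DE : D * (vol Q0 * C1 `^ p) <= (eta * kappa * C1 * C2) `^ p * X `^ p * w.
  have gen (e1 k1 x1 u1 c1 c2 V : R) : 0 <= e1 -> 0 <= k1 -> 0 <= x1 -> 0 <= u1 ->
      0 <= c1 -> 0 <= c2 -> u1 `^ p * V <= c2 `^ p * w ->
      (e1 * (k1 * x1 * u1)) `^ p * (V * c1 `^ p) <= (e1 * k1 * c1 * c2) `^ p * x1 `^ p * w.
    move=> e10 k10 x10 u10 c10 c20 h; rewrite !powRM ?mulr_ge0//.
    rewrite (_ : _ * (V * _) = e1 `^ p * k1 `^ p * c1 `^ p * x1 `^ p * (u1 `^ p * V)); last by ring.
    rewrite (_ : _ * w = e1 `^ p * k1 `^ p * c1 `^ p * x1 `^ p * (c2 `^ p * w)); last by ring.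
    by rewrite ler_wpM2l// !mulr_ge0 ?powR_ge0.
  apply: gen => //; [by rewrite mulr_ge0// exprn_ge0|exact: ltW|exact: vnorm_ge0].
apply: (le_trans (lerD (lexx _) DE)).
have r1 := rho_lt1.
have s0 : 1 - (1 + rho) / 2 != 0 by rewrite gt_eqF//; lra.
have AE : (eta * kappa * C1 * C2) `^ p = (1 - (1 + rho) / 2) * JN_const.
  by rewrite /JN_const; move: (_ `^ p) => z; rewrite mulrC mulfVK.
rewrite AE /A mulrA (mulrAC theta) theta_rho le_eqVlt; apply/orP; left; apply/eqP.
ring.
Qed.

End one_cube.

(** Strong induction on the depth: stopped cubes are reached with a smaller
depth. *)
Lemma osc_le N Q :
  (\int[mu]_(x in Q) (osc N Q (gavg Q B) x)%:E <=
    (JN_const * X `^ p)%:E * \int[mu]_(x in Q) (wt x)%:E)%E.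
Proof.
elim/ltn_ind: N Q => N IH Q; apply: osc_one_cube => M MN S; exact: IH.
Qed.

(** The depth is removed by Fatou's lemma, and the reducing property turns the weight of
Q into |UQ e|^p. *)
Lemma weighted_oscillation_vec Q :
  (avg Q (fun x => (vnorm (v x *m (B x - gavg Q B) *m e) `^ p)%:E) <=
   (JN_const * c * X `^ p * vnorm (UQ Q *m e) `^ p)%:E)%E.
Proof.
have A0 : 0 <= JN_const * X `^ p by rewrite mulr_ge0 ?JN_const_ge0 ?powR_ge0.
have h := fatou_EN p0 (hB Q) mv (osc_le ^~ Q).
rewrite avgE -(@lee_pmul2l _ (vol Q)%:E)//; last by rewrite lte_fin vol_gt0.
rewrite muleA volK mul1e; apply: (le_trans h).
rewrite integral_avg muleCA lee_wpmul2l ?lee_fin ?(ltW (vol_gt0 Q))//.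
rewrite (_ : (JN_const * c * X `^ p * vnorm (UQ Q *m e) `^ p)%:E =
  (JN_const * X `^ p)%:E * (c%:E * (vnorm (UQ Q *m e) `^ p)%:E))%E; last first.
  by rewrite -!EFinM; congr EFin; ring.
by rewrite lee_wpmul2l ?lee_fin//; exact: HU.
Qed.

End fixed_vector.

End John_Nirenberg.

(** * Oscillations with respect to a pair of weights *)

Section oscillations.
Context (R : realType) (d n : nat).
Local Notation mu := (leb R d).
Local Notation mxfun := (euclid R d -> 'M[R[i]]_n).
Implicit Types (Q : cube R d) (x y : euclid R d) (X : R) (B : mxfun).

(** The quantities are compared through their finite upper bounds X.  This
is the quantity a), with V and U represented by their reducing matrices alone. *)
Definition osc_reduced (VQ UQ : cube R d -> 'M[R[i]]_n) B X : Prop := forall Q,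
  (avg Q (fun x => (opnorm (VQ Q *m (B x - gavg Q B) *m invmx (UQ Q)))%:E) <= X%:E)%E.

(** The quantity b), and c) for the dual data. *)
Definition osc_mean (p : R) (v : mxfun) (UQ : cube R d -> 'M[R[i]]_n) B X : Prop :=
  forall Q, avgLe Q p (fun x => opnorm (v x *m (B x - gavg Q B) *m invmx (UQ Q))) X.

(** The quantity d), and e) for the dual data. *)
Definition osc_double (p q : R) (v u' : mxfun) B X : Prop := forall Q,
  (avg Q (fun x => (avg Q (fun y => (opnorm (v x *m (B x - B y) *m u' y) `^ q)%:E))
     `^ (p / q)) <= (X `^ p)%:E)%E.

(** What the comparisons use about the weights and their reducing matrices.
WQ plays the part of the reducing matrix of v', that is, up to bounded factors, of
the inverse of VQ.  These hypotheses also hold for the dual data, so each comparison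
below has a dual for free. *)
Record two_weight (c K p q : R) (v v' u u' : mxfun)
    (VQ UQ WQ : cube R d -> 'M[R[i]]_n) : Prop := TwoWeight {
  tw_v : dual_pair v v';
  tw_u : dual_pair u u';
  tw_VQ : forall Q, VQ Q \in unitmx;
  tw_UQ : forall Q, UQ Q \in unitmx;
  tw_WQ : forall Q, WQ Q \in unitmx;
  tw_v_VQ : forall Q, avgLe Q p (fun x => opnorm (v x *m invmx (VQ Q))) K;
  tw_VQ_v' : forall Q, avgLe Q q (fun x => opnorm (VQ Q *m v' x)) K;
  tw_u_UQ : forall Q, avgLe Q p (fun x => opnorm (u x *m invmx (UQ Q))) K;
  tw_UQ_u' : forall Q, avgLe Q q (fun x => opnorm (UQ Q *m u' x)) K;
  tw_v_WQ : forall Q, avgLe Q p (fun x => opnorm (v x *m WQ Q)) K;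
  tw_ue : forall Q (e : 'cV[R[i]]_n),
    (avg Q (fun x => (vnorm (u x *m e) `^ p)%:E) <= c%:E * (vnorm (UQ Q *m e) `^ p)%:E)%E }.

Variables (c K p q : R) (v v' u u' : mxfun) (VQ UQ WQ : cube R d -> 'M[R[i]]_n).
Hypotheses (p1 : 1 < p) (q0 : 0 < q) (pq : p^-1 + q^-1 = 1) (c0 : 0 < c) (K0 : 0 < K).
Hypothesis tw : two_weight c K p q v v' u u' VQ UQ WQ.

Let p0 : 0 < p. Proof. exact: lt_trans p1. Qed.
Let mv := dp_meas (tw_v tw).
Let mv' := dp_meas' (tw_v tw).
Let mu_ := dp_meas (tw_u tw).
Let mu' := dp_meas' (tw_u tw).

Let mosc (w : mxfun) (M N : 'M[R[i]]_n) Q B : mxmeas w -> mxinteg Q B ->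
  measurable_fun setT (fun x => opnorm (w x *m (B x - M) *m N)).
Proof.
move=> mw hB; apply: measurable_opnorm.
exact: (mxmeasM (mxmeasM mw (mxmeasB (mxinteg_meas hB) (mxmeas_cst _ M))) (mxmeas_cst _ N)).
Qed.

(** The John-Nirenberg inequality for the vectors e = UQ^-1 e_j, which
satisfy |UQ e| = 1, bounds the columns. *)
Lemma osc_mean_of_reduced : exists2 C : R, 0 < C &
  forall B, (forall Q, mxinteg Q B) -> forall X, 0 < X ->
    osc_reduced VQ UQ B X -> osc_mean p v UQ B (C * X).
Proof.
pose A := JN_const d p c K K * c.
have A0 : 0 <= A by apply: mulr_ge0; [exact: JN_const_ge0|exact: ltW].
pose C := 2 * n%:R ^+ 2 * A `^ p^-1.
have C0 : 0 <= C by rewrite /C !mulr_ge0 ?powR_ge0 ?exprn_ge0 ?ler0n.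
exists (C + 1) => [|B hB X X0 hX Q]; first by rewrite ltr_wpDl.
apply: (@avgLe_mono _ _ _ _ _ (C * X)) => //; first by rewrite mulr_ge0// ltW.
  by rewrite ler_wpM2r ?(ltW X0)// lerDl.
rewrite /C -[X in avgLe _ _ _ X]mulrA; apply: avgLe_opnorm_cols; first exact: ltW.
- by rewrite mulr_ge0 ?powR_ge0 ?ltW.
- exact: (mxmeasM (mxmeasM mv (mxmeasB (mxinteg_meas (hB Q)) (mxmeas_cst _ _)))
    (mxmeas_cst _ _)).
move=> j; set e := invmx (UQ Q) *m ecol R j.
have inv_u : {ae mu, forall x, u' x *m u x = 1%:M} by exact: dp_inv (dual_pairC (tw_u tw)).
have E x : v x *m (B x - gavg Q B) *m invmx (UQ Q) *m ecol R j = v x *m (B x - gavg Q B) *m e.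
  exact: esym (mulmxA _ _ _).
have Ue : UQ Q *m e = ecol R j by rewrite /e mulmxA (mulmxV (tw_UQ tw Q)) mul1mx.
have AX : A * X `^ p * vnorm (UQ Q *m e) `^ p = (A `^ p^-1 * X) `^ p.
  rewrite Ue vnorm_ecol powR1 mulr1 (powRM p (powR_ge0 A p^-1) (ltW X0)) -powRrM.
  by rewrite mulVf ?gt_eqF// powRr1.
rewrite /avgLe; under eq_fun do rewrite E.
rewrite -AX.
exact: (@weighted_oscillation_vec _ _ _ p q v u u' VQ UQ c K K p1 q0 pq mv mu_ mu' inv_u
  (tw_VQ tw) (tw_UQ tw) c0 (ltW K0) (ltW K0) (tw_v_VQ tw) (tw_UQ_u' tw) (tw_ue tw)
  e B X hB X0 hX Q).
Qed.

(** Insert v' v = 1 after VQ and apply Hoelder's inequality. *)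
Lemma osc_reduced_of_mean B X : (forall Q, mxinteg Q B) -> 0 <= X ->
  osc_mean p v UQ B X -> osc_reduced VQ UQ B (K * X).
Proof.
move=> hB X0 hX Q.
have mg := mosc (gavg Q B) (invmx (UQ Q)) mv (hB Q).
have mf : measurable_fun setT (fun x => opnorm (VQ Q *m v' x)).
  by apply: measurable_opnorm; exact: (mxmeasM (mxmeas_cst _ (VQ Q)) mv').
have qp : q^-1 + p^-1 = 1 by rewrite addrC.
have := avg_hoelder q0 p0 qp mf mg (fun=> opnorm_ge0 _) (fun=> opnorm_ge0 _) (ltW K0) X0
  (tw_VQ_v' tw Q) (hX Q).
apply: le_trans; apply: avg_le_ae.
- apply: measurable_opnorm_EFin.
  exact: (mxmeasM (mxmeasM (mxmeas_cst _ (VQ Q))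
    (mxmeasB (mxinteg_meas (hB Q)) (mxmeas_cst _ _))) (mxmeas_cst _ _)).
- by apply/measurable_EFinP; exact: (measurable_funM mf mg).
- by move=> x; rewrite lee_fin opnorm_ge0.
- by move=> x; rewrite lee_fin mulr_ge0 ?opnorm_ge0.
apply: filterS (dp_inv (dual_pairC (tw_v tw))) => x vx; rewrite lee_fin.
have := opnormM (VQ Q *m v' x) (v x *m (B x - gavg Q B) *m invmx (UQ Q)).
move: (B x - gavg Q B) => D; rewrite -(mulmxA (VQ Q)) -(mulmxA (v x)) (mulmxA (v' x)) vx.
by rewrite mul1mx -!mulmxA.
Qed.

Lemma poweR_powR (z : R) : 0 <= z -> ((z `^ q)%:E `^ (p / q))%E = (z `^ p)%:E.
Proof. by move=> z0; rewrite poweR_EFin -powRrM mulrCA mulfV ?gt_eqF// mulr1. Qed.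

Lemma measurable_double Q B : mxinteg Q B -> measurable_fun setT (fun x =>
  (avg Q (fun y => (opnorm (v x *m (B x - B y) *m u' y) `^ q)%:E)) `^ (p / q))%E.
Proof.
move=> hB; apply: (measurableT_comp (measurable_poweR _)).
apply: (@measurable_avg2 _ _ Q (fun z => (opnorm (v z.1 *m (B z.1 - B z.2) *m u' z.2) `^ q)%:E)).

  apply/measurable_EFinP; apply: (measurableT_comp (measurable_powR q)).
  apply: measurable_opnorm.
  have mB := mxinteg_meas hB.
  exact: (mxmeasM (mxmeasM (mxmeas_comp measurable_fst mv)
    (mxmeasB (mxmeas_comp measurable_fst mB) (mxmeas_comp measurable_snd mB)))
    (mxmeas_comp measurable_snd mu')).
by move=> z; rewrite lee_fin powR_ge0.
Qed.

Let mslice Q B x : mxinteg Q B ->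
  measurable_fun setT (fun y => opnorm (v x *m (B x - B y) *m u' y)).
Proof.
move=> hB; apply: measurable_opnorm.
exact: (mxmeasM (mxmeasM (mxmeas_cst _ (v x))
  (mxmeasB (mxmeas_cst _ (B x)) (mxinteg_meas hB))) mu').
Qed.

(** At fixed x, v(x) (B(x) - m) UQ^-1 is the mean over y of
v(x) (B(x) - B(y)) u'(y) times u(y) UQ^-1; apply Hoelder's inequality in y. *)
Lemma osc_mean_of_double B X : (forall Q, mxinteg Q B) -> 0 <= X ->
  osc_double p q v u' B X -> osc_mean p v UQ B (K * X).
Proof.
move=> hB X0 hX Q.
rewrite /avgLe (powRM p (ltW K0) X0) EFinM.
have Kp : (0 <= (K `^ p)%:E)%E by rewrite lee_fin powR_ge0.
apply: le_trans (lee_wpmul2l Kp (hX Q)).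
rewrite -(avgZ _ (measurable_double (hB Q)) _ Kp); last by move=> x; exact: poweR_ge0.
apply: (avg_le _ _ _ (powR_EFin_ge0 _ _)).
- exact: (measurable_powR_EFin p (mosc (gavg Q B) (invmx (UQ Q)) mv (hB Q))).
- by apply: measurable_funeM; exact: measurable_double.
- by move=> x; rewrite mule_ge0// poweR_ge0.
move=> x; set a := avg Q (fun y => _).
have a0 : (0 <= a)%E by apply: avg_ge0 => y; rewrite lee_fin powR_ge0.
case E : a a0 => [r| |] a0; [| |by []]; last first.
  (* an infinite inner mean makes the bound infinite, as K > 0 *)
  rewrite poweRyr; last by rewrite gt_eqF ?divr_gt0.
  by rewrite gt0_muley ?leey// lte_fin powR_gt0.
have r0 : 0 <= r by rewrite -lee_fin.
have rq : (r `^ q^-1) `^ q = r by rewrite -powRrM mulVf ?gt_eqF// powRr1.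
have ha : avgLe Q q (fun y => opnorm (v x *m (B x - B y) *m u' y)) (r `^ q^-1).
  by rewrite /avgLe rq -E.
have mg : measurable_fun setT (fun y => opnorm (u y *m invmx (UQ Q))).
  by apply: measurable_opnorm; exact: (mxmeasM mu_ (mxmeas_cst _ _)).
have qp : q^-1 + p^-1 = 1 by rewrite addrC.
have h := avg_hoelder q0 p0 qp (mslice x (hB Q)) mg (fun=> opnorm_ge0 _) (fun=> opnorm_ge0 _)
  (powR_ge0 _ _) (ltW K0) ha (tw_u_UQ tw Q).
rewrite -rq (poweR_powR (powR_ge0 _ _)) -EFinM lee_fin -(powRM p (ltW K0) (powR_ge0 _ _)).
apply: ge0_ler_powR; [exact: ltW|by rewrite nnegrE opnorm_ge0| |].
  by rewrite nnegrE mulr_ge0 ?powR_ge0 ?ltW.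
rewrite mulrC -lee_fin; apply: le_trans h.
have hBx := mxintegB (B x) (hB Q).
have -> : opnorm (v x *m (B x - gavg Q B) *m invmx (UQ Q)) =
    opnorm (v x *m gavg Q (fun y => B y - B x) *m invmx (UQ Q)).
  rewrite (gavgB _ (hB Q)) -(opnormN (v x *m (B x - gavg Q B) *m invmx (UQ Q))).
  by rewrite -mulNmx -mulmxN opprB.
apply: (le_trans (opnorm_gavg _ _ hBx)); apply: avg_le_ae.
- apply: measurable_opnorm_EFin.
  exact: (mxmeasM (mxmeasM (mxmeas_cst _ (v x)) (mxinteg_meas hBx)) (mxmeas_cst _ _)).
- by apply/measurable_EFinP; exact: (measurable_funM (mslice x (hB Q)) mg).
- by move=> y; rewrite lee_fin opnorm_ge0.
- by move=> y; rewrite lee_fin mulr_ge0 ?opnorm_ge0.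
apply: filterS (dp_inv (dual_pairC (tw_u tw))) => y uy; rewrite lee_fin.
have := opnormM (v x *m (B x - B y) *m u' y) (u y *m invmx (UQ Q)).
rewrite mulmxA -(mulmxA _ (u' y)) uy mulmx1; apply: le_trans.
rewrite le_eqVlt -(opnormN (v x *m (B x - B y) *m invmx (UQ Q))).
by rewrite -mulNmx -mulmxN opprB eqxx.
Qed.

(** Write B(x) - B(y) = (B(x) - m) - (B(y) - m).  In the first term
insert UQ^-1 UQ, in the second WQ WQ^-1: each becomes a product of a function of x and a
function of y with bounded means. *)
Lemma osc_double_of_means B X : (forall Q, mxinteg Q B) -> 0 <= X ->
  osc_mean p v UQ B X ->
  (forall Q, avgLe Q q (fun y => opnorm (invmx (WQ Q) *m (B y - gavg Q B) *m u' y)) X) ->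
  osc_double p q v u' B (32 * K * X).
Proof.
move=> hB X0 hb hc Q; have K0' := ltW K0.
have q1 : 1 <= q by rewrite -invf_le1// -pq lerDr invr_ge0 ltW.
pose f1 y := opnorm (UQ Q *m u' y).
pose f2 y := opnorm (invmx (WQ Q) *m (B y - gavg Q B) *m u' y).
pose b x := opnorm (v x *m (B x - gavg Q B) *m invmx (UQ Q)).
pose s x := opnorm (v x *m WQ Q).
have m1 : measurable_fun setT f1.
  by apply: measurable_opnorm; exact: (mxmeasM (mxmeas_cst _ (UQ Q)) mu').
have m2 : measurable_fun setT f2.
  apply: measurable_opnorm.
  exact: (mxmeasM (mxmeasM (mxmeas_cst _ _) (mxmeasB (mxinteg_meas (hB Q)) (mxmeas_cst _ _))) mu').
have mb : measurable_fun setT b := mosc (gavg Q B) (invmx (UQ Q)) mv (hB Q).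
have ms : measurable_fun setT s.
  by apply: measurable_opnorm; exact: (mxmeasM mv (mxmeas_cst _ _)).
have f10 y : 0 <= f1 y := opnorm_ge0 _.
have f20 y : 0 <= f2 y := opnorm_ge0 _.
have b0 x : 0 <= b x := opnorm_ge0 _.
have s0 x : 0 <= s x := opnorm_ge0 _.
have hf1 : avgLe Q q f1 K := tw_UQ_u' tw Q.
have hf2 : avgLe Q q f2 X := hc Q.
have hb' : avgLe Q p b X := hb Q.
have hs : avgLe Q p s K := tw_v_WQ tw Q.
have split_le x y : opnorm (v x *m (B x - B y) *m u' y) <= b x * f1 y + s x * f2 y.
  have -> : v x *m (B x - B y) *m u' y =
      v x *m (B x - gavg Q B) *m invmx (UQ Q) *m (UQ Q *m u' y) -
      v x *m WQ Q *m (invmx (WQ Q) *m (B y - gavg Q B) *m u' y).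
    have gen (a y1 y2 iU U1 W1 iW w : 'M[R[i]]_n) : iU *m U1 = 1%:M -> W1 *m iW = 1%:M ->
        a *m (y1 - y2) *m w = a *m y1 *m iU *m (U1 *m w) - a *m W1 *m (iW *m y2 *m w).
      move=> h1 h2; rewrite !mulmxA -(mulmxA (a *m y1) iU) h1 -(mulmxA a W1) h2 !mulmx1.
      by rewrite mulmxBr mulmxBl.
    have h := gen (v x) (B x - gavg Q B) (B y - gavg Q B) _ _ _ _ (u' y)
      (mulVmx (tw_UQ tw Q)) (mulmxV (tw_WQ tw Q)).
    by rewrite -h opprB addrA subrK.
  apply: (le_trans (opnormD _ _)); rewrite opnormN.
  by apply: lerD; exact: opnormM.
clearbody f1 f2 b s.
have mt : measurable_fun setT (fun x => 4 * (K * b x + X * s x)).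
  apply: (measurable_funM (measurable_cst _)); apply: measurable_funD.
    exact: (measurable_funM (measurable_cst _) mb).
  exact: (measurable_funM (measurable_cst _) ms).
have t0 x : 0 <= 4 * (K * b x + X * s x) by rewrite mulr_ge0// addr_ge0// mulr_ge0.
have hI x : (avg Q (fun y => (opnorm (v x *m (B x - B y) *m u' y) `^ q)%:E) <=
    ((4 * (K * b x + X * s x)) `^ q)%:E)%E.
  have h1 := avgLeZ (b0 x) m1 f10 K0' hf1.
  have h2 := avgLeZ (s0 x) m2 f20 X0 hf2.
  have m1' := measurable_funM (measurable_cst (b x)) m1.
  have m2' := measurable_funM (measurable_cst (s x)) m2.
  have := avgLeD q1 m1' m2' (fun y => mulr_ge0 (b0 x) (f10 y))
    (fun y => mulr_ge0 (s0 x) (f20 y)) (mulr_ge0 (b0 x) K0') (mulr_ge0 (s0 x) X0) h1 h2.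
  rewrite (mulrC (b x) K) (mulrC (s x) X).
  apply: (avgLe_le q0 (mslice x (hB Q)) (measurable_funD m1' m2') (fun=> opnorm_ge0 _)).
    by move=> y; exact: addr_ge0 (mulr_ge0 (b0 x) (f10 y)) (mulr_ge0 (s0 x) (f20 y)).
  by move=> y; exact: split_le.
apply: (@le_trans _ _ (avg Q (fun x => ((4 * (K * b x + X * s x)) `^ p)%:E))).
  apply: (avg_le _ (measurable_double (hB Q)) (measurable_powR_EFin p mt)
    (fun=> poweR_ge0 _ _) (powR_EFin_ge0 _ _)) => x.
  rewrite -(poweR_powR (t0 x)); apply: (lee_poweR _ _ (hI x)).
    by rewrite divr_ge0 ?ltW.
  by apply: avg_ge0 => y; rewrite lee_fin powR_ge0.
have h1 := avgLeZ K0' mb b0 X0 hb'.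
have h2 := avgLeZ X0 ms s0 K0' hs.
have m1' := measurable_funM (measurable_cst K) mb.
have m2' := measurable_funM (measurable_cst X) ms.
have h3 := avgLeD (ltW p1) m1' m2' (fun x => mulr_ge0 K0' (b0 x))
  (fun x => mulr_ge0 X0 (s0 x)) (mulr_ge0 K0' X0) (mulr_ge0 X0 K0') h1 h2.
have n4 : 0 <= 4 :> R by rewrite ler0n.
have Y0 : 0 <= 4 * (K * X + X * K) by rewrite mulr_ge0// addr_ge0// mulr_ge0.
have := avgLeZ n4 (measurable_funD m1' m2')
  (fun x => addr_ge0 (mulr_ge0 K0' (b0 x)) (mulr_ge0 X0 (s0 x))) Y0 h3.
(* each of the two triangle inequalities, in y and in x, costs a factor 4 *)
by rewrite /avgLe (_ : 4 * (4 * (K * X + X * K)) = 32 * K * X)//; ring.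
Qed.

End oscillations.

(** * Duality for matrix A_p weights *)

Section weights.
Context (R : realType) (d n : nat).
Local Notation mu := (leb R d).
Local Notation mxfun := (euclid R d -> 'M[R[i]]_n).
Implicit Types (Q : cube R d) (W w : mxfun) (M : 'M[R[i]]_n).

Lemma posdef_adj M : posdef M -> M ^t* = M.
Proof. by case=> /is_hermitianmxP + _; rewrite expr0 scale1r => {2}->. Qed.

(** M is its own first power, which has M^-1 as inverse power. *)
Lemma posdef_unitmx M : posdef M -> M \in unitmx.
Proof.
move=> pM; have pow1 : mxpow M 1 = M.
  by rewrite mxpowE -[RHS](fcalc_id pM); apply: eq_fcalc => // t /ltW t0; rewrite powRr1.
by have := mxpowNK 1 pM; rewrite pow1 => /mulmx1_unit[].
Qed.

Lemma posdef1 : posdef (1%:M : 'M[R[i]]_n).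
Proof.
split.
  by apply/is_hermitianmxP; rewrite expr0 scale1r trmx1 map_mx1.
move=> v v0; rewrite mulmx1 mxE.
have E j : (v ^t*) 0 j * v j 0 = `|v j 0| ^+ 2 by rewrite adjE -normCKC.
rewrite (eq_bigr _ (fun j _ => E j)) lt_def sumr_ge0 ?andbT => [|j _]; last first.
  by rewrite exprn_ge0.
apply: contra v0; rewrite psumr_eq0 => [/allP v0|j _]; last by rewrite exprn_ge0.
apply/eqP/colP => j; have := v0 j (mem_index_enum j).
by rewrite mxE sqrf_eq0 normr_eq0 => /eqP.
Qed.

(** A weight is positive definite only almost everywhere; it is replaced by the
identity on the exceptional set, which completeness of the measure permits. *)
Lemma weight_mxmeas_mxpow W s : matrix_weight W -> mxmeas (fun x => mxpow (W x) s).
Proof.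
move=> [mW pW]; pose W1 x := if `[< posdef (W x) >] then W x else 1%:M.
have E : {ae mu, forall x, W x = W1 x}.
  by apply: filterS pW => x pWx; rewrite /W1 asboolT.
have p1 x : posdef (W1 x).
  by rewrite /W1; case: asboolP => // _; exact: posdef1.
have m1 : mxmeas W1 by exact: ae_mxmeas E mW.
apply: ae_mxmeas (mxmeas_mxpow p1 m1 s).
by apply: filterS E => x ->.
Qed.

Lemma weight_dual_pair W s : matrix_weight W ->
  dual_pair (fun x => mxpow (W x) s) (fun x => mxpow (W x) (- s)).
Proof.
move=> hW; split.
- exact: weight_mxmeas_mxpow.
- exact: weight_mxmeas_mxpow.
- by move=> x; exact: mxpow_adj.
- by move=> x; exact: mxpow_adj.
- by case: hW => _; apply: filterS => x pWx; exact: mxpowNK.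
Qed.

Lemma reducing_reduces (c r s : R) W (M : cube R d -> 'M[R[i]]_n) :
  reducing c r s W M -> forall Q, reduces c r (fun x => mxpow (W x) s) Q (M Q).
Proof.
by move=> h Q; have [pM hM] := h Q; split; [exact: posdef_adj|exact: posdef_unitmx|].
Qed.

Lemma Ap_char_ApLe (p q : R) W : (Ap_char p q W < +oo)%E ->
  exists2 K : R, 0 <= K & forall Q,
    ApLe p q (fun x => mxpow (W x) p^-1) (fun x => mxpow (W x) (- p^-1)) Q K.
Proof.
move=> hoo; exists (fine (Ap_char p q W)).
  rewrite fine_ge0//; apply: le_trans (ereal_sup_ubound (imageT _ (Cube (fun=> 0) ltr01))).
  by apply: avg_ge0 => x; exact: poweR_ge0.
move=> Q; have le : ((avg Q (fun x => (avg Q (fun y =>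
      (opnorm (mxpow (W x) p^-1 *m mxpow (W y) (- p^-1)) `^ q)%:E)) `^ (p / q)))
      <= Ap_char p q W)%E by exact: (ereal_sup_ubound (imageT _ Q)).
rewrite /ApLe fineK// ge0_fin_numE//; apply: le_trans le.
by apply: avg_ge0 => x; exact: poweR_ge0.
Qed.

Lemma opnorm_adj3 (A D E : 'M[R[i]]_n) : A ^t* = A -> E ^t* = E ->
  opnorm (E *m D ^t* *m A) = opnorm (A *m D *m E).
Proof. by move=> hA hE; rewrite -(opnorm_adj (A *m D *m E)) !adjM hA hE mulmxA. Qed.

Lemma avgLe_opnorm_swap Q r w M X : (forall x, (w x) ^t* = w x) -> M ^t* = M ->
  avgLe Q r (fun x => opnorm (w x *m M)) X -> avgLe Q r (fun x => opnorm (M *m w x)) X.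
Proof.
move=> hw hM h.
have E : (fun x => opnorm (M *m w x)) = (fun x => opnorm (w x *m M)).
  by apply/funext => x; exact: opnorm_swap.
rewrite E; exact: h.
Qed.

Lemma avg_le_scale Q (k X : R) (f g : euclid R d -> R) : measurable_fun setT f ->
  measurable_fun setT g -> (forall x, 0 <= f x) -> (forall x, 0 <= g x) -> 0 <= k ->
  (forall x, f x <= k * g x) -> (avg Q (fun x => (g x)%:E) <= X%:E)%E ->
  (avg Q (fun x => (f x)%:E) <= (k * X)%:E)%E.
Proof.
move=> mf mg f0 g0 k0 fg hX.
have gE0 x : (0 <= (g x)%:E)%E by rewrite lee_fin.
have mgE : measurable_fun setT (fun x => (g x)%:E) by apply/measurable_EFinP.
have kE : (0 <= k%:E)%E by rewrite lee_fin.
rewrite EFinM; apply: le_trans (lee_wpmul2l kE hX).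
rewrite -(avgZ _ mgE gE0 kE); apply: avg_le.
- by apply/measurable_EFinP.
- exact: measurable_funeM.
- by move=> x; rewrite lee_fin.
- by move=> x; rewrite -EFinM lee_fin mulr_ge0.
- by move=> x; rewrite -EFinM lee_fin.
Qed.

End weights.

Section duality.
Context (R : realType) (d n : nat).
Local Notation mu := (leb R d).
Local Notation mxfun := (euclid R d -> 'M[R[i]]_n).
Variables (c KU KV p q : R) (v v' u u' : mxfun) (rU rV rV' : cube R d -> 'M[R[i]]_n).
Hypotheses (p1 : 1 < p) (pq : p^-1 + q^-1 = 1) (c0 : 0 < c).
Hypotheses (vv' : dual_pair v v') (uu' : dual_pair u u').
Hypotheses (KU0 : 0 <= KU) (KV0 : 0 <= KV).
Hypotheses (hKU : forall Q, ApLe p q u u' Q KU) (hKV : forall Q, ApLe p q v v' Q KV).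
Hypotheses (hU : forall Q, reduces c p u Q (rU Q)).
Hypotheses (hV : forall Q, reduces c p v Q (rV Q)).
Hypotheses (hV' : forall Q, reduces c q v' Q (rV' Q)).

(** One constant that dominates all the bounds of two_weight. *)
Definition Ktw : R := 1 + (Kred n c p + Kred n c q + KAp n c p KU + KAp n c p KV +
  Kprod n c p q KV * Kred n c p).

Let p0 : 0 < p. Proof. exact: lt_trans p1. Qed.
Let q1 : 1 < q. Proof. exact: conjugate_gt1 p1 pq. Qed.

Let kr r : 0 <= Kred n c r. Proof. exact: Kred_ge0. Qed.
Let ku : 0 <= KAp n c p KU. Proof. exact: KAp_ge0. Qed.
Let kv : 0 <= KAp n c p KV. Proof. exact: KAp_ge0. Qed.
Let kp : 0 <= Kprod n c p q KV. Proof. exact: Kprod_ge0. Qed.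

Let kpr : 0 <= Kprod n c p q KV * Kred n c p. Proof. exact: mulr_ge0 kp (kr p). Qed.

Lemma Ktw_gt0 : 0 < Ktw.
Proof. by apply: ltr_pwDl => //; rewrite !addr_ge0. Qed.

Let mono (Q : cube R d) (r : R) (f : euclid R d -> R) (Y : R) :
  0 < r -> 0 <= Y -> Y <= Ktw -> avgLe Q r f Y -> avgLe Q r f Ktw.
Proof. exact: avgLe_mono. Qed.

Let rU_adj Q : (rU Q) ^t* = rU Q. Proof. by case: (hU Q). Qed.
Let rU_unit Q : rU Q \in unitmx. Proof. by case: (hU Q). Qed.
Let rV_adj Q : (rV Q) ^t* = rV Q. Proof. by case: (hV Q). Qed.
Let rV_unit Q : rV Q \in unitmx. Proof. by case: (hV Q). Qed.
Let rV'_adj Q : (rV' Q) ^t* = rV' Q. Proof. by case: (hV' Q). Qed.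
Let rV'_unit Q : rV' Q \in unitmx. Proof. by case: (hV' Q). Qed.
Let q0 : 0 < q. Proof. exact: lt_trans q1. Qed.

Let bounds : [/\ Kred n c p <= Ktw, Kred n c q <= Ktw, KAp n c p KU <= Ktw,
  KAp n c p KV <= Ktw & Kprod n c p q KV * Kred n c p <= Ktw].
Proof.
by rewrite /Ktw; have := kr p; have := kr q; have := ku; have := kv; have := kpr; split; lra.
Qed.
Let le1 := let: And5 h _ _ _ _ := bounds in h.
Let le2 := let: And5 _ h _ _ _ := bounds in h.
Let le3 := let: And5 _ _ h _ _ := bounds in h.
Let le4 := let: And5 _ _ _ h _ := bounds in h.
Let le5 := let: And5 _ _ _ _ h := bounds in h.

Let v_rV Q : avgLe Q p (fun x => opnorm (v x *m invmx (rV Q))) Ktw.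
Proof. exact: mono p0 (kr p) le1 (avg_reduced c0 (ltW p1) (dp_meas vv') (hV Q)). Qed.
Let u_rU Q : avgLe Q p (fun x => opnorm (u x *m invmx (rU Q))) Ktw.
Proof. exact: mono p0 (kr p) le1 (avg_reduced c0 (ltW p1) (dp_meas uu') (hU Q)). Qed.
Let v'_rV' Q : avgLe Q q (fun x => opnorm (v' x *m invmx (rV' Q))) Ktw.
Proof. exact: mono q0 (kr q) le2 (avg_reduced c0 (ltW q1) (dp_meas' vv') (hV' Q)). Qed.
Let v'_rV Q : avgLe Q q (fun x => opnorm (v' x *m rV Q)) Ktw.
Proof. exact: mono q0 kv le4 (Ap_dual c0 p1 pq vv' KV0 (hKV Q) (hV Q)). Qed.
Let u'_rU Q : avgLe Q q (fun x => opnorm (u' x *m rU Q)) Ktw.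
Proof. exact: mono q0 ku le3 (Ap_dual c0 p1 pq uu' KU0 (hKU Q) (hU Q)). Qed.
Let v_rV' Q : avgLe Q p (fun x => opnorm (v x *m rV' Q)) Ktw.
Proof. exact: mono p0 kpr le5 (avg_reduced_dual c0 p1 pq vv' KV0 (hKV Q) (hV Q) (hV' Q)). Qed.

Lemma two_weight_direct : two_weight c Ktw p q v v' u u' rV rU rV'.
Proof.
apply: (TwoWeight vv' uu' rV_unit rU_unit rV'_unit v_rV _ u_rU _ v_rV').
- move=> Q; exact: (avgLe_opnorm_swap (dp_adj' vv') (rV_adj Q) (v'_rV Q)).
- move=> Q; exact: (avgLe_opnorm_swap (dp_adj' uu') (rU_adj Q) (u'_rU Q)).
- by move=> Q e; have [_ _ /(_ e)[]] := hU Q.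
Qed.

(** Up to adjoints, the bounds for the dual data are the bounds used for the direct ones:
the A_p condition of U says that rU^-1 acts as a reducing matrix for u' (lemma Ap_dual),
and rV' is one for v' by hypothesis. *)
Lemma two_weight_dual :
  two_weight c Ktw q p u' u v' v (fun Q => invmx (rU Q)) rV' rU.
Proof.
apply: (TwoWeight (dual_pairC uu') (dual_pairC vv') _ rV'_unit rU_unit _ _ v'_rV' _ u'_rU).
- by move=> Q; rewrite unitmx_inv.
- move=> Q; rewrite invmxK; exact: u'_rU.
- move=> Q; exact: (avgLe_opnorm_swap (dp_adj uu') (inv_adj (rU_unit Q) (rU_adj Q)) (u_rU Q)).
- move=> Q; exact: (avgLe_opnorm_swap (dp_adj vv') (rV'_adj Q) (v_rV' Q)).
- by move=> Q e; have [_ _ /(_ e)[]] := hV' Q.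
Qed.

End duality.

(** * Equivalence of the oscillation norms *)

Section comparisons.
Context (R : realType) (d n : nat).
Local Notation mu := (leb R d).
Local Notation mxfun := (euclid R d -> 'M[R[i]]_n).
Implicit Types (Q : cube R d) (B : mxfun) (F : cube R d -> \bar R).

Lemma sup_cube_le F (X : \bar R) : (sup_cube F <= X)%E <-> forall Q, (F Q <= X)%E.
Proof.
split=> [h Q|h]; first by apply: le_trans h; exact: (ereal_sup_ubound (imageT _ Q)).
by apply: ge_ereal_sup => _ [Q _ <-].
Qed.

Lemma sup_cube_ge0 F : (forall Q, 0 <= F Q)%E -> (0 <= sup_cube F)%E.
Proof.
move=> F0; apply: le_trans (F0 (Cube (fun=> 0) ltr01)) _.
exact: (ereal_sup_ubound (imageT _ _)).
Qed.

Lemma poweR_invr_le (a : \bar R) (r X : R) : 0 < r -> 0 <= X -> (0 <= a)%E ->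
  (a `^ r^-1 <= X%:E)%E <-> (a <= (X `^ r)%:E)%E.
Proof.
move=> r0 X0; case: a => [a| |]// a0; last first.
  by rewrite poweRyr ?gt_eqF ?invr_gt0//; split; rewrite leye_eq.
rewrite lee_fin in a0; rewrite poweR_EFin !lee_fin; split=> h.
  have := ge0_ler_powR (ltW r0) _ _ h; rewrite !nnegrE powR_ge0 => /(_ isT X0).
  by rewrite -powRrM mulVf ?gt_eqF// powRr1.
have r0' : 0 <= r^-1 by rewrite invr_ge0 ltW.
have := ge0_ler_powR r0' _ _ h; rewrite !nnegrE powR_ge0 => /(_ a0 isT).
by rewrite -powRrM mulfV ?gt_eqF// powRr1.
Qed.

Lemma sup_cube_poweR_le F (r X : R) : 0 < r -> 0 <= X -> (forall Q, 0 <= F Q)%E ->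
  (sup_cube (fun Q => F Q `^ r^-1) <= X%:E)%E <-> forall Q, (F Q <= (X `^ r)%:E)%E.
Proof.
move=> r0 X0 F0; apply: iff_trans (sup_cube_le _ _) _.
by split=> h Q; apply/(poweR_invr_le r0 X0 (F0 Q)); exact: h.
Qed.

(** Comparison at finite positive levels only: it suffices since y is the infimum
of the positive reals above it, and an infinite y is trivial. *)
Lemma le_mul_of_bounds (C : R) (x y : \bar R) : 0 < C -> (0 <= y)%E ->
  (forall X : R, 0 < X -> (y <= X%:E)%E -> (x <= (C * X)%:E)%E) -> (x <= C%:E * y)%E.
Proof.
move=> C0; case: y => [y| |]// y0 h; last by rewrite gt0_muley ?lte_fin// leey.
rewrite lee_fin in y0; apply/lee_addgt0Pr => e e0.
have := h (y + e / C); rewrite lee_fin lerDl mulrDr (mulrCA C) mulfV ?gt_eqF// mulr1.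
rewrite -EFinM -EFinD; apply; last by rewrite divr_ge0 ?ltW.
by rewrite ltr_wpDl// divr_gt0.
Qed.

(** Domination up to a constant, tested at finite positive levels; this is
transitive without arithmetic of infinite values. *)
Definition controls (F G : mxfun -> \bar R) : Prop := exists2 C : R, 0 < C &
  forall B, (forall Q, mxinteg Q B) -> forall X : R, 0 < X ->
    (F B <= X%:E)%E -> (G B <= (C * X)%:E)%E.

Lemma controls_trans (F G H : mxfun -> \bar R) : controls F G -> controls G H -> controls F H.
Proof.
move=> [C C0 hFG] [D D0 hGH]; exists (D * C) => [|B hB X X0 hX]; first exact: mulr_gt0.
by rewrite -mulrA; apply: hGH; rewrite ?mulr_gt0//; exact: hFG.
Qed.

End comparisons.

Section quantities.
Context (R : realType) (d n : nat).
Local Notation mu := (leb R d).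
Local Notation mxfun := (euclid R d -> 'M[R[i]]_n).
Variables (p q : R) (U V : mxfun) (rU rV rV' : cube R d -> 'M[R[i]]_n).
Hypotheses (p0 : 0 < p) (q0 : 0 < q).
Implicit Types (B : mxfun) (X : R).

Let v x := mxpow (V x) p^-1.
Let v' x := mxpow (V x) (- p^-1).
Let u x := mxpow (U x) p^-1.
Let u' x := mxpow (U x) (- p^-1).
Let adj B : mxfun := fun x => (B x) ^t*.

Lemma bmo_aP B X : (bmo_a rU rV B <= X%:E)%E <-> osc_reduced rV rU B X.
Proof. exact: sup_cube_le. Qed.

Lemma bmo_bP B X : 0 <= X -> (bmo_b p V rU B <= X%:E)%E <-> osc_mean p v rU B X.
Proof.
move=> X0; apply: sup_cube_poweR_le => // Q.
by apply: avg_ge0 => x; rewrite lee_fin powR_ge0.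
Qed.

Lemma bmo_cP B X : 0 <= X -> (bmo_c p q U rV' B <= X%:E)%E <-> osc_mean q u' rV' (adj B) X.
Proof.
move=> X0; apply: sup_cube_poweR_le => // Q.
by apply: avg_ge0 => x; rewrite lee_fin powR_ge0.
Qed.

Lemma bmo_dP B X : 0 <= X -> (bmo_d p q U V B <= X%:E)%E <-> osc_double p q v u' B X.
Proof.
move=> X0; apply: sup_cube_poweR_le => // Q.
by apply: avg_ge0 => x; exact: poweR_ge0.
Qed.

Lemma opnorm_adjB (A D D' E : 'M[R[i]]_n) : A ^t* = A -> E ^t* = E ->
  opnorm (A *m (D - D') *m E) = opnorm (E *m (D' ^t* - D ^t* ) *m A).
Proof.
move=> hA hE; rewrite -(opnorm_adj3 (D - D') hA hE) adjB.
rewrite -(opnormN (E *m (D ^t* - D' ^t* ) *m A)) -mulNmx -mulmxN opprB.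
reflexivity.
Qed.

(** Taking adjoints turns the integrand of e) into that of d) for the dual data; the
variable of the outer mean is then the first one. *)
Lemma bmo_eP B X : 0 <= X -> (bmo_e p q U V B <= X%:E)%E <-> osc_double q p u' v (adj B) X.
Proof.
move=> X0.
have E Q : avg Q (fun y => (avg Q (fun x =>
      (opnorm (mxpow (V x) p^-1 *m (B x - B y) *m mxpow (U y) (- p^-1)) `^ p)%:E)) `^ (q / p))%E =
    avg Q (fun x => (avg Q (fun y =>
      (opnorm (u' x *m (adj B x - adj B y) *m v y) `^ p)%:E)) `^ (q / p))%E.
  apply: (f_equal (avg Q)); apply/funext => y.
  apply: (f_equal (fun a => a `^ (q / p))%E).
  apply: (f_equal (avg Q)); apply/funext => x.
  exact: (f_equal (fun t : R => (t `^ p)%:E)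
    (opnorm_adjB (B x) (B y) (mxpow_adj (V x) p^-1) (mxpow_adj (U y) (- p^-1)))).
rewrite /osc_double; under eq_forall do rewrite -E.
apply: sup_cube_poweR_le => // Q.
by apply: avg_ge0 => x; exact: poweR_ge0.
Qed.

End quantities.

Section equivalence.
Context (R : realType) (d n : nat).
Local Notation mu := (leb R d).
Local Notation mxfun := (euclid R d -> 'M[R[i]]_n).
Implicit Types (Q : cube R d) (x : euclid R d) (B : mxfun) (X : R).
Variables (c K KP KI p q : R) (U V : mxfun) (rU rV rV' : cube R d -> 'M[R[i]]_n).
Let v x := mxpow (V x) p^-1.
Let v' x := mxpow (V x) (- p^-1).
Let u x := mxpow (U x) p^-1.
Let u' x := mxpow (U x) (- p^-1).
Let adj (B : mxfun) : mxfun := fun x => (B x) ^t*.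
Hypotheses (p1 : 1 < p) (q1 : 1 < q) (pq : p^-1 + q^-1 = 1) (c0 : 0 < c) (K0 : 0 < K).
Hypotheses (tw1 : two_weight c K p q v v' u u' rV rU rV').
Hypotheses (tw2 : two_weight c K q p u' u v' v (fun Q => invmx (rU Q)) rV' rU).
Hypotheses (rU_adj : forall Q, (rU Q) ^t* = rU Q) (rV_adj : forall Q, (rV Q) ^t* = rV Q)
  (rV'_adj : forall Q, (rV' Q) ^t* = rV' Q).
Hypotheses (KP0 : 0 < KP) (hKP : forall Q, opnorm (rV' Q *m rV Q) <= KP).
Hypotheses (KI0 : 0 < KI) (hKI : forall Q, opnorm (invmx (rV' Q) *m invmx (rV Q)) <= KI).

Let p0 : 0 < p. Proof. exact: lt_trans p1. Qed.
Let q0 : 0 < q. Proof. exact: lt_trans q1. Qed.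
Let qp : q^-1 + p^-1 = 1. Proof. by rewrite addrC. Qed.
Let irU_adj Q : (invmx (rU Q)) ^t* = invmx (rU Q).
Proof. exact: inv_adj (tw_UQ tw1 Q) (rU_adj Q). Qed.
Let irV'_adj Q : (invmx (rV' Q)) ^t* = invmx (rV' Q).
Proof. exact: inv_adj (tw_WQ tw1 Q) (rV'_adj Q). Qed.
Let v_adj x : (v x) ^t* = v x. Proof. exact: mxpow_adj. Qed.
Let u'_adj x : (u' x) ^t* = u' x. Proof. exact: mxpow_adj. Qed.
Let adjI B : (forall Q, mxinteg Q B) -> forall Q, mxinteg Q (adj B).
Proof. move=> hB Q; exact: mxinteg_adj (hB Q). Qed.
Let adj_osc B : (forall Q, mxinteg Q B) -> forall Q x,
  adj B x - gavg Q (adj B) = (B x - gavg Q B) ^t*.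
Proof. by move=> hB Q x; rewrite /adj (gavg_adj (hB Q)) adjB. Qed.

Let mred B Q (S T : 'M[R[i]]_n) : mxinteg Q B ->
  measurable_fun setT (fun x => opnorm (S *m (B x - gavg Q B) *m T)).
Proof.
move=> hB; apply: measurable_opnorm.
exact: (mxmeasM (mxmeasM (mxmeas_cst _ S) (mxmeasB (mxinteg_meas hB) (mxmeas_cst _ _)))
  (mxmeas_cst _ T)).
Qed.

(** Up to the adjoint, the dual integrand is
rV'^-1 (B - m) rU^-1 = (rV'^-1 rV^-1) rV (B - m) rU^-1. *)
Lemma osc_reduced_dual B X : (forall Q, mxinteg Q B) -> 0 <= X ->
  osc_reduced rV rU B X -> osc_reduced (fun Q => invmx (rU Q)) rV' (adj B) (KI * X).
Proof.
move=> hB X0 hX Q; have hB' := adjI hB.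
apply: (avg_le_scale (mred _ _ (hB' Q)) (mred _ _ (hB Q)) (fun=> opnorm_ge0 _)
  (fun=> opnorm_ge0 _) (ltW KI0) _ (hX Q)) => x.
rewrite (adj_osc hB) (opnorm_adj3 _ (irV'_adj Q) (irU_adj Q)).
move: (B x - gavg Q B) => D.
have -> : invmx (rV' Q) *m D *m invmx (rU Q) =
    invmx (rV' Q) *m invmx (rV Q) *m (rV Q *m D *m invmx (rU Q)).
  rewrite !mulmxA -(mulmxA (invmx (rV' Q)) (invmx (rV Q))) (mulVmx (tw_VQ tw1 Q)).
  by rewrite mulmx1.
apply: (le_trans (opnormM _ _)); exact: (ler_wpM2r (opnorm_ge0 _) (hKI Q)).
Qed.

(** The converse, with the factor rV' rV. *)
Lemma osc_reduced_direct B X : (forall Q, mxinteg Q B) -> 0 <= X ->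
  osc_reduced (fun Q => invmx (rU Q)) rV' (adj B) X -> osc_reduced rV rU B (KP * X).
Proof.
move=> hB X0 hX Q; have hB' := adjI hB.
apply: (avg_le_scale (mred _ _ (hB Q)) (mred _ _ (hB' Q)) (fun=> opnorm_ge0 _)
  (fun=> opnorm_ge0 _) (ltW KP0) _ (hX Q)) => x.
rewrite (adj_osc hB) -(opnorm_adj3 (B x - gavg Q B) (rV_adj Q) (irU_adj Q)).
move: ((B x - gavg Q B) ^t*) => D.
have -> : invmx (rU Q) *m D *m rV Q =
    invmx (rU Q) *m D *m invmx (rV' Q) *m (rV' Q *m rV Q).
  rewrite !mulmxA -(mulmxA _ (invmx (rV' Q)) (rV' Q)) (mulVmx (tw_WQ tw1 Q)).
  by rewrite mulmx1.
apply: (le_trans (opnormM _ _)); rewrite mulrC; exact: (ler_wpM2r (opnorm_ge0 _) (hKP Q)).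
Qed.

Let a : mxfun -> \bar R := bmo_a rU rV.
Let b : mxfun -> \bar R := bmo_b p V rU.
Let c_ : mxfun -> \bar R := bmo_c p q U rV'.
Let d_ : mxfun -> \bar R := bmo_d p q U V.
Let e : mxfun -> \bar R := bmo_e p q U V.

Lemma a_controls_b : controls a b.
Proof.
have [C C0 h] := osc_mean_of_reduced p1 q0 pq c0 K0 tw1.
exists C => // B hB X X0 /bmo_aP hX; apply/(bmo_bP _ _ p0); first by rewrite mulr_ge0 ?ltW.
exact: h.
Qed.

Lemma b_controls_a : controls b a.
Proof.
exists K => // B hB X X0 /(bmo_bP _ _ p0 _ (ltW X0)) hX; apply/bmo_aP.
exact: (osc_reduced_of_mean p1 q0 pq K0 tw1 hB (ltW X0) hX).
Qed.

Lemma a_controls_c : controls a c_.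
Proof.
have [C C0 h] := osc_mean_of_reduced q1 p0 qp c0 K0 tw2.
exists (C * KI) => [|B hB X X0 /bmo_aP hX]; first exact: mulr_gt0.
have CX : 0 <= C * KI * X by rewrite !mulr_ge0 ?ltW.
apply/(bmo_cP _ _ _ q0 _ CX); rewrite -mulrA; apply: (h _ (adjI hB)); first exact: mulr_gt0.
exact: (osc_reduced_dual hB (ltW X0) hX).
Qed.

Lemma c_controls_a : controls c_ a.
Proof.
exists (KP * K) => [|B hB X X0 /(bmo_cP _ _ _ q0 _ (ltW X0)) hX]; first exact: mulr_gt0.
have KX : 0 <= K * X by rewrite mulr_ge0 ?ltW.
apply/bmo_aP; rewrite -mulrA; apply: (osc_reduced_direct hB KX).
exact: (osc_reduced_of_mean q1 p0 qp K0 tw2 (adjI hB) (ltW X0) hX).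
Qed.

Lemma d_controls_b : controls d_ b.
Proof.
exists K => // B hB X X0 /(bmo_dP _ _ _ p0 _ (ltW X0)) hX.
have KX : 0 <= K * X by rewrite mulr_ge0 ?ltW.
apply/(bmo_bP _ _ p0 _ KX).
exact: (osc_mean_of_double p1 q0 pq K0 tw1 hB (ltW X0) hX).
Qed.

Lemma e_controls_c : controls e c_.
Proof.
exists K => // B hB X X0 /(bmo_eP _ _ _ q0 _ (ltW X0)) hX.
have KX : 0 <= K * X by rewrite mulr_ge0 ?ltW.
apply/(bmo_cP _ _ _ q0 _ KX).
exact: (osc_mean_of_double q1 p0 qp K0 tw2 (adjI hB) (ltW X0) hX).
Qed.

Let both : exists2 C : R, 0 < C & forall B, (forall Q, mxinteg Q B) -> forall X, 0 < X ->
  osc_reduced rV rU B X ->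
  osc_mean p v rU B (C * X) /\ osc_mean q u' rV' (adj B) (C * X).
Proof.
have [C C0 h] := a_controls_b; have [D D0 h'] := a_controls_c.
exists (C + D) => [|B hB X X0 hX]; first exact: addr_gt0.
have CX : 0 <= C * X by rewrite mulr_ge0 ?ltW.
have DX : 0 <= D * X by rewrite mulr_ge0 ?ltW.
have CD : 0 <= (C + D) * X by rewrite mulrDl addr_ge0.
have le1 : ((C * X)%:E <= ((C + D) * X)%:E)%E by rewrite lee_fin mulrDl lerDl.
have le2 : ((D * X)%:E <= ((C + D) * X)%:E)%E by rewrite lee_fin mulrDl lerDr.
have ha : (a B <= X%:E)%E by apply/bmo_aP.
split.
  by apply/(bmo_bP _ _ p0 _ CD); apply: le_trans (h B hB X X0 ha) le1.
by apply/(bmo_cP _ _ _ q0 _ CD); apply: le_trans (h' B hB X X0 ha) le2.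
Qed.

Lemma a_controls_d : controls a d_.
Proof.
have [C C0 h] := both.
exists (32 * K * C) => [|B hB X X0 /bmo_aP hX]; first by rewrite !mulr_gt0.
have CX : 0 <= C * X by rewrite mulr_ge0 ?ltW.
have [hb hc] := h B hB X X0 hX.
have KX : 0 <= 32 * K * C * X by rewrite !mulr_ge0 ?ltW.
apply/(bmo_dP _ _ _ p0 _ KX); rewrite -mulrA.
apply: (osc_double_of_means p1 q0 pq K0 tw1 hB CX hb) => Q.
have E y : opnorm (invmx (rV' Q) *m (B y - gavg Q B) *m u' y) =
    opnorm (u' y *m (adj B y - gavg Q (adj B)) *m invmx (rV' Q)).
  by rewrite (adj_osc hB) (opnorm_adj3 _ (irV'_adj Q) (u'_adj y)).
by rewrite (funext E); exact: hc.
Qed.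

Lemma a_controls_e : controls a e.
Proof.
have [C C0 h] := both.
exists (32 * K * C) => [|B hB X X0 /bmo_aP hX]; first by rewrite !mulr_gt0.
have CX : 0 <= C * X by rewrite mulr_ge0 ?ltW.
have [hb hc] := h B hB X X0 hX.
have KX : 0 <= 32 * K * C * X by rewrite !mulr_ge0 ?ltW.
apply/(bmo_eP _ _ _ q0 _ KX); rewrite -mulrA.
apply: (osc_double_of_means q1 p0 qp K0 tw2 (adjI hB) CX hc) => Q.
have E y : opnorm (invmx (rU Q) *m (adj B y - gavg Q (adj B)) *m v y) =
    opnorm (v y *m (B y - gavg Q B) *m invmx (rU Q)).
  by rewrite (adj_osc hB) (opnorm_adj3 _ (v_adj y) (irU_adj Q)).
by rewrite (funext E); exact: hb.
Qed.

Lemma bmo_ge0 B : [/\ 0 <= a B, 0 <= b B, 0 <= c_ B, 0 <= d_ B & 0 <= e B]%E.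
Proof.
split; apply: sup_cube_ge0 => Q; try exact: poweR_ge0.
by apply: avg_ge0 => x; rewrite lee_fin opnorm_ge0.
Qed.

(** Every quantity is compared with a), in both directions. *)
Lemma bmo_equivalent : exists2 C : R, 0 < C &
  forall B, (forall Q, mxinteg Q B) ->
    {in [:: a B; b B; c_ B; d_ B; e B] &, forall x y : \bar R, (x <= C%:E * y)%E}.
Proof.
have ba := b_controls_a; have ca := c_controls_a.
have da := controls_trans d_controls_b ba; have ea := controls_trans e_controls_c ca.
have [Cb Cb0 hb] := a_controls_b; have [Cc Cc0 hc] := a_controls_c.
have [Cd Cd0 hd] := a_controls_d; have [Ce Ce0 he] := a_controls_e.
have [Db Db0 kb] := ba; have [Dc Dc0 kc] := ca.
have [Dd Dd0 kd] := da; have [De De0 ke] := ea.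
pose C := 1 + (Cb + Cc + Cd + Ce); pose D := 1 + (Db + Dc + Dd + De).
have C0 : 0 < C by rewrite /C; lra.
have D0 : 0 < D by rewrite /D; lra.
have up (r s X : R) (z : \bar R) : 0 < X -> r <= s -> (z <= (r * X)%:E)%E -> (z <= (s * X)%:E)%E.
  by move=> X0 rs h; apply: (le_trans h); rewrite lee_fin ler_wpM2r ?(ltW X0).
exists (C * D) => [|B hB x y]; first exact: mulr_gt0.
have from_a z : z \in [:: a B; b B; c_ B; d_ B; e B] -> forall X : R, 0 < X ->
    (a B <= X%:E)%E -> (z <= (C * X)%:E)%E.
  rewrite !inE => hz X X0 hX; case/or4P: hz => [/eqP->|/eqP->|/eqP->|/orP[]/eqP->].
  - by apply: (up 1) => //; [rewrite /C; lra|rewrite mul1r].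
  - by apply: (up Cb) (hb B hB X X0 hX) => //; rewrite /C; lra.
  - by apply: (up Cc) (hc B hB X X0 hX) => //; rewrite /C; lra.
  - by apply: (up Cd) (hd B hB X X0 hX) => //; rewrite /C; lra.
  - by apply: (up Ce) (he B hB X X0 hX) => //; rewrite /C; lra.
have to_a z : z \in [:: a B; b B; c_ B; d_ B; e B] -> forall X : R, 0 < X ->
    (z <= X%:E)%E -> (a B <= (D * X)%:E)%E.
  rewrite !inE => hz X X0; case/or4P: hz => [/eqP->|/eqP->|/eqP->|/orP[]/eqP->] hX.
  - by apply: (up 1) => //; [rewrite /D; lra|rewrite mul1r].
  - by apply: (up Db) (kb B hB X X0 hX) => //; rewrite /D; lra.
  - by apply: (up Dc) (kc B hB X X0 hX) => //; rewrite /D; lra.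
  - by apply: (up Dd) (kd B hB X X0 hX) => //; rewrite /D; lra.
  - by apply: (up De) (ke B hB X X0 hX) => //; rewrite /D; lra.
move=> hx hy; apply: le_mul_of_bounds; first exact: mulr_gt0.
  have [] := bmo_ge0 B; move: hy; rewrite !inE.
  by case/or4P => [/eqP->|/eqP->|/eqP->|/orP[]/eqP->].
move=> X X0 hX; rewrite -mulrA; apply: (from_a _ hx); first exact: mulr_gt0.
exact: (to_a _ hy).
Qed.

End equivalence.

Theorem corollary4p7 (R : realType) (d n : nat) (p q : R)
    (U V : euclid R d -> 'M[R[i]]_n)
    (c : R) (rU rV rV' : cube R d -> 'M[R[i]]_n) :
  (0 < d)%N -> (0 < n)%N ->
  1 < p -> p^-1 + q^-1 = 1 ->
  matrix_Ap p q U -> matrix_Ap p q V ->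
  0 < c ->
  reducing c p p^-1 U rU ->
  reducing c p p^-1 V rV ->
  reducing c q (- p^-1) V rV' ->
  exists2 C : R, 0 < C &
    forall B : euclid R d -> 'M[R[i]]_n, mx_locally_integrable B ->
      {in [:: bmo_a rU rV B; bmo_b p V rU B; bmo_c p q U rV' B;
              bmo_d p q U V B; bmo_e p q U V B] &,
        forall x y : \bar R, (x <= C%:E * y)%E}.
Proof.
move=> _ _ p1 pq [wU AU] [wV AV] c0 /reducing_reduces hU /reducing_reduces hV.
move=> /reducing_reduces hV'.
have [KU KU0 hKU] := Ap_char_ApLe AU; have [KV KV0 hKV] := Ap_char_ApLe AV.
have dU := weight_dual_pair p^-1 wU; have dV := weight_dual_pair p^-1 wV.
have tw1 := two_weight_direct p1 pq c0 dV dU KU0 KV0 hKU hKV hU hV hV'.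
have tw2 := two_weight_dual p1 pq c0 dV dU KU0 KV0 hKU hKV hU hV hV'.
have K0 : 0 < Ktw n c KU KV p q by exact: Ktw_gt0.
have q1 := conjugate_gt1 p1 pq.
pose KP := 1 + Kprod n c p q KV.
have KP0 : 0 < KP by rewrite ltr_pwDl// Kprod_ge0.
have hKP Q : opnorm (rV' Q *m rV Q) <= KP.
  apply: (le_trans (reduced_prod_le c0 p1 pq dV KV0 (hKV Q) (hV Q) (hV' Q))).
  by rewrite lerDr.
pose KI := 1 + Kred n c q * Kred n c p.
have KI0 : 0 < KI by rewrite ltr_pwDl// mulr_ge0// Kred_ge0.
have hKI Q : opnorm (invmx (rV' Q) *m invmx (rV Q)) <= KI.
  apply: (le_trans (reduced_inv_prod_le c0 p1 pq dV (hV Q) (hV' Q))).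
  by rewrite lerDr.
have rU_adj Q : (rU Q) ^t* = rU Q by have [] := hU Q.
have rV_adj Q : (rV Q) ^t* = rV Q by have [] := hV Q.
have rV'_adj Q : (rV' Q) ^t* = rV' Q by have [] := hV' Q.
have [C C0 h] := bmo_equivalent p1 q1 pq c0 K0 tw1 tw2 rU_adj rV_adj rV'_adj KP0 hKP KI0 hKI.
exists C => // B hB; apply: h => Q; exact: loc_mxinteg.
Qed.
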